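(* Let $n\ge0$ and let $\boldsymbol{p}_{Th}^n\in\boldsymbol{Q}_h$, $\boldsymbol{p}_h^n\in\boldsymbol{Q}_h^0$, $f^{n+1}\in[L^2(\Omega)]^d$, $g^{n+1}\in L^2(\Omega)$ be given. Then, for either the HDG or the EDG-HDG spaces, there exists a unique solution $(\boldsymbol{u}_h^{n+1},\boldsymbol{p}_{Th}^{n+1},z_h^{n+1},\boldsymbol{p}_h^{n+1})\in\boldsymbol{X}_h$ of the fully discrete (backward Euler) problem $$a_h(\boldsymbol{u}_h^{n+1},\boldsymbol{v}_h)+b_h(\boldsymbol{v}_h,\boldsymbol{p}_{Th}^{n+1})=(f^{n+1},v_h)_\Omega,$$ $$b_h(\boldsymbol{u}_h^{n+1},\boldsymbol{q}_{Th})+\lambda^{-1}(\alpha p_h^{n+1}-p_{Th}^{n+1},q_{Th})_\Omega=0,$$ $$(\kappa^{-1}z_h^{n+1},w_h)_\Omega+b_h((w_h,0),\boldsymbol{p}_h^{n+1})=0,$$ $$\tfrac1{\Delta t}\big((c_0p_h^{n+1},q_h)_\Omega+\lambda^{-1}(\alpha p_h^{n+1}-p_{Th}^{n+1},\alpha q_h)_\Omega\big)-b_h((z_h^{n+1},0),\boldsymbol{q}_h)=\tfrac1{\Delta t}\big((c_0p_h^n,q_h)_\Omega+\lambda^{-1}(\alpha p_h^n-p_{Th}^n,\alpha q_h)_\Omega\big)+(g^{n+1},q_h)_\Omega$$ for all $(\boldsymbol{v}_h,\boldsymbol{q}_{Th},w_h,\boldsymbol{q}_h)\in\boldsymbol{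X}_h$.
   Context: **Domain and parameters.** $\Omega\subset\mathbb{R}^d$, $d\in\{2,3\}$, is a bounded polygonal (polyhedral) domain whose boundary is partitioned as $\partial\Omega=\overline{\Gamma}_P\cup\overline{\Gamma}_F=\overline{\Gamma}_D\cup\overline{\Gamma}_T$ with $\Gamma_P\cap\Gamma_F=\emptyset$, $|\Gamma_P|>0$, $\Gamma_D\cap\Gamma_T=\emptyset$, $|\Gamma_D|>0$. The constants are $\Delta t>0$ (time step), $\kappa>0$, $c_0\ge0$, $0<\alpha<1$, and the Lamé constants $\lambda=E\nu/((1+\nu)(1-2\nu))>0$, $\mu=E/(2(1+\nu))>0$ with $0<\nu_*\le\nu<1/2$. **Mesh and inner products.** $\mathcal{T}_h$ is a member of a shape-regular family of simplicial triangulations of $\Omega$ (compatible with the boundary partitions), $h_K$ is the diameter of $K$, $\mathcal{F}_h$ is the set of all facets, and $\Gamma_0$ is their union; $n$ is the outward unit normal on $\partial K$ (as a superscript $n$ denotes the time level). $(\cdot,\cdot)_\Omega$ and $\|\cdot\|_\Omega$ are the (elementwise summed) $L^2$ inner product and norm; $\langle\phi,\psi\rangle_{\partial\mathcal{T}_h}=\sum_K\langle\phi,\psi\rangle_{\partial K}$. Differential operators on discrete functions are applied elementwise; $\varepsilon(v)=\frac12(\nabla v+\nabla v^T)$. **Spaces** (integer $k\ge1$; $\mathbb{P}_l$ = polynomials of degree $\le l$): $V_h=\{v_h\in[L^2(\Omega)]^d: v_h|_K\in[\mathbb{P}_k(K)]^d\ \forall K\}$; $\bar V_h=\{\bar v_h\in[L^2(\Gamma_0)]^d:\bar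 v_h|_F\in[\mathbb{P}_k(F)]^d\ \forall F\in\mathcal{F}_h,\ \bar v_h=0\text{ on }\Gamma_D\}$ (HDG method), or this space intersected with $[C^0(\Gamma_0)]^d$ (EDG-HDG method); $Q_h=\{q_h\in L^2(\Omega):q_h|_K\in\mathbb{P}_{k-1}(K)\ \forall K\}$; $\bar Q_h=\{\bar q_h\in L^2(\Gamma_0):\bar q_h|_F\in\mathbb{P}_k(F)\ \forall F\}$; $\bar Q_h^0=\{\bar q_h\in\bar Q_h:\bar q_h=0\text{ on }\Gamma_P\}$. $\boldsymbol{V}_h=V_h\times\bar V_h$, $\boldsymbol{Q}_h=Q_h\times\bar Q_h$, $\boldsymbol{Q}_h^0=Q_h\times\bar Q_h^0$, $\boldsymbol{X}_h=\boldsymbol{V}_h\times\boldsymbol{Q}_h\times V_h\times\boldsymbol{Q}_h^0$. Boldface denotes element/facet pairs, e.g. $\boldsymbol{v}_h=(v_h,\bar v_h)$. **Bilinear forms.** $$a_h(\boldsymbol{u},\boldsymbol{v})=(2\mu\varepsilon(u),\varepsilon(v))_\Omega+\sum_K\langle\tfrac{2\beta\mu}{h_K}(u-\bar u),v-\bar v\rangle_{\partial K}-\langle2\mu\varepsilon(u)n,v-\bar v\rangle_{\partial\mathcal{T}_h}-\langle2\mu\varepsilon(v)n,u-\bar u\rangle_{\partial\mathcal{T}_h},$$ $$b_h(\boldsymbol{v},\boldsymbol{q})=-(q,\nabla\cdot v)_\Omega+\langle\bar q,(v-\bar v)\cdot n\rangle_{\partial\mathcal{T}_h}.$$ The penalty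 parameter satisfies $\beta>\beta_0$, where $\beta_0>0$ is such that for $\beta>\beta_0$ there is a constant $c>0$ independent of $h$ with $a_h(\boldsymbol{v}_h,\boldsymbol{v}_h)\ge c\mu\big(\|\varepsilon(v_h)\|_\Omega^2+\sum_Kh_K^{-1}\|v_h-\bar v_h\|_{\partial K}^2\big)$ for all $\boldsymbol{v}_h\in\boldsymbol{V}_h$. *)

(* Defs.v *)
From HB Require Import structures.
From mathcomp Require Import all_boot all_order all_algebra.
From mathcomp Require Import all_classical all_reals all_analysis.
(* Not imported: its notations clash with those of MathComp-Analysis. *)
From mathcomp Require Import -(notations) mpoly.
Set Implicit Arguments.
Unset Strict Implicit.
Unset Printing Implicit Defensive.
Import Order.TTheory GRing.Theory Num.Theory.
Import numFieldNormedType.Exports.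
Local Open Scope classical_set_scope.
Local Open Scope ring_scope.

Section Lebesgue.
Variable R : realType.

Lemma measurable_consr n :
  measurable_fun [set: n.-tuple (measurableTypeR R) * measurableTypeR R]
    (fun y => [the n.+1.-tuple (measurableTypeR R) of y.2 :: y.1]).
Proof. by apply: measurable_cons. Qed.

(* Lebesgue measure on R^n: the n-fold product of the one-dimensional one,
   transported to n.-tuple R with its product sigma-algebra. *)
Fixpoint lebn n : {measure set (n.-tuple (measurableTypeR R)) -> \bar R} :=
  match n with
  | 0 => dirac [tuple]
  | m.+1 => measure_function_pushforward__canonical__measure_function_Measure
              (product_measure1 (lebn m) (@lebesgue_measure R))
              (@measurable_consr m)
  end.

(* The library puts the measurable structure on n.-tuple R and the linear and
   topological structures on 'rV[R]_n; [rVt] identifies the two. *)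
Definition rVt n (t : n.-tuple (measurableTypeR R)) : 'rV[R]_n :=
  \row_i tnth t i.

Definition borel n (A : set 'rV[R]_n) : Prop :=
  measurable (@rVt n @^-1` A).

Definition rVint n (A : set 'rV[R]_n) (f : 'rV[R]_n -> R) : R :=
  Rintegral (lebn n) (@rVt n @^-1` A) (f \o @rVt n).

Definition L2 n (A : set 'rV[R]_n) (f : 'rV[R]_n -> R) : Prop :=
  patch (fun=> 0) (@rVt n @^-1` A) (f \o @rVt n) \in Lfun (lebn n) 2%:E.

End Lebesgue.

Section Geometry.
Variable R : realType.

Definition dot d (x y : 'rV[R]_d) : R := \sum_i x 0 i * y 0 i.

(* The library norm on 'rV is the max norm. *)
Definition enorm d (x : 'rV[R]_d) : R := Num.sqrt (dot x x).

Definition hull d (I : finType) (x : I -> 'rV[R]_d) (A : {set I}) :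
    set 'rV[R]_d :=
  [set y | exists c : I -> R,
     [/\ forall i, i \in A -> 0 <= c i,
         \sum_(i in A) c i = 1 &
         y = \sum_(i in A) c i *: x i]].

Definition affine_indep d (I : finType) (x : I -> 'rV[R]_d) (A : {set I}) :=
  forall c : I -> R,
    \sum_(i in A) c i = 0 -> \sum_(i in A) c i *: x i = 0 ->
    forall i, i \in A -> c i = 0.

Definition diam d (A : set 'rV[R]_d) : R :=
  sup [set r | exists y z, [/\ A y, A z & r = enorm (y - z)]].

(* Diameter of the largest ball contained in A. *)
Definition indiam d (A : set 'rV[R]_d) : R :=
  sup [set r | exists c rho, [/\ 0 <= rho,
         [set y | enorm (y - c) <= rho] `<=` A & r = 2 * rho]].

Definition bdry d (Om : set 'rV[R]_d) : set 'rV[R]_d := closure Om `\` Om.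

(* A bounded polygonal/polyhedral domain. Regular openness excludes slits, so
   that Om lies locally on one side of the flat parts of its boundary. *)
Definition polyhedral_domain d (Om : set 'rV[R]_d) : Prop :=
  [/\ open Om, connected Om & Om !=set0] /\
  [/\ Om = interior (closure Om),
      exists M : R, forall x, Om x -> enorm x <= M &
      exists m (S : 'I_m -> 'I_d.+1 -> 'rV[R]_d),
        (forall j, affine_indep (S j) [set: 'I_d.+1]%SET) /\
        closure Om = [set y | exists j, hull (S j) [set: 'I_d.+1]%SET y]].

(* Conforming simplicial complexes; a cell is given by its set of vertices. *)
Record mesh d := Mesh {
  nvert : nat;
  vert : 'I_nvert -> 'rV[R]_d;
  cells : {set {set 'I_nvert}};
  cells_card : forall K, K \in cells -> #|K| = d.+1;
  cells_indep : forall K, K \in cells -> affine_indep vert K;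
  cells_conform : forall K K', K \in cells -> K' \in cells ->
    hull vert K `&` hull vert K' = hull vert (K :&: K')%SET }.

Variable d : nat.
Implicit Types (T : mesh d) (Om : set 'rV[R]_d).

Definition facets T : {set {set 'I_(nvert T)}} :=
  [set F : {set 'I_(nvert T)} | (#|F| == d) &&
     [exists K : {set 'I_(nvert T)}, (K \in cells T) && (F \subset K)]]%SET.

Definition cell T := {K : {set 'I_(nvert T)} | K \in cells T}.
Definition facet T := {F : {set 'I_(nvert T)} | F \in facets T}.

Definition cset T (K : cell T) : set 'rV[R]_d := hull (@vert d T) (val K).
Definition fset T (F : facet T) : set 'rV[R]_d := hull (@vert d T) (val F).
Definition inc T (F : facet T) (K : cell T) : bool := val F \subset val K.

Definition skeleton T : set 'rV[R]_d := [set x | exists F : facet T, fset F x].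

Definition triangulates T Om : Prop :=
  closure Om = [set x | exists K : cell T, cset K x].

Definition hK T (K : cell T) : R := diam (cset K).

Definition shape_regular (I : Type) (Th : I -> mesh d) : Prop :=
  exists sigma : R, forall i (K : cell (Th i)), hK K <= sigma * indiam (cset K).

(* Each boundary facet belongs to one of the two parts. *)
Definition compatible T Om (G1 G2 : set 'rV[R]_d) : Prop :=
  forall F : facet T, fset F `<=` bdry Om ->
    fset F `<=` closure G1 \/ fset F `<=` closure G2.

Definition bdry_partition Om (G1 G2 : set 'rV[R]_d) : Prop :=
  [/\ borel G1, borel G2, bdry Om = closure G1 `|` closure G2 &
      G1 `&` G2 = set0].

(* Outward unit normal of the cell K on its facet F. *)
Definition normal T (K : cell T) (F : facet T) : 'rV[R]_d :=
  xget 0 [set n | [/\ dot n n = 1,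
    forall a b, a \in val F -> b \in val F -> dot n (vert a - vert b) = 0 &
    forall a b, a \in val F -> b \in val K -> b \notin val F ->
      dot n (vert b - vert a) < 0]].

(* Surface integration on the facet F with vertices a_0, ..., a_(d-1), through
   the affine parametrization t |-> a_0 + sum_i t_i (a_(i+1) - a_0) of F by the
   reference simplex of R^(d-1), whose area element is sqrt (det Gram). *)
Definition refsimplex m : set 'rV[R]_m :=
  [set t | (forall i, 0 <= t 0 i) /\ \sum_i t 0 i <= 1].

Definition fpt T (F : facet T) (i : nat) : 'rV[R]_d :=
  [seq vert v | v <- enum (val F)]`_i.

Definition fparam T (F : facet T) (t : 'rV[R]_d.-1) : 'rV[R]_d :=
  fpt F 0 + \sum_i t 0 i *: (fpt F i.+1 - fpt F 0).

Definition farea_elt T (F : facet T) : R :=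
  Num.sqrt (\det (\matrix_(i < d.-1, j < d.-1)
    dot (fpt F i.+1 - fpt F 0) (fpt F j.+1 - fpt F 0))).

Definition fint T (F : facet T) (phi : 'rV[R]_d -> R) : R :=
  farea_elt F * rVint (@refsimplex d.-1) (phi \o fparam F).

Definition farea T (F : facet T) (A : set 'rV[R]_d) : \bar R :=
  ((farea_elt F)%:E * lebn R d.-1
    [set t | refsimplex (rVt t) /\ A (fparam F (rVt t))])%E.

(* Surface measure of G, a subset of the boundary: distinct facets overlap in
   null sets, and interior facets meet the boundary in null sets. *)
Definition surf T (G : set 'rV[R]_d) : \bar R := (\sum_(F : facet T) farea F G)%E.

(* phi vanishes surface-almost everywhere on the part of F lying in G. *)
Definition vanishes_on T (F : facet T) (G : set 'rV[R]_d)
    (phi : 'rV[R]_d -> R) : Prop :=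
  {ae lebn R d.-1, forall t, refsimplex (rVt t) -> G (fparam F (rVt t)) ->
    phi (fparam F (rVt t)) = 0}.

(* Discrete functions. An element of L^2(Om) which is a polynomial on each cell
   is represented by the family of these polynomials (cells have nonempty
   interior); traces on the boundary of K and elementwise derivatives are those
   of the polynomial of K. An element of L^2(Gamma_0) which is a polynomial on
   each facet F is represented by the family of its restrictions to the facets,
   each extended by 0 outside of F. Both representations are unique, so that
   equality of representatives is equality in L^2. *)
Notation pol := (mpoly.mpoly d R).

Definition ev (p : pol) (x : 'rV[R]_d) : R := mpoly.meval (fun i => x 0 i) p.

Definition Pol (l : nat) : set pol := [set p | (mpoly.msize p <= l.+1)%N].

Definition PolOn (l : nat) (A : set 'rV[R]_d) : set ('rV[R]_d -> R) :=
  [set phi | exists2 p, Pol l p & phi = patch (fun=> 0) A (ev p)].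

Definition evec T := cell T -> 'I_d -> pol.
Definition fvec T := facet T -> 'I_d -> 'rV[R]_d -> R.
Definition esca T := cell T -> pol.
Definition fsca T := facet T -> 'rV[R]_d -> R.

Inductive method := HDG | EDG_HDG.

Definition Vh T (k : nat) : set (evec T) :=
  [set v | forall K i, Pol k (v K i)].

Definition Vbar_hdg T (k : nat) (GD : set 'rV[R]_d) : set (fvec T) :=
  [set v | forall F i, PolOn k (fset F) (v F i) /\ vanishes_on F GD (v F i)].

(* Membership in [C^0(Gamma_0)]^d. *)
Definition C0skel T : set (fvec T) :=
  [set v | forall i, exists2 g : 'rV[R]_d -> R,
     {within skeleton T, continuous g} & forall F x, fset F x -> v F i x = g x].

Definition Vbar T (k : nat) (m : method) (GD : set 'rV[R]_d) : set (fvec T) :=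
  match m with
  | HDG => @Vbar_hdg T k GD
  | EDG_HDG => @Vbar_hdg T k GD `&` @C0skel T
  end.

Definition Qh T (k : nat) : set (esca T) := [set q | forall K, Pol k.-1 (q K)].
Definition Qbar T (k : nat) : set (fsca T) :=
  [set q | forall F, PolOn k (fset F) (q F)].
Definition Qbar0 T (k : nat) (GP : set 'rV[R]_d) : set (fsca T) :=
  [set q | Qbar k q /\ forall F, vanishes_on F GP (q F)].

Definition bVh T k m GD : set (evec T * fvec T) := Vh k `*` Vbar k m GD.
Definition bQh T k : set (esca T * fsca T) := Qh k `*` Qbar k.
Definition bQh0 T k GP : set (esca T * fsca T) := Qh k `*` Qbar0 k GP.

Definition Xcarrier T : Type :=
  ((evec T * fvec T) * (esca T * fsca T) * evec T * (esca T * fsca T))%type.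
Definition Xh T k m GD GP : set (Xcarrier T) :=
  bVh k m GD `*` bQh k `*` Vh k `*` bQh0 k GP.

Definition eps (v : 'I_d -> pol) (i j : 'I_d) : pol :=
  2^-1 *: (mpoly.mderiv j (v i) + mpoly.mderiv i (v j)).
Definition divg (v : 'I_d -> pol) : pol := \sum_i mpoly.mderiv i (v i).

(* (phi, 1)_Om, elementwise summed, and <phi, 1>_{bdry K}. *)
Definition intOm T (phi : cell T -> 'rV[R]_d -> R) : R :=
  \sum_(K : cell T) rVint (cset K) (phi K).
Definition intbd T (K : cell T) (phi : facet T -> 'rV[R]_d -> R) : R :=
  \sum_(F : facet T | inc F K) fint F (phi F).

Definition ipQ T (p q : esca T) : R :=
  intOm (fun K x => ev (p K) x * ev (q K) x).
Definition ipV T (u v : evec T) : R :=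
  intOm (fun K x => \sum_i ev (u K i) x * ev (v K i) x).
(* The data f and g are only constrained on the open set Om, hence K `&` Om. *)
Definition ipL2Q T Om (g : 'rV[R]_d -> R) (q : esca T) : R :=
  \sum_(K : cell T) rVint (cset K `&` Om) (fun x => g x * ev (q K) x).
Definition ipL2V T Om (f : 'I_d -> 'rV[R]_d -> R) (v : evec T) : R :=
  \sum_(K : cell T)
    rVint (cset K `&` Om) (fun x => \sum_i f i x * ev (v K i) x).
Definition ipeps T (u v : evec T) : R :=
  intOm (fun K x => \sum_i \sum_j ev (eps (u K) i j) x * ev (eps (v K) i j) x).

(* The i-th component of u - ubar on the facet F of K. *)
Definition jmp T (u : evec T * fvec T) (K : cell T) (F : facet T) (i : 'I_d)
    (x : 'rV[R]_d) : R :=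
  ev (u.1 K i) x - u.2 F i x.

(* <2 mu eps(u) n, v - vbar>_{bdry T_h} *)
Definition consist T (mu : R) (u v : evec T * fvec T) : R :=
  \sum_(K : cell T) intbd K (fun F x =>
    \sum_i (2 * mu * \sum_j ev (eps (u.1 K) i j) x * normal K F 0 j)
           * jmp v K F i x).

Definition a_h T (beta mu : R) (u v : evec T * fvec T) : R :=
  2 * mu * ipeps u.1 v.1
  + \sum_(K : cell T) intbd K (fun F x =>
      2 * beta * mu / hK K * \sum_i jmp u K F i x * jmp v K F i x)
  - consist mu u v
  - consist mu v u.

Definition b_h T (v : evec T * fvec T) (q : esca T * fsca T) : R :=
  - intOm (fun K x => ev (q.1 K) x * ev (divg (v.1 K)) x)
  + \sum_(K : cell T) intbd K (fun F x =>
      q.2 F x * \sum_i jmp v K F i x * normal K F 0 i).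

(* ||eps(v_h)||^2 + sum_K h_K^-1 ||v_h - vbar_h||^2_{bdry K} *)
Definition energy T (v : evec T * fvec T) : R :=
  ipeps v.1 v.1
  + \sum_(K : cell T) (hK K)^-1 *
      intbd K (fun F x => \sum_i jmp v K F i x ^+ 2).

Definition nofacet T (w : evec T) : evec T * fvec T := (w, fun _ _ _ => 0).

Definition scale T (a : R) (p : esca T) : esca T := fun K => a *: p K.
Definition comb T (a : R) (p pT : esca T) : esca T := fun K => a *: p K - pT K.

Definition solves T (k : nat) (m : method) (Om GD GP : set 'rV[R]_d)
    (beta lam mu alpha kappa c0 dt : R)
    (pTn pn : esca T * fsca T)
    (f : 'I_d -> 'rV[R]_d -> R) (g : 'rV[R]_d -> R)
    (X : Xcarrier T) : Prop :=
  let: (u, pT, z, p) := X in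
  forall Y : Xcarrier T, Xh k m GD GP Y ->
  let: (v, qT, w, q) := Y in
  [/\ a_h beta mu u v + b_h v pT = ipL2V Om f v.1,
      b_h u qT + lam^-1 * ipQ (comb alpha p.1 pT.1) qT.1 = 0,
      kappa^-1 * ipV z w + b_h (nofacet w) p = 0 &
      dt^-1 * (ipQ (scale c0 p.1) q.1
               + lam^-1 * ipQ (comb alpha p.1 pT.1) (scale alpha q.1))
        - b_h (nofacet z) q
      = dt^-1 * (ipQ (scale c0 pn.1) q.1
               + lam^-1 * ipQ (comb alpha pn.1 pTn.1) (scale alpha q.1))
        + ipL2Q Om g q.1].

End Geometry.

(* Main.v *)
(* The discrete problem is a square linear system, so it suffices that the homogeneous
   problem has only the trivial solution. Testing it with its own solution makes the
   energy of u, the element part of alpha p - p_T and z vanish. The rest is propagated from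
   facet to facet, without integration by parts. If ubar = 0 on a facet F of K then u, being
   strain-free and zero on F, vanishes on K, hence ubar vanishes on all facets of K. If
   pbar = 0 on a facet F of K opposite to the vertex a, the test field (x - a) q, with q such
   that its divergence is p, has no flux through the other facets, so that p = 0 on K; then
   edge-directed test fields show that pbar vanishes on all facets of K. The propagation
   starts on Gamma_D and on Gamma_P, where a polynomial vanishing almost everywhere on a set
   of positive surface measure is zero, and reaches every facet because Om is connected
   and sets of codimension two do not disconnect it. *)

(* Two obstacles shape the argument. First, c_0 may vanish and p_T carries no boundary condition, so
   the energy identity alone controls neither pressure: p is recovered from the Darcy equation once
   z = 0, the element part of p_T then equals that of alpha p and vanishes, and the facet part of
   p_T follows cell by cell from the momentum equation with u = 0. Second, the continuity built into
   the EDG-HDG facet space would restrict test functions. Every field used to recover a pressure is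
   therefore supported in one cell and has zero facet component; such fields are admissible in both
   versions of [Vbar], so one proof covers both methods. Integrals enter mainly through linearity,
   positivity, and the fact that a nonnegative polynomial with zero integral is zero. The last fact
   rests on zero sets of nonzero polynomials being null sets, which also starts the propagation. The
   drop of one degree from velocities to element pressures is what lets (x - a) q be an admissible
   field whose divergence is any prescribed element pressure. *)
Require Import Defs.
From HB Require Import structures.
From mathcomp Require Import all_boot all_order all_algebra.
From mathcomp Require Import all_classical all_reals all_analysis.
From mathcomp Require Import measurable_realfun ring lra.
From mathcomp Require Import -(notations) mpoly.
Set Implicit Arguments.
Unset Strict Implicit.
Unset Printing Implicit Defensive.
Import Order.TTheory GRing.Theory Num.Theory.
Import numFieldNormedType.Exports.
Local Open Scope classical_set_scope.
Local Open Scope ring_scope.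

(** * Finite-dimensional variational problems *)

Section FiniteSpan.
Variable F : fieldType.

Definition submodset (V : lmodType F) (S : set V) : Prop :=
  S 0 /\ forall (a : F) u v, S u -> S v -> S (a *: u + v).

(** Only containment in a finite span is asked, so the property passes to subsets: boundary
    conditions and continuity constraints can be forgotten when it is checked. *)
Definition fspan (V : lmodType F) (S : set V) : Prop :=
  exists (J : finType) (e : J -> V),
    forall v, S v -> exists c : J -> F, v = \sum_j c j *: e j.

Lemma fspanS (V : lmodType F) (S S' : set V) : S `<=` S' -> fspan S' -> fspan S.
Proof. by move=> SS' [J [e h]]; exists J, e => v /SS' /h. Qed.

Lemma fspan_prod (V W : lmodType F) (S : set V) (S' : set W) :
  fspan S -> fspan S' -> fspan (S `*` S').
Proof.
move=> [J [e he]] [J' [e' he']].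
exists (J + J')%type, (fun j => match j with inl i => (e i, 0) | inr i => (0, e' i) end).
move=> [v w] [/= /he [c ->] /he' [c' ->]].
exists (fun j => match j with inl i => c i | inr i => c' i end).
rewrite big_sumType /=.
have h1 : \sum_i c i *: ((e i, 0) : V * W) = (\sum_i c i *: e i, 0).
  rewrite [LHS]surjective_pairing; congr pair.
    by rewrite (raddf_sum (@fst V W)).
  by rewrite (raddf_sum (@snd V W)) /= big1 // => i _; rewrite scaler0.
have h2 : \sum_i c' i *: ((0, e' i) : V * W) = (0, \sum_i c' i *: e' i).
  rewrite [LHS]surjective_pairing; congr pair.
    by rewrite (raddf_sum (@fst V W)) /= big1 // => i _; rewrite scaler0.
  by rewrite (raddf_sum (@snd V W)).
by rewrite h1 h2 /GRing.add /= /add_pair /= addr0 add0r.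
Qed.

Lemma fspan_fun (I : finType) (V : lmodType F) (S : I -> set V) :
  (forall i, fspan (S i)) ->
  fspan ([set f | forall i, S i (f i)] : set (I -> V)).
Proof.
move=> h.
pose J i := sval (cid (h i)).
pose e i := sval (cid (svalP (cid (h i)))).
have he i v : S i v -> exists c : J i -> F, v = \sum_j c j *: e i j :=
  svalP (cid (svalP (cid (h i)))) v.
exists {i : I & J i}, (fun j i => if tag j == i then e (tag j) (tagged j) else 0).
move=> f hf; pose c i := sval (cid (he i (f i) (hf i))).
exists (fun j => c (tag j) (tagged j)); apply: funext => i.
rewrite fct_sumE.
rewrite -(sig_big_dep (fun _ => true) (fun _ _ => true)
  (fun i0 j => (c i0 j *: (fun i => if i0 == i then e i0 j else 0) : I -> V) i)) /=.
rewrite (bigD1 i) //= [X in _ + X]big1 ?addr0; last first.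
  by move=> i' /negPf ni; apply: big1 => j _; rewrite /GRing.scale /= ni scaler0.
rewrite (svalP (cid (he i (f i) (hf i)))).
by apply: eq_bigr => j _; rewrite [RHS]/GRing.scale /= eqxx.
Qed.

Lemma fspan_image (V W : lmodType F) (S : set V) (f : {linear V -> W}) :
  fspan S -> fspan [set f v | v in S].
Proof.
move=> [J [e he]]; exists J, (f \o e) => _ [v /he [c ->] <-].
by exists c; rewrite linear_sum; apply: eq_bigr => j _; rewrite linearZ.
Qed.

(* The basis consists of a maximal family in S that is independent; its size is bounded by
   that of the spanning family. *)
Lemma fspan_basis (V : lmodType F) (S : set V) : submodset S -> fspan S ->
  exists r (b : 'I_r -> V), [/\ forall i, S (b i),
    forall c : 'I_r -> F, \sum_i c i *: b i = 0 -> forall i, c i = 0 &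
    forall v, S v -> exists c : 'I_r -> F, v = \sum_i c i *: b i].
Proof.
move=> [S0 Slin] [J [e he]].
pose indep r (b : 'I_r -> V) := (forall i, S (b i)) /\
  forall c : 'I_r -> F, \sum_i c i *: b i = 0 -> forall i, c i = 0.
pose P r := `[< exists b : 'I_r -> V, indep r b >].
have P0 : exists r, P r.
  by exists 0%N; apply/asboolP; exists (fun=> 0); split => [[]|c _ []].
have Pub r : P r -> (r <= #|J|)%N.
  move=> /asboolP [b [bS bi]].
  pose C i := cid (he _ (bS i)).
  (* The rows of [M] are the coordinates of the [b i] along [e]; a left kernel vector is a linear
     relation among the [b i], hence zero. *)
  pose M := \matrix_(i < r, j < #|J|) sval (C i) (enum_val j).
  suff : row_free M by move=> /eqP <-; apply: rank_leq_col.
  rewrite -kermx_eq0; apply/eqP/row_matrixP => k; rewrite row0.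
  set c := row k _.
  have cM : c *m M = 0 by apply/sub_kermxP; apply: row_sub.
  apply/rowP => i; rewrite [RHS]mxE; apply: (bi (c 0)).
  under eq_bigr do rewrite (svalP (C _)) scaler_sumr.
  rewrite exchange_big big1 //= => j _.
  under eq_bigr do rewrite scalerA.
  rewrite -scaler_suml; have /rowP /(_ (enum_rank j)) := cM.
  rewrite !mxE => h; rewrite -[RHS](scale0r (e j)) -[in RHS]h; congr (_ *: _).
  by apply: eq_bigr => i' _; rewrite !mxE enum_rankK.
have [r /asboolP [b [bS bi]] rmax] := ex_maxnP P0 Pub.
exists r, b; split => // v Sv.
apply: contrapT => nv.
suff /rmax : P r.+1 by rewrite ltnn.
(* A vector outside the span, put in front of the family, gives a longer independent one and
   contradicts maximality. *)
apply/asboolP; exists (fun i => if unlift ord0 i is Some j then b j else v); split.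
  by move=> i; case: unliftP.
move=> c; rewrite big_ord_recl unlift_none.
under eq_bigr do rewrite liftK.
move=> h.
have c0 : c ord0 = 0.
  apply/eqP; apply: contrapT => /negP c0; apply: nv.
  exists (fun i => - (c ord0)^-1 * c (lift ord0 i)).
  under eq_bigr do rewrite -scalerA.
  rewrite -scaler_sumr; move/eqP: h; rewrite addrC addr_eq0 => /eqP ->.
  by rewrite scalerN scaleNr opprK scalerA mulVf // scale1r.
move: h; rewrite c0 scale0r add0r => /bi h i.
by case: (unliftP ord0 i) => [j ->|->].
Qed.

Lemma submodset_sum (V : lmodType F) (S : set V) (J : finType) (c : J -> F) e :
  submodset S -> (forall j, S (e j)) -> S (\sum_j c j *: e j).
Proof.
move=> [S0 Slin] Se; elim/big_ind : _ => //.
- by move=> x y Sx Sy; rewrite -[x]scale1r; apply: Slin.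
- by move=> i _; rewrite -[_ *: _]addr0; apply: Slin.
Qed.

Lemma linear_on_sum (V : lmodType F) (S : set V) (L : V -> F) (J : finType) (c : J -> F) e :
  submodset S ->
  (forall a u v, S u -> S v -> L (a *: u + v) = a * L u + L v) ->
  (forall j, S (e j)) -> L (\sum_j c j *: e j) = \sum_j c j * L (e j).
Proof.
move=> [S0 Slin] Ll Se.
have L0 : L 0 = 0.
  by have := Ll (-1) 0 0 S0 S0; rewrite scaler0 addr0 mulN1r addNr.
suff [] : S (\sum_j c j *: e j) /\ L (\sum_j c j *: e j) = \sum_j c j * L (e j) by [].
apply: (big_rec2 (fun x y => S x /\ L x = y)) => // i y x _ [Sx <-].
by split; [apply: Slin|rewrite Ll].
Qed.

(** Trial and test sets coincide, so the matrix of [B] in a basis of [S] is square; a left kernel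
    vector gives an element of [S] paired to zero with all of [S], and nondegeneracy makes the
    matrix invertible. Linearity is required on [S] only, because integrals are additive only on
    integrable functions. *)
Lemma variational_exists_unique (V : lmodType F) (S : set V) (B : V -> V -> F) (L : V -> F) :
  submodset S -> fspan S ->
  (forall y, S y -> forall a u v, S u -> S v -> B (a *: u + v) y = a * B u y + B v y) ->
  (forall x, S x -> forall a u v, S u -> S v -> B x (a *: u + v) = a * B x u + B x v) ->
  (forall a u v, S u -> S v -> L (a *: u + v) = a * L u + L v) ->
  (forall x, S x -> (forall y, S y -> B x y = 0) -> x = 0) ->
  exists! x, S x /\ forall y, S y -> B x y = L y.
Proof.
move=> Sm Sf Bl Br Ll nd.
have [r [b [bS bi bsp]]] := fspan_basis Sm Sf.
pose G := \matrix_(i < r, j < r) B (b i) (b j).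
have BG (c : 'rV_r) j : B (\sum_i c 0 i *: b i) (b j) = (c *m G) 0 j.
  rewrite (linear_on_sum _ Sm (Bl _ (bS j)) bS) mxE.
  by apply: eq_bigr => i _; rewrite mxE.
have ext x : S x -> (forall j, B x (b j) = L (b j)) -> forall y, S y -> B x y = L y.
  move=> Sx h y /bsp [c ->].
  rewrite (linear_on_sum _ Sm (Br _ Sx) bS) (linear_on_sum _ Sm Ll bS).
  by apply: eq_bigr => i _; rewrite h.
have Gu : G \in unitmx.
  rewrite -row_free_unit -kermx_eq0; apply/eqP/row_matrixP => i; rewrite row0.
  set c := row i _.
  have cG : c *m G = 0 by apply/sub_kermxP; apply: row_sub.
  have cb : \sum_i c 0 i *: b i = 0.
    apply: nd; first exact: submodset_sum.
    move=> y /bsp [c' ->].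
    rewrite (linear_on_sum _ Sm (Br _ _) bS); last exact: submodset_sum.
    by apply: big1 => j _; rewrite BG cG mxE mulr0.
  by apply/rowP => j; rewrite [RHS]mxE; apply: (bi (c 0)).
pose c := (\row_j L (b j)) *m invmx G.
exists (\sum_i c 0 i *: b i); split.
  split; first exact: submodset_sum.
  apply: ext; first exact: submodset_sum.
  by move=> j; rewrite BG -mulmxA mulVmx // mulmx1 mxE.
move=> x [Sx hx]; apply/eqP; rewrite -subr_eq0; apply/eqP.
have SX : S (\sum_i c 0 i *: b i) by exact: submodset_sum.
have BX : forall y, S y -> B (\sum_i c 0 i *: b i) y = L y.
  by apply: ext => // j; rewrite BG -mulmxA mulVmx // mulmx1 mxE.
rewrite addrC -scaleN1r; apply: nd; first by apply Sm.
by move=> y Sy; rewrite (Bl _ Sy) // BX // hx // mulN1r addNr.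
Qed.

End FiniteSpan.

(** * Polynomials *)

Section Polynomials.
Variables (R : realType) (n : nat).
Local Notation pol := (mpoly n R).
Implicit Types (p q : pol) (x : 'rV[R]_n).

Lemma ev0 x : ev (0 : pol) x = 0. Proof. exact: meval0. Qed.
Lemma evC c x : ev (mpolyC n c) x = c. Proof. exact: mevalC. Qed.
Lemma ev1 x : ev (1 : pol) x = 1. Proof. exact: meval1. Qed.
Lemma evX i x : ev (mpolyX R (mnm1 i)) x = x 0 i. Proof. exact: mevalXU. Qed.
Lemma evD p q x : ev (p + q) x = ev p x + ev q x. Proof. exact: mevalD. Qed.
Lemma evN p x : ev (- p) x = - ev p x. Proof. exact: mevalN. Qed.
Lemma evB p q x : ev (p - q) x = ev p x - ev q x. Proof. exact: mevalB. Qed.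
Lemma evM p q x : ev (p * q) x = ev p x * ev q x. Proof. exact: mevalM. Qed.
Lemma evZ c p x : ev (c *: p) x = c * ev p x. Proof. exact: mevalZ. Qed.
Lemma ev_sum (J : Type) (r : seq J) (P : pred J) (f : J -> pol) x :
  ev (\sum_(j <- r | P j) f j) x = \sum_(j <- r | P j) ev (f j) x.
Proof. exact: (raddf_sum (meval (fun i => x 0 i))). Qed.

Lemma mpoly_alg_ind (P : pol -> Prop) :
  (forall c, P (mpolyC n c)) -> (forall i, P (mpolyX R (mnm1 i))) ->
  (forall p q, P p -> P q -> P (p + q)) -> (forall p q, P p -> P q -> P (p * q)) ->
  forall p, P p.
Proof.
move=> PC PX PD PM p; rewrite (mpolyE p).
apply: (big_ind P) => //; first by rewrite -(mpolyC0 n R).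
move=> m _; rewrite -mul_mpolyC; apply: (PM) => //.
rewrite mpolyXE_id; apply: (big_ind P) => //.
  by rewrite -(mpolyC1 n R).
have PXn i k : P (mpolyX R (mnm1 i) ^+ k).
  elim: k => [|k IH]; first by rewrite expr0 -(mpolyC1 n R).
  by rewrite exprS; apply: PM.
by move=> i _; exact: PXn.
Qed.

Lemma PolP l p : Pol l p <-> forall m, mcoeff m p != 0 -> (mdeg m <= l)%N.
Proof.
split=> [pl m|h].
  by rewrite -mcoeff_msupp => /msize_mdeg_lt h; rewrite -ltnS; exact: leq_trans h pl.
rewrite /Pol /= msizeE; apply/bigmax_leqP_seq => m /[!mcoeff_msupp] /h mm _.
by rewrite ltnS.
Qed.

Lemma Pol0 l : Pol l (0 : pol).
Proof. by rewrite /Pol /= msize0. Qed.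

Lemma PolD l p q : Pol l p -> Pol l q -> Pol l (p + q).
Proof.
move=> hp hq; rewrite /Pol /=; apply: leq_trans (msizeD_le _ _) _.
by rewrite geq_max; apply/andP.
Qed.

Lemma PolZ l c p : Pol l p -> Pol l (c *: p).
Proof. by move=> hp; apply: leq_trans (msizeZ_le _ _) _. Qed.

Lemma PolN l p : Pol l p -> Pol l (- p).
Proof. by rewrite /Pol /= msizeN. Qed.

Lemma PolB l p q : Pol l p -> Pol l q -> Pol l (p - q).
Proof. by move=> hp /PolN; apply: PolD. Qed.

Lemma Pol_sum l (J : Type) (r : seq J) (P : pred J) (f : J -> pol) :
  (forall j, P j -> Pol l (f j)) -> Pol l (\sum_(j <- r | P j) f j).
Proof. by move=> h; apply: (big_ind (@Pol R n l)) => //; [exact: Pol0|exact: PolD]. Qed.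

Lemma PolW k l p : (k <= l)%N -> Pol k p -> Pol l p.
Proof. by move=> kl /leq_trans; apply. Qed.

Lemma PolC l (c : R) : Pol l (mpolyC n c).
Proof. by rewrite /Pol /= msizeC; case: (_ != 0). Qed.

Lemma PolX (m : multinom n) : Pol (mdeg m) (mpolyX R m).
Proof. by rewrite /Pol /= msizeX. Qed.

Lemma PolXU (i : 'I_n) : Pol 1 (mpolyX R (mnm1 i)).
Proof. by have := PolX (mnm1 i); rewrite mdeg1. Qed.

Lemma PolM k l p q : Pol k p -> Pol l q -> Pol (k + l) (p * q).
Proof.
move=> /PolP hp /PolP hq; apply/PolP => m.
rewrite -mcoeff_msupp => /msuppM_le /allpairsP [[m1 m2] /= [h1 h2 ->]].
by rewrite mdegD leq_add // (hp, hq) // -mcoeff_msupp.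
Qed.

Lemma Pol_mderiv l i p : Pol l p -> Pol l.-1 (mderiv i p).
Proof.
move=> /PolP hp; apply/PolP => m; rewrite mcoeff_deriv => h.
have /hp : mcoeff (mnm_add m (mnm1 i)) p != 0.
  by apply: contraNneq h => ->; rewrite mul0rn.
by rewrite mdegD mdeg1 addn1; case: l {hp}.
Qed.

(** The inductive step is a linear combination and not a product, since products leave the degree
    bound. *)
Lemma Pol_ind l (P : pol -> Prop) :
  P 0 -> (forall c p q, P p -> P q -> P (c *: p + q)) ->
  (forall m, (mdeg m <= l)%N -> P (mpolyX R m)) ->
  forall p, Pol l p -> P p.
Proof.
move=> P0 PL PX p pl; rewrite (mpolyE p) big_seq.
apply: (big_ind P) => // [p1 p2 h1 h2|m].
  by rewrite -[p1]scale1r; apply: PL.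
rewrite mcoeff_msupp => /(iffLR (PolP l p) pl) hm.
by rewrite -[_ *: _]addr0; apply: PL => //; apply: PX.
Qed.

Lemma Pol_submod l : submodset (Pol l : set pol).
Proof. by split; [exact: Pol0|move=> a u v hu hv; apply: PolD => //; apply: PolZ]. Qed.

Lemma fspan_Pol l : fspan (Pol l : set pol).
Proof.
exists (bmultinom n l.+1), (fun m => mpolyX R (bmnm m)) => p pl.
exists (fun m => mcoeff (bmnm m) p).
exact: mpolywE.
Qed.

End Polynomials.

Section PolynomialMaps.
Variables (R : realType) (n : nat).
Local Notation pol := (mpoly n R).
Implicit Types (p q : pol) (x : 'rV[R]_n).

Lemma ev_subst (m : nat) (phi : 'rV[R]_m -> 'rV[R]_n) :
  (forall i, exists q : mpoly m R, forall t, ev q t = phi t 0 i) ->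
  forall p, exists q : mpoly m R, forall t, ev q t = ev p (phi t).
Proof.
move=> h p; elim/mpoly_alg_ind: p => [c|i|p q [p' hp] [q' hq]|p q [p' hp] [q' hq]].
- by exists (mpolyC m c) => t; rewrite !evC.
- by have [q hq] := h i; exists q => t; rewrite hq evX.
- by exists (p' + q') => t; rewrite !evD hp hq.
- by exists (p' * q') => t; rewrite !evM hp hq.
Qed.

(** Chain rule along a line: formal partial derivatives become the derivative of a univariate
    polynomial, for which roots can be counted. *)
Lemma ev_line p (y w : 'rV[R]_n) : exists2 q : {poly R},
  (forall t, q.[t] = ev p (y + t *: w)) &
  (forall t, q^`().[t] = \sum_i ev (mderiv i p) (y + t *: w) * w 0 i).
Proof.
elim/mpoly_alg_ind: p => [c|i|p q [p' hp hp'] [q' hq hq']|p q [p' hp hp'] [q' hq hq']].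
- exists c%:P => t; first by rewrite hornerC evC.
  rewrite derivC horner0 big1 // => i _.
  by rewrite mderivC ev0 mul0r.
- exists ((y 0 i)%:P + (w 0 i)%:P * 'X) => t.
    by rewrite hornerD hornerM !hornerC hornerX evX !mxE mulrC.
  rewrite derivD derivC add0r derivM derivC mul0r add0r derivX mulr1 hornerC.
  rewrite (bigD1 i) //= big1 ?addr0 => [|j /negPf ji].
    have -> : mderiv i (mpolyX R (mnm1 i)) = mpolyC n 1.
      apply/mpolyP => m; rewrite mcoeff_deriv mcoeffX mcoeffC mul1r -{1}[mnm1 i]add0m.
      rewrite (inj_eq (@addIm _ _)) eq_sym; case: eqP => [->|_]; last by rewrite mul0rn.
      by rewrite mnm0E.
    by rewrite evC mul1r.
  have -> : mderiv j (mpolyX R (mnm1 i)) = 0.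
    by rewrite mderivX mnm1E eq_sym ji scale0r.
  by rewrite ev0 mul0r.
- exists (p' + q') => t; first by rewrite hornerD hp hq evD.
  rewrite derivD hornerD hp' hq' -big_split; apply: eq_bigr => i _ /=.
  by rewrite mderivD evD mulrDl.
- exists (p' * q') => t; first by rewrite hornerM hp hq evM.
  rewrite derivM hornerD !hornerM hp hq hp' hq' mulr_suml mulr_sumr -big_split.
  apply: eq_bigr => i _ /=.
  by rewrite mderivM evD !evM mulrDl -!mulrA [w 0 i * _]mulrC.
Qed.

(* The divergence of (x - a) q is n q + (x - a) . grad q: up to lower order terms it
   multiplies the top-degree part of q by n + deg q. *)
Lemma euler_surj (a : 'rV[R]_n) l p : (0 < n)%N -> Pol l p -> exists2 q, Pol l q &
  \sum_i mderiv i ((mpolyX R (mnm1 i) - mpolyC n (a 0 i)) * q) = p.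
Proof.
move=> n0.
pose E q := \sum_i mderiv i ((mpolyX R (mnm1 i) - mpolyC n (a 0 i)) * q).
have EL c u v : E (c *: u + v) = c *: E u + E v.
  rewrite /E scaler_sumr -big_split; apply: eq_bigr => i _ /=.
  by rewrite mulrDr mderivD -scalerAr mderivZ.
have E0 : E 0 = 0 by rewrite /E big1 // => i _; rewrite mulr0 mderiv0.
(* The remainder is minus the derivative of the monomial in the direction [a]. The predecessor
   truncates at 0, so the vanishing of the remainder for constants is recorded separately. *)
have EX m : Pol (mdeg m).-1 (E (mpolyX R m) - (n + mdeg m)%:R *: mpolyX R m) /\
    (mdeg m = 0%N -> E (mpolyX R m) - (n + mdeg m)%:R *: mpolyX R m = 0).
  have -> : E (mpolyX R m) - (n + mdeg m)%:R *: mpolyX R m =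
      - \sum_i a 0 i *: mderiv i (mpolyX R m).
    have eqi i : mderiv i ((mpolyX R (mnm1 i) - mpolyC n (a 0 i)) * mpolyX R m) =
        (1 + fun_of_multinom m i)%:R *: mpolyX R m - a 0 i *: mderiv i (mpolyX R m).
      rewrite mulrBl mderivB mul_mpolyC mderivZ; congr (_ - _).
      rewrite -mpolyXD mderivX mnmDE mnm1E eqxx; congr (_ *: mpolyX R _).
      by rewrite addmC addmK.
    rewrite /E (eq_bigr _ (fun i _ => eqi i)) sumrB -scaler_suml -natr_sum big_split /=.
    by rewrite sum1_card card_ord -mdegE addrAC addrN add0r.
  split.
    by apply: PolN; apply: Pol_sum => i _; apply: PolZ; apply: Pol_mderiv; exact: PolX.
  move=> /eqP; rewrite mdeg_eq0 => /eqP ->.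
  by rewrite mpolyX0 big1 ?oppr0 // => i _; rewrite -(mpolyC1 n R) mderivC scaler0.
elim: l p => [|l IH] p pl.
  exists (n%:R^-1 *: p); first exact: PolZ.
  have h : E p = n%:R *: p.
    move: p pl; apply: Pol_ind => [|c p q hp hq|m].
    - by rewrite E0 scaler0.
    - by rewrite EL hp hq scalerDr !scalerA mulrC.
    - by rewrite leqn0 => /eqP m0; have [_ /(_ m0) /eqP] := EX m; rewrite subr_eq0 m0 addn0 => /eqP.
  rewrite -/(E _) -[_ *: p]addr0 EL E0 addr0 h scalerA mulVf ?scale1r //.
  by rewrite pnatr_eq0 -lt0n.
have h : Pol l (E p - (n + l.+1)%:R *: p).
  move: p pl; apply: Pol_ind => [|c p q hp hq|m].
  - by rewrite E0 scaler0 subr0; apply: Pol0.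
  - rewrite EL scalerDr scalerA mulrC -scalerA opprD addrACA -scalerBr.
    by apply: PolD => //; apply: PolZ.
  - rewrite leq_eqVlt => /orP [/eqP ml|ml].
      by have [] := EX m; rewrite ml.
    have [h1 _] := EX m.
    rewrite -(subrK ((n + mdeg m)%:R *: mpolyX R m) (E _)) -addrA -scalerBl.
    apply: PolD; first by apply: (PolW _ h1); rewrite -ltnS (leq_trans _ ml) // ltnS leq_pred.
    by apply: PolZ; apply: (PolW _ (PolX _ m)).
set c : R := (n + l.+1)%:R in h.
have c0 : c != 0 by rewrite pnatr_eq0 addnS.
(* [c^-1 *: p] solves the equation up to [c^-1 *: (E p - c *: p)], whose degree is at most [l]; the
   induction hypothesis supplies the correction. *)
have [q ql hq] := IH _ (PolZ (- c^-1) h).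
exists (c^-1 *: p + q); first by apply: PolD; [exact: PolZ|apply: (PolW _ ql)].
rewrite -/(E _) EL [E q]hq scaleNr scalerBr scalerA mulVf // scale1r.
by rewrite opprB addrC subrK.
Qed.

(** A monomial of positive degree contains some factor x_i, which equals the combination of the i-th
    coordinates of the [a j]; a constant is multiplied by the sum of the [c j], which is 1. On a
    facet this writes a polynomial as a sum of barycentric coordinates times polynomials of one
    degree less, the shape produced by the edge-directed test fields. *)
Lemma barycentric_decomp (J : finType) (a : J -> 'rV[R]_n) l p : Pol l.+1 p ->
  exists2 s : J -> pol, (forall j, Pol l (s j)) &
    forall (c : J -> R), \sum_j c j = 1 ->
      ev p (\sum_j c j *: a j) = \sum_j c j * ev (s j) (\sum_j c j *: a j).
Proof.
move: p; apply: Pol_ind => [|c p q [s sl hs] [s' sl' hs']|m].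
- exists (fun=> 0) => [j|c _]; first exact: Pol0.
  by rewrite ev0 big1 // => j _; rewrite mulr0.
- exists (fun j => c *: s j + s' j) => [j|c' hc'].
    by apply: PolD => //; apply: PolZ.
  rewrite evD evZ hs // hs' // mulr_sumr -big_split; apply: eq_bigr => j _ /=.
  by rewrite evD evZ mulrDr mulrCA.
have [->|m0] := eqVneq m (@mnm0 n) => ml.
  exists (fun=> mpolyC n 1) => [j|c hc]; first exact: PolC.
  by rewrite mpolyX0 ev1; under eq_bigr do rewrite mulr1.
have [i mi] : exists i, fun_of_multinom m i != 0%N.
  apply: contrapT => h; move/negP: m0; apply; apply/eqP/mnmP => i.
  rewrite mnm0E; apply/eqP; apply: contrapT => hi; apply: h; exists i; exact/negP.
set m' := mnm_sub m (mnm1 i).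
have mE : m = mnm_add m' (mnm1 i) by rewrite submK // lep1mP.
have m'l : (mdeg m' <= l)%N by move: ml; rewrite mE mdegD mdeg1 addn1.
exists (fun j => a j 0 i *: mpolyX R m') => [j|c hc].
  by apply: PolZ; apply: (PolW _ (PolX _ _)).
rewrite mE mpolyXD evM evX summxE mulrC mulr_suml; apply: eq_bigr => j _.
by rewrite evZ mxE mulrA.
Qed.

End PolynomialMaps.

(** * Lebesgue measure and integration of polynomials *)

Section LebesgueMeasure.
Variable R : realType.
Local Notation T n := (n.-tuple (measurableTypeR R)).

Lemma rVtE n (t : T n) i : rVt t 0 i = tnth t i.
Proof. by rewrite mxE. Qed.

Lemma measurable_ev n (p : mpoly n R) : measurable_fun [set: T n] (fun t => ev p (rVt t)).
Proof.
elim/mpoly_alg_ind: p => [c|i|p q hp hq|p q hp hq].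
- by rewrite (_ : (fun _ => _) = cst c) // funeqE => t; rewrite evC.
- rewrite (_ : (fun _ => _) = (fun t : T n => tnth t i)); first exact: measurable_tnth.
  by rewrite funeqE => t; rewrite evX rVtE.
- rewrite (_ : (fun _ => _) = (fun t => ev p (rVt t)) \+ (fun t => ev q (rVt t))).
    exact: measurable_funD.
  by rewrite funeqE => t; rewrite evD.
- rewrite (_ : (fun _ => _) = (fun t => ev p (rVt t)) \* (fun t => ev q (rVt t))).
    exact: measurable_funM.
  by rewrite funeqE => t; rewrite evM.
Qed.

(** Holds by conversion: a pushforward of a product measure is by definition the integral of the
    measures of sections. *)
Lemma lebn_cons n (A : set (T n.+1)) : lebn R n.+1 A =
  (\int[lebn R n]_t (@lebesgue_measure R \o
     xsection ((fun y : T n * measurableTypeR R =>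
       [the n.+1.-tuple (measurableTypeR R) of y.2 :: y.1]) @^-1` A)) t)%E.
Proof. by []. Qed.

(* Separates the first variable, the one that [lebn] peels off. *)
Lemma mpoly_split n (p : mpoly n.+1 R) : exists2 Q : {poly (mpoly n R)}, (Q = 0 -> p = 0) &
  forall x (t : T n), ev p (rVt [tuple of x :: t]) =
    (map_poly (meval (fun i => rVt t 0 i)) Q).[x].
Proof.
pose f : {rmorphism R -> {poly (mpoly n R)}} := polyC \o @mpolyC n R.
pose h (i : 'I_n.+1) : {poly (mpoly n R)} :=
  if unlift ord0 i is Some j then (mpolyX R (mnm1 j))%:P else 'X.
pose g : {rmorphism mpoly n R -> mpoly n.+1 R} :=
  mmap (@mpolyC n.+1 R) (fun j => mpolyX R (mnm1 (lift ord0 j))).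
have FM (u v : mpoly n.+1 R) : mmap f h (u * v) = mmap f h u * mmap f h v.
  exact: (rmorphM (mmap f h)).
exists (mmap f h p).
  (* Substituting the first variable back recovers [p], so that [Q = 0] forces [p = 0]. *)
  have gK : (map_poly g (mmap f h p)).[mpolyX R (mnm1 ord0)] = p.
    elim/mpoly_alg_ind: p => [c|i|p q hp hq|p q hp hq].
    - by rewrite mmapC map_polyC hornerC /= mmapC.
    - rewrite mmapX mmap1U /h; case: unliftP => [j ->|->].
        by rewrite map_polyC hornerC /= mmapX mmap1U.
      by rewrite map_polyX hornerX.
    - by rewrite mmapD (rmorphD (map_poly g)) hornerD; congr (_ + _); [exact: hp|exact: hq].
    - by rewrite FM (rmorphM (map_poly g)) hornerM; congr (_ * _); [exact: hp|exact: hq].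
  by move=> p0; rewrite -gK p0 rmorph0 horner0.
move=> x t; set e := map_poly _.
have eD u v : e (u + v) = e u + e v by exact: (rmorphD (map_poly (meval _))).
have eM u v : e (u * v) = e u * e v by exact: (rmorphM (map_poly (meval _))).
elim/mpoly_alg_ind: p => [c|i|p q hp hq|p q hp hq].
- by rewrite evC mmapC /e map_polyC hornerC /= mevalC.
- rewrite evX mmapX mmap1U rVtE /h; case: unliftP => [j ->|->].
    by rewrite /e map_polyC hornerC /= mevalXU rVtE tnthS.
  by rewrite /e map_polyX hornerX.
- by rewrite evD mmapD eD hornerD; congr (_ + _); [exact: hp|exact: hq].
- by rewrite evM FM eM hornerM; congr (_ * _); [exact: hp|exact: hq].
Qed.

Lemma measurable_ev_eq0 n (p : mpoly n R) : measurable [set t : T n | ev p (rVt t) = 0].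
Proof.
have := @measurable_ev n p measurableT [set 0] (measurable_set1 _).
by rewrite setTI.
Qed.

Lemma finite_roots (q : {poly R}) : q != 0 -> finite_set [set x | root q x].
Proof.
move: {2}(size q) (leqnn (size q)) => k; elim: k q => [|k IH] q.
  by rewrite leqn0 size_poly_eq0 => ->.
move=> qk q0; have [[a qa]|nr] := pselect (exists a, root q a); last first.
  rewrite (_ : [set _ | _] = set0); first exact: finite_set0.
  by apply/seteqP; split => // a qa; apply: nr; exists a.
have /factor_theorem [q' qE] := qa.
have q'0 : q' != 0 by apply: contraNneq q0 => q'0; rewrite qE q'0 mul0r.
apply: (@sub_finite_set _ _ ([set a] `|` [set x | root q' x])).
  move=> x /=; rewrite qE rootM root_XsubC => /orP [->|/eqP ->]; [by right|by left].
rewrite finite_setU; split; first exact: finite_set1.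
apply: IH => //; move: qk; rewrite qE size_Mmonic ?monicXsubC // size_XsubC addn2.
by rewrite ltnS.
Qed.

(** Induction on the number of variables. Unless the leading coefficient in the first variable
    vanishes at [t], which by induction happens on a null set, the section at [t] is the finite root
    set of a nonzero univariate polynomial. *)
Lemma lebn_ev_eq0 n (p : mpoly n R) : p != 0 ->
  lebn R n [set t : T n | ev p (rVt t) = 0] = 0%E.
Proof.
elim: n p => [|n IH] p p0.
  rewrite (_ : [set _ | _] = set0) ?measure0 //.
  apply/seteqP; split => // t /=; rewrite (nvar0_mpolyC p) evC => h.
  by move/negP: p0; apply; rewrite (nvar0_mpolyC p) h mpolyC0.
have [Q Q0 hQ] := mpoly_split p.
have c0 : lead_coef Q != 0.
  by rewrite lead_coef_eq0; apply: contra_neq p0.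
rewrite lebn_cons (ae_eq_integral (cst 0%E)) ?integral0 //.
  apply: measurable_fun_xsection.
  by have := @measurable_consr R n measurableT _ (measurable_ev_eq0 p); rewrite setTI.
exists [set t : T n | ev (lead_coef Q) (rVt t) = 0]; split.
- exact: measurable_ev_eq0.
- exact: IH.
move=> t /= ht; apply: contrapT => ht0; apply: ht => _.
set q := map_poly (meval (fun i => rVt t 0 i)) Q.
have q0 : q != 0.
  apply/eqP => /polyP /(_ (size Q).-1); rewrite coef0 coef_map => h.
  by apply: ht0; rewrite -[RHS]h lead_coefE.
apply: countable_lebesgue_measure0.
apply: finite_set_countable; apply: sub_finite_set (finite_roots q0) => x /=.
by rewrite /xsection /= inE /= hQ => /eqP.
Qed.

Lemma lebn_box n (a b : 'I_n -> R) : (forall i, a i <= b i) ->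
  measurable [set t : T n | forall i, a i <= tnth t i <= b i] /\
  lebn R n [set t : T n | forall i, a i <= tnth t i <= b i] = (\prod_i (b i - a i))%:E.
Proof.
elim: n a b => [|n IH] a b ab.
  rewrite (_ : [set _ | _] = setT); last by apply/seteqP; split => // t _ [].
  by split => //; rewrite big_ord0 /= diracT.
have [mB EB] := IH (a \o lift ord0) (b \o lift ord0) (fun i => ab _).
have mI i : measurable [set t : T n.+1 | a i <= tnth t i <= b i].
  have := @measurable_tnth _ (measurableTypeR R) n.+1 i measurableT _
    (@measurable_itv R `[a i, b i]).
  by rewrite setTI.
split.
  rewrite (_ : [set _ | _] = \bigcap_i [set t : T n.+1 | a i <= tnth t i <= b i]).
    by apply: fin_bigcap_measurable => //; exact: finite_finset.
  by apply/seteqP; split => t h i //=; exact: h.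
transitivity ((lebn R n \x @lebesgue_measure R)%E
  ([set t : T n | forall i, a (lift ord0 i) <= tnth t i <= b (lift ord0 i)] `*`
   [set` `[a ord0, b ord0]])).
  congr (product_measure1 _ _ _); apply/seteqP; split => -[t x] /=.
    move=> h; split=> [i|]; first by have := h (lift ord0 i); rewrite tnthS.
    by have := h ord0; rewrite in_itv.
  move=> [h]; rewrite in_itv /= => h0 i.
  by case: (unliftP ord0 i) => [j ->|->] //; rewrite tnthS.
rewrite product_measure1E //.
have E0 := @lebesgue_measure_itv R `[a ord0, b ord0].
rewrite [X in (X * _)%E]EB [X in (_ * X)%E]E0 /= big_ord_recl lte_fin.
have := ab ord0; rewrite le_eqVlt => /orP [/eqP ->|->].
  by rewrite ltxx subrr mul0r mule0.
by rewrite -EFinD -EFinM mulrC.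
Qed.

End LebesgueMeasure.

Section Integration.
Variables (R : realType) (n : nat).
Local Notation T := (n.-tuple (measurableTypeR R)).
Implicit Types (A : set 'rV[R]_n) (p q : mpoly n R).

Definition bounded_borel A : Prop :=
  borel A /\ exists M : R, forall x, A x -> forall i, `|x 0 i| <= M.

Definition integrable_on A (phi : 'rV[R]_n -> R) : Prop :=
  (lebn R n).-integrable (@rVt R n @^-1` A) (EFin \o (phi \o @rVt R n)).

(** Facet unknowns are polynomials extended by zero, so they agree with a polynomial on their facet
    only. The degree is forgotten because integrability and positivity arguments do not depend on
    it. *)
Definition poly_on m (A : set 'rV[R]_m) (phi : 'rV[R]_m -> R) : Prop :=
  exists p : mpoly m R, forall x, A x -> phi x = ev p x.

Lemma bounded_borel_fin A : bounded_borel A -> (lebn R n (@rVt R n @^-1` A) < +oo)%E.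
Proof.
move=> [mA [M AM]].
have M0 : - `|M| <= `|M| by rewrite (le_trans _ (normr_ge0 M)) // oppr_le0.
have [mB EB] := @lebn_box R n (fun=> - `|M|) (fun=> `|M|) (fun=> M0).
apply: (@le_lt_trans _ _ (lebn R n [set t : T | forall i, - `|M| <= tnth t i <= `|M|])).
  apply: le_measure; rewrite ?inE // => t /= At i.
  rewrite -ler_norml -rVtE; apply: le_trans (AM _ At i) _.
  exact: ler_norm.
by rewrite EB ltry.
Qed.

Lemma ev_bounded A p : (exists M : R, forall x, A x -> forall i, `|x 0 i| <= M) ->
  exists C : R, forall x, A x -> `|ev p x| <= C.
Proof.
move=> [M AM]; elim/mpoly_alg_ind: p => [c|i|p q [C hC] [D hD]|p q [C hC] [D hD]].
- by exists `|c| => x _; rewrite evC.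
- by exists M => x /AM; rewrite evX.
- exists (C + D) => x Ax; rewrite evD; apply: le_trans (ler_normD _ _) _.
  by apply: lerD; [exact: hC|exact: hD].
- exists (C * D) => x Ax; rewrite evM normrM.
  by apply: ler_pM => //; [exact: hC|exact: hD].
Qed.

Lemma ev_bounded_on A p : bounded_borel A ->
  [bounded ev p (rVt t) | t in @rVt R n @^-1` A].
Proof.
move=> [_ /(@ev_bounded A p) [C hC]]; exists C; split; first exact: num_real.
by move=> D CD t /= At; apply: le_trans (ltW CD); exact: hC.
Qed.

Lemma integrable_ev A p : bounded_borel A -> integrable_on A (ev p).
Proof.
move=> bA; have [mA _] := bA.
apply: measurable_bounded_integrable => //; first exact: bounded_borel_fin.
  exact: (measurable_funS measurableT (@subsetT _ _) (@measurable_ev R n p)).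
exact: ev_bounded_on.
Qed.

Lemma rVint_eq A phi psi : (forall x, A x -> phi x = psi x) ->
  rVint A phi = rVint A psi.
Proof. by move=> h; apply: eq_Rintegral => t; rewrite inE /= => /h. Qed.

Lemma rVint_linear_integrable A (a : R) phi psi : borel A ->
  integrable_on A phi -> integrable_on A psi ->
  rVint A (fun x => a * phi x + psi x) = a * rVint A phi + rVint A psi.
Proof.
move=> mA hphi hpsi; rewrite /rVint -RintegralZl // -RintegralD //.
exact: (integrableZl mA a hphi).
Qed.

Lemma integrable_on_lin A (a : R) phi psi : borel A ->
  integrable_on A phi -> integrable_on A psi ->
  integrable_on A (fun x => a * phi x + psi x).
Proof.
move=> mA hphi hpsi.
have h := integrableD mA (integrableZl mA a hphi) hpsi.
exact: h.
Qed.

Lemma integrable_on_sum A (J : Type) (r : seq J) (phi : J -> 'rV[R]_n -> R) :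
  bounded_borel A -> (forall j, integrable_on A (phi j)) ->
  integrable_on A (fun x => \sum_(j <- r) phi j x).
Proof.
move=> bA h; elim: r => [|j r IH].
  rewrite (_ : (fun _ => _) = ev 0); first exact: integrable_ev.
  by apply: funext => x; rewrite big_nil ev0.
rewrite (_ : (fun _ => _) = (fun x => 1 * phi j x + \sum_(j <- r) phi j x)).
  by apply: integrable_on_lin => //; apply bA.
by apply: funext => x; rewrite big_cons mul1r.
Qed.

Lemma poly_on_integrable A phi : bounded_borel A -> poly_on A phi -> integrable_on A phi.
Proof.
move=> bA [p hp]; apply: eq_integrable (integrable_ev p bA); first by apply bA.
by move=> t; rewrite inE /= => /hp ->.
Qed.

Lemma rVint_linear A (a : R) phi psi : bounded_borel A -> poly_on A phi -> poly_on A psi ->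
  rVint A (fun x => a * phi x + psi x) = a * rVint A phi + rVint A psi.
Proof.
move=> bA hphi hpsi; apply: rVint_linear_integrable; first by apply bA.
  exact: poly_on_integrable.
exact: poly_on_integrable.
Qed.

Lemma rVint_ge0 A phi : (forall x, A x -> 0 <= phi x) -> 0 <= rVint A phi.
Proof. by move=> h; apply: Rintegral_ge0 => t; exact: h. Qed.

Definition nonnull A : Prop := (0 < lebn R n (@rVt R n @^-1` A))%E.

(** Otherwise the exceptional null set and the null zero set of [p] would together cover [A]. *)
Lemma ae_eq0_ev A p : borel A -> nonnull A ->
  {ae lebn R n, forall t, A (rVt t) -> ev p (rVt t) = 0} -> p = 0.
Proof.
move=> mA A0 [N [mN N0 hN]]; apply/eqP; apply: contraTT A0 => p0.
rewrite /nonnull -leNgt.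
have mZ := @measurable_ev_eq0 R n p.
apply: (@le_trans _ _ (lebn R n (N `|` [set t : T | ev p (rVt t) = 0]))).
  apply: le_measure; rewrite ?inE //; first exact: measurableU.
  move=> t /= At; have [->|/eqP ne0] := eqVneq (ev p (rVt t)) 0; [by right|left].
  by apply: hN => /= /(_ At).
apply: le_trans (measureU2 _ mN mZ) _.
by rewrite [X in (X + _)%E]N0 [X in (_ + X)%E](lebn_ev_eq0 p0) adde0.
Qed.

Lemma rVint_eq0 A p : bounded_borel A -> nonnull A ->
  (forall x, A x -> 0 <= ev p x) -> rVint A (ev p) = 0 -> p = 0.
Proof.
move=> bA A0 p0 I0; have [mA _] := bA.
apply: (@ae_eq0_ev A) => //.
(* [Rintegral] is obtained through [fine], which sends infinite values to 0; only for a finite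
   integral does its vanishing carry over to the extended integral. *)
have fin := integrable_fin_num mA (integrable_ev p bA).
have E0 : (\int[lebn R n]_(t in @rVt R n @^-1` A) `|(ev p (rVt t))%:E| = 0)%E.
  rewrite -[RHS]/(0%:E) -I0 /rVint /Rintegral fineK //.
  by apply: eq_integral => t; rewrite inE /= => /p0 h; rewrite ger0_norm.
have mf : measurable_fun (@rVt R n @^-1` A) (fun t => (ev p (rVt t))%:E).
  apply/measurable_EFinP.
  exact: (measurable_funS measurableT (@subsetT _ _) (@measurable_ev R n p)).
have := (ae_eq_integral_abs (lebn R n) mA mf).1 E0.
by apply: filterS => t /= h At; have [] := h At.
Qed.

(** On a set of finite measure, |g| <= 1 + g^2 makes an L^2 function integrable; a polynomial is a
    bounded factor there. The extension by zero is used because [g] is only constrained on [Om]. *)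
Lemma L2_integrable_mul A (Om : set 'rV[R]_n) g p : bounded_borel A -> L2 Om g ->
  integrable_on A (fun x => patch (fun=> 0) Om g x * ev p x).
Proof.
move=> bA; have [mA _] := bA; rewrite /L2.
have -> : patch (fun=> 0) (@rVt R n @^-1` Om) (g \o @rVt R n) =
    (patch (fun=> 0) Om g) \o @rVt R n.
  by [].
set g' := patch _ _ _ => hg.
have mg : measurable_fun [set: T] (g' \o @rVt R n).
  by move: hg; rewrite inE => /andP [] /[!inE].
have ig : integrable_on A g'.
  have i2 := Lfun2_integrable_sqr hg.
  have i2A := integrableS measurableT mA (@subsetT _ _) i2.
  have i1 := integrable_ev 1 bA.
  have mgA := measurable_funS measurableT (@subsetT _ (@rVt R n @^-1` A)) mg.
  apply: (le_integrable mA _ _ (integrableD mA i1 i2A)).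
    exact/measurable_EFinP.
  move=> t /= At; rewrite lee_fin ev1.
  rewrite [leRHS]ger0_norm ?addr_ge0 ?sqr_ge0 // -[X in _ + X]real_normK ?num_real //.
  set x := `|_|; have x0 : 0 <= x by exact: normr_ge0.
  have : 0 <= (x - 1) ^+ 2 by exact: sqr_ge0.
  rewrite sqrrB1 -addrA addrCA; nra.
have h := integrableMl mA ig
  (measurable_funS measurableT (@subsetT _ _) (@measurable_ev R n p)) (ev_bounded_on p bA).
exact: h.
Qed.

Lemma rVint_setI A (Om : set 'rV[R]_n) phi :
  rVint (A `&` Om) phi = rVint A (patch (fun=> 0) Om phi).
Proof.
rewrite /rVint preimage_setI Rintegral_mkcondr; exact: eq_Rintegral.
Qed.

End Integration.

(** * Simplices and connectivity through facets *)

Section Barycentric.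
Variables (R : realType) (d : nat).

Lemma dotC (x y : 'rV[R]_d) : dot x y = dot y x.
Proof. by apply: eq_bigr => i _; rewrite mulrC. Qed.

Lemma dotDr (x y z : 'rV[R]_d) : dot x (y + z) = dot x y + dot x z.
Proof. by rewrite /dot -big_split; apply: eq_bigr => i _; rewrite mxE mulrDr. Qed.

Lemma dotZr (x y : 'rV[R]_d) a : dot x (a *: y) = a * dot x y.
Proof. by rewrite /dot mulr_sumr; apply: eq_bigr => i _; rewrite mxE mulrCA. Qed.

Lemma dotNr (x y : 'rV[R]_d) : dot x (- y) = - dot x y.
Proof. by rewrite -scaleN1r dotZr mulN1r. Qed.

Lemma dotBr (x y z : 'rV[R]_d) : dot x (y - z) = dot x y - dot x z.
Proof. by rewrite dotDr dotNr. Qed.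

Lemma dotZl (x y : 'rV[R]_d) a : dot (a *: x) y = a * dot x y.
Proof. by rewrite dotC dotZr dotC. Qed.

Lemma dot0r (x : 'rV[R]_d) : dot x 0 = 0.
Proof. by rewrite -(scale0r 0) dotZr mul0r. Qed.

Lemma dot_sumr (J : Type) (r : seq J) (P : pred J) (x : 'rV[R]_d) (y : J -> 'rV[R]_d) :
  dot x (\sum_(j <- r | P j) y j) = \sum_(j <- r | P j) dot x (y j).
Proof. by apply: (big_morph _ (dotDr x) (dot0r x)). Qed.

Lemma dot_ge0 (x : 'rV[R]_d) : 0 <= dot x x.
Proof. by apply: sumr_ge0 => i _; rewrite -expr2 sqr_ge0. Qed.

Lemma dot_eq0 (x : 'rV[R]_d) : dot x x = 0 -> x = 0.
Proof.
move=> /eqP; rewrite psumr_eq0 => [/allP h|i _]; last by rewrite -expr2 sqr_ge0.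
apply/rowP => i; rewrite mxE; have /implyP /(_ isT) := h i (mem_index_enum _).
by rewrite -expr2 sqrf_eq0 => /eqP.
Qed.

(** Affine functions are kept as polynomials, so that barycentric coordinates and hyperplanes
    inherit measurability, continuity and the null zero sets. *)
Definition aff (g : 'rV[R]_d) (h : R) : mpoly d R :=
  \sum_i g 0 i *: mpolyX R (mnm1 i) + mpolyC d h.

Lemma ev_aff g h y : ev (aff g h) y = dot g y + h.
Proof.
rewrite evD evC ev_sum; congr (_ + _).
by apply: eq_bigr => i _; rewrite evZ evX.
Qed.

Lemma Pol_aff g h : Pol 1 (aff g h).
Proof.
apply: PolD; last exact: PolC.
by apply: Pol_sum => i _; apply: PolZ; exact: PolXU.
Qed.

Lemma ev_aff_comb g h (J : finType) (A : {set J}) (c : J -> R) (x : J -> 'rV[R]_d) :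
  \sum_(j in A) c j = 1 ->
  ev (aff g h) (\sum_(j in A) c j *: x j) = \sum_(j in A) c j * ev (aff g h) (x j).
Proof.
move=> c1; rewrite ev_aff dot_sumr -[h in LHS]mul1r -c1 mulr_suml -big_split.
by apply: eq_bigr => j _ /=; rewrite dotZr ev_aff mulrDr.
Qed.

Variables (J : finType) (x : J -> 'rV[R]_d) (A : {set J}).
Hypothesis A_indep : affine_indep x A.

Lemma barycentric_uniq (c c' : J -> R) :
  \sum_(a in A) c a = \sum_(a in A) c' a ->
  \sum_(a in A) c a *: x a = \sum_(a in A) c' a *: x a ->
  forall a, a \in A -> c a = c' a.
Proof.
move=> h1 h2 a aA; apply/eqP; rewrite -subr_eq0; apply/eqP.
apply: (A_indep (c := fun a => c a - c' a)) => //.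
  by rewrite sumrB h1 subrr.
under eq_bigr do rewrite scalerBl.
by rewrite sumrB h2 subrr.
Qed.

Hypothesis A_card : #|A| = d.+1.

(** In homogeneous coordinates the d + 1 rows (x_a, 1) are linearly independent by affine
    independence, hence form an invertible system; the coordinates of [y] are the entries of (y, 1)
    times a left inverse, which are affine in [y]. *)
Lemma barycentric_exists : exists (g : J -> 'rV[R]_d) (h : J -> R),
  forall y, \sum_(a in A) ev (aff (g a) (h a)) y = 1 /\
    \sum_(a in A) ev (aff (g a) (h a)) y *: x a = y.
Proof.
pose M : 'M[R]_(#|A|, d + 1) :=
  \matrix_(k, j) (row_mx (x (enum_val k)) (1%:M : 'M[R]_1)) 0 j.
have ME (c : 'rV_#|A|) : c *m M =
    row_mx (\sum_k c 0 k *: x (enum_val k)) (\sum_k c 0 k)%:M.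
  rewrite -[LHS]hsubmxK; congr row_mx; apply/rowP => j.
    rewrite mxE mxE summxE; apply: eq_bigr => k _.
    by rewrite mxE row_mxEl mxE.
  rewrite mxE mxE [RHS]mxE ord1 eqxx mulr1n; apply: eq_bigr => k _.
  by rewrite mxE row_mxEr mxE eqxx mulr1.
have Mfree : row_free M.
  rewrite -kermx_eq0; apply/eqP/row_matrixP => i; rewrite row0.
  set v := row i _.
  have : v *m M = 0 by apply/sub_kermxP; apply: row_sub.
  rewrite ME -row_mx0 => /eq_row_mx [h1 h2].
  pose c a := \sum_k v 0 k *+ (enum_val k == a).
  have cE k : c (enum_val k) = v 0 k.
    rewrite /c (bigD1 k) //= eqxx big1 ?addr0 // => k' k'k.
    by rewrite (inj_eq enum_val_inj) (negPf k'k).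
  apply/rowP => k; rewrite [RHS]mxE -cE.
  apply: (A_indep (c := c)); last exact: enum_valP.
    rewrite big_enum_val /=; under eq_bigr do rewrite cE.
    by move/matrixP: h2 => /(_ 0 0); rewrite !mxE eqxx mulr1n.
  by rewrite big_enum_val /=; under eq_bigr do rewrite cE.
have /row_fullP [N NM] : row_full M.
  by move: Mfree; rewrite /row_full /row_free => /eqP ->; rewrite A_card addn1.
pose k0 : 'I_#|A| := cast_ord (esym A_card) ord0.
pose idx a := enum_rank_in (enum_valP k0) a.
exists (fun a => \row_i N (lshift 1 i) (idx a)), (fun a => N (rshift d 0) (idx a)) => y.
pose c := row_mx y 1%:M *m N.
have cM : c *m M = row_mx y 1%:M by rewrite -mulmxA NM mulmx1.
have cE a : ev (aff (\row_i N (lshift 1 i) (idx a)) (N (rshift d 0) (idx a))) y = c 0 (idx a).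
  rewrite ev_aff mxE big_split_ord /= big_ord1 row_mxEr mxE eqxx mul1r; congr (_ + _).
  by apply: eq_bigr => i _; rewrite row_mxEl mxE mulrC.
move: cM; rewrite ME => /eq_row_mx [h1 h2].
split.
  rewrite big_enum_val /=; under eq_bigr do rewrite cE /idx enum_valK_in.
  by move/matrixP: h2 => /(_ 0 0); rewrite !mxE !eqxx !mulr1n.
by rewrite big_enum_val /=; under eq_bigr do rewrite cE /idx enum_valK_in.
Qed.

End Barycentric.

Section Hull.
Variables (R : realType) (d : nat) (J : finType) (x : J -> 'rV[R]_d) (A : {set J}).
Variables (g : J -> 'rV[R]_d) (h : J -> R).
Hypothesis A_indep : affine_indep x A.
Hypothesis lamP : forall y, \sum_(a in A) ev (aff (g a) (h a)) y = 1 /\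
    \sum_(a in A) ev (aff (g a) (h a)) y *: x a = y.
Local Notation lam a := (aff (g a) (h a)).

(** Extended by zero outside [B], the coefficients represent the same point over [A], where
    barycentric coordinates are unique. *)
Lemma bary_sub (B : {set J}) (c : J -> R) y : B \subset A ->
  \sum_(a in B) c a = 1 -> y = \sum_(a in B) c a *: x a ->
  forall a, a \in A -> ev (lam a) y = if a \in B then c a else 0.
Proof.
move=> /finset.setIidPr BA c1 yE a aA.
have [l1 l2] := lamP y.
apply: (barycentric_uniq A_indep (c := fun a => ev (lam a) y)
  (c' := fun a => if a \in B then c a else 0)) => //.
  rewrite l1 -big_mkcondr /= -[LHS]c1 -[in LHS]BA.
  by apply: eq_bigl => b; rewrite !inE.
rewrite l2 yE -[in LHS]BA.
under eq_bigl do rewrite !inE.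
rewrite big_mkcondr /=; apply: eq_bigr => b _.
by case: ifP => //; rewrite scale0r.
Qed.

Lemma bary_vert a b : a \in A -> b \in A -> ev (lam a) (x b) = (a == b)%:R.
Proof.
move=> aA bA; rewrite (@bary_sub [set b]%SET (fun=> 1) (x b)) //.
- by rewrite finset.in_set1; case: eqP.
- by rewrite finset.sub1set.
- by rewrite big_set1.
- by rewrite big_set1 scale1r.
Qed.

(** The description by half-spaces from which closedness and Borel measurability of cells are read
    off. *)
Lemma hullP y : hull x A y <-> forall a, a \in A -> 0 <= ev (lam a) y.
Proof.
split=> [[c [c0 c1 yE]] a aA|h0].
  by rewrite (bary_sub _ c1 yE) // aA c0.
by have [l1 l2] := lamP y; exists (fun a => ev (lam a) y).
Qed.

Lemma bary_center : A != finset.set0 -> exists y, forall a, a \in A -> 0 < ev (lam a) y.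
Proof.
move=> A0; have nA : (0 < #|A|)%N by rewrite card_gt0.
have nA' : #|A|%:R != 0 :> R by rewrite pnatr_eq0 -lt0n.
exists (\sum_(a in A) #|A|%:R^-1 *: x a) => a aA.
rewrite (@bary_sub A (fun=> #|A|%:R^-1) _) // ?aA ?invr_gt0 ?ltr0n //.
by rewrite sumr_const -[LHS]mulr_natr mulVf.
Qed.

Lemma hull_bounded (B : {set J}) : exists M : R, forall y, hull x B y -> forall i, `|y 0 i| <= M.
Proof.
exists (\sum_(a in B) \sum_i `|x a 0 i|) => y [c [c0 c1 ->]] i.
rewrite summxE; apply: le_trans (ler_norm_sum _ _ _) _.
apply: ler_sum => a aB; rewrite mxE normrM ger0_norm ?c0 //.
have ca : c a <= 1.
  by rewrite -c1 (bigD1 a) //= lerDl; apply: sumr_ge0 => b /andP [bB _]; exact: c0.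
apply: (@le_trans _ _ `|x a 0 i|); first by rewrite ler_piMl.
by rewrite (bigD1 i) //= lerDl sumr_ge0.
Qed.

Lemma hull_borel : borel (hull x A).
Proof.
rewrite /borel (_ : _ @^-1` _ = \bigcap_(a in [set` A])
  [set t : d.-tuple (measurableTypeR R) | 0 <= ev (lam a) (rVt t)]).
  apply: fin_bigcap_measurable => // a _.
  have := @measurable_ev R d (lam a) measurableT _ (@measurable_itv R `[0, +oo[).
  rewrite setTI; congr (measurable _).
  by apply/seteqP; split => t /=; rewrite in_itv /= andbT.
by apply/seteqP; split => t /= => [/hullP|] h0; [move=> a /= /h0|apply/hullP].
Qed.

Lemma hull_bounded_borel : bounded_borel (hull x A).
Proof. by split; [exact: hull_borel|exact: hull_bounded]. Qed.

End Hull.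

Section Topology.
Variables (R : realType) (d : nat).

Lemma continuous_ev (p : mpoly d R) : continuous (ev p : 'rV[R]_d -> R).
Proof.
elim/mpoly_alg_ind: p => [c|i|p q hp hq|p q hp hq] y.
- rewrite (_ : ev _ = cst c); first exact: cst_continuous.
  by apply: funext => z; rewrite evC.
- rewrite (_ : ev _ = fun z : 'rV[R]_d => z 0 i); first exact: coord_continuous.
  by apply: funext => z; rewrite evX.
- rewrite (_ : ev _ = (fun z => ev p z + ev q z)); first exact: (continuousD (hp y) (hq y)).
  by apply: funext => z; rewrite evD.
- rewrite (_ : ev _ = (fun z => ev p z * ev q z)); first exact: (continuousM (hp y) (hq y)).
  by apply: funext => z; rewrite evM.
Qed.

Lemma closed_ev_ge0 (p : mpoly d R) : closed [set y : 'rV[R]_d | 0 <= ev p y].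
Proof.
have := @closed_comp _ _ (ev p : 'rV[R]_d -> R) [set z | 0 <= z]
  (fun y _ => @continuous_ev p y) (@closed_ge R 0).
exact.
Qed.

Lemma open_box (U : set 'rV[R]_d) y : open U -> U y ->
  exists2 e : R, 0 < e & forall z : 'rV[R]_d, (forall i, `|z 0 i - y 0 i| < e) -> U z.
Proof.
rewrite openE => /[apply] /nbhs_ballP [e /= e0 eU]; exists e => // z hz.
by apply: eU => /=; split => // i j; rewrite ord1 /ball /= distrC.
Qed.

Lemma nonnull_box (A : set 'rV[R]_d) (a b : 'I_d -> R) : borel A ->
  (forall i, a i < b i) -> (forall z : 'rV[R]_d, (forall i, a i <= z 0 i <= b i) -> A z) ->
  nonnull A.
Proof.
move=> mA ab hA.
have [mB EB] := @lebn_box R d a b (fun i => ltW (ab i)).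
apply: (@lt_le_trans _ _ (lebn R d [set t | forall i, a i <= tnth t i <= b i])).
  rewrite [X in (_ < X)%E]EB lte_fin; apply: prodr_gt0 => i _.
  by rewrite subr_gt0.
apply: le_measure; rewrite ?inE // => t /= ht.
by apply: hA => i; rewrite rVtE.
Qed.

Lemma nonnull_open (A U : set 'rV[R]_d) y : borel A -> open U -> U y -> U `<=` A -> nonnull A.
Proof.
move=> mA oU Uy UA; have [e e0 he] := open_box oU Uy.
apply: (@nonnull_box A (fun i => y 0 i - e / 2) (fun i => y 0 i + e / 2)) => //.
  by move=> i; lra.
move=> z hz; apply: UA; apply: he => i; have := hz i => /andP [h1 h2].
by rewrite ltr_norml; apply/andP; split; lra.
Qed.

End Topology.

(** * Generic position and connectivity of the mesh through facets *)

Section Connectivity.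
Variables (R : realType) (d : nat).

Lemma ev_eq0_open (U : set 'rV[R]_d) y (p : mpoly d R) : open U -> U y ->
  (forall z, U z -> ev p z = 0) -> p = 0.
Proof.
move=> oU Uy pU; have [e e0 he] := open_box oU Uy.
pose A := [set z : 'rV[R]_d | forall i, y 0 i - e / 2 <= z 0 i <= y 0 i + e / 2].
have mA : borel A.
  have ab i : y 0 i - e / 2 <= y 0 i + e / 2 by lra.
  have [m _] := @lebn_box R d (fun i => y 0 i - e / 2) (fun i => y 0 i + e / 2) ab.
  rewrite /borel; congr (measurable _) : m.
  by apply/seteqP; split => t /= h i; have := h i; rewrite rVtE.
have AU : A `<=` U.
  move=> z hz; apply: he => i; have := hz i => /andP [h1 h2].
  by rewrite ltr_norml; apply/andP; split; lra.
apply: (@ae_eq0_ev _ _ A) => //.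
  apply: (@nonnull_box _ _ A (fun i => y 0 i - e / 2) (fun i => y 0 i + e / 2)) => // i.
  by lra.
by apply: aeW => t /AU /pU.
Qed.

(** Genericity: the product of finitely many nonzero polynomials is nonzero, so it cannot vanish on
    an open set. *)
Lemma ev_neq0_open (I : finType) (U : set 'rV[R]_d) y (p : I -> mpoly d R) :
  open U -> U y -> (forall i, p i != 0) -> exists2 z, U z & forall i, ev (p i) z != 0.
Proof.
move=> oU Uy p0; apply: contrapT => nz.
have : \prod_i p i != 0 by apply/prodf_neq0.
move/negP; apply; apply/eqP; apply: (ev_eq0_open oU Uy) => z Uz.
rewrite /ev rmorph_prod; apply/eqP/prodf_eq0; apply: contrapT => h; apply: nz.
by exists z => // i; apply/negP => hi; apply: h; exists i.
Qed.

(** At most d columns in homogeneous coordinates, which live in dimension d + 1, leave a nonzero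
    vector in the left kernel. *)
Lemma hyperplane_through (s : seq 'rV[R]_d) : (size s <= d)%N ->
  exists g h, aff g h != 0 /\ forall y, y \in s -> ev (aff g h) y = 0.
Proof.
move=> sd; pose M : 'M[R]_(d + 1, size s) :=
  \matrix_(k, j) (row_mx (s`_j) (1%:M : 'M[R]_1)) 0 k.
have [i vi] : exists i, row i (kermx M) != 0.
  apply: contrapT => h.
  have : kermx M == 0.
    apply/eqP/row_matrixP => i; rewrite row0; apply/eqP; apply: contrapT => hi.
    by apply: h; exists i; exact/negP.
  rewrite kermx_eq0 => /eqP fr; have := rank_leq_col M.
  by rewrite fr addn1 leqNgt ltnS sd.
have [v v0 vM] : exists2 v : 'rV_(d + 1), v != 0 & v *m M = 0.
  by exists (row i (kermx M)) => //; apply/sub_kermxP; apply: row_sub.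
pose g : 'rV[R]_d := lsubmx v; pose h := v 0 (rshift d 0).
have evE y : ev (aff g h) y = (v *m (row_mx y 1%:M)^T) 0 0.
  rewrite ev_aff [RHS]mxE big_split_ord /= big_ord1; congr (_ + _).
    by apply: eq_bigr => k _; rewrite mxE [in RHS]mxE row_mxEl.
  by rewrite mxE row_mxEr mxE eqxx mulr1.
exists g, h; split.
  apply: contraNneq v0 => gh0; have e0 y : dot g y + h = 0 by rewrite -ev_aff gh0 ev0.
  have h0 : h = 0 by have := e0 0; rewrite dot0r add0r.
  have g0 : g = 0 by apply: dot_eq0; have := e0 g; rewrite h0 addr0.
  rewrite -[v]hsubmxK -/g g0 (_ : rsubmx v = 0) ?row_mx0 //.
  by apply/rowP => j; rewrite !mxE ord1.
move=> y /(nthP 0) [j js <-]; rewrite evE.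
move/rowP: vM => /(_ (Ordinal js)); rewrite !mxE => E; rewrite -[RHS]E.
by apply: eq_bigr => k _; rewrite mxE [in RHS]mxE.
Qed.

Lemma aff_hull0 (J : finType) (x : J -> 'rV[R]_d) (B : {set J}) g h y :
  (forall a, a \in B -> ev (aff g h) (x a) = 0) -> hull x B y -> ev (aff g h) y = 0.
Proof.
move=> h0 [c [_ c1 ->]]; rewrite ev_aff_comb // big1 // => a aB.
by rewrite h0 // mulr0.
Qed.

Lemma connected_closed_cover (U : topologicalType) (E A B : set U) : connected E ->
  closed A -> closed B -> E `<=` A `|` B -> E `&` A !=set0 -> E `&` B !=set0 ->
  E `&` (A `&` B) !=set0.
Proof.
move=> cE cA cB EAB EA0 [b [Eb Bb]]; apply: contrapT => n.
have EA : E `&` A = E.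
  apply: cE => //; last by exists A.
  exists (~` B); first by rewrite openC.
  apply/seteqP; split => z [Ez h]; split => //.
    by move=> Bz; apply: n; exists z.
  by have [] := EAB _ Ez.
by apply: n; exists b; move: Eb; rewrite -{1}EA => -[? ?].
Qed.

Variable T : mesh R d.

Lemma cell_bary (K : cell T) : exists gh : ('I_(nvert T) -> 'rV[R]_d) * ('I_(nvert T) -> R),
  forall y, \sum_(a in val K) ev (aff (gh.1 a) (gh.2 a)) y = 1 /\
    \sum_(a in val K) ev (aff (gh.1 a) (gh.2 a)) y *: vert a = y.
Proof.
have [g [h H]] := barycentric_exists (cells_indep (valP K)) (cells_card (valP K)).
by exists (g, h).
Qed.

Definition bary_g (K : cell T) := (sval (cid (cell_bary K))).1.
Definition bary_h (K : cell T) := (sval (cid (cell_bary K))).2.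
Definition bary (K : cell T) a : mpoly d R := aff (bary_g K a) (bary_h K a).

Lemma baryP (K : cell T) y : \sum_(a in val K) ev (bary K a) y = 1 /\
  \sum_(a in val K) ev (bary K a) y *: vert a = y.
Proof. exact: (svalP (cid (cell_bary K))). Qed.

Lemma csetP (K : cell T) y : cset K y <-> forall a, a \in val K -> 0 <= ev (bary K a) y.
Proof. exact: (hullP (cells_indep (valP K)) (baryP K)). Qed.

Definition cell_int (K : cell T) : set 'rV[R]_d :=
  [set y | forall a, a \in val K -> 0 < ev (bary K a) y].

Lemma cell_int_sub K : cell_int K `<=` cset K.
Proof. by move=> y h; apply/csetP => a /h /ltW. Qed.

Lemma cell_int_nonempty K : cell_int K !=set0.
Proof.
have [|y hy] := bary_center (cells_indep (valP K)) (baryP K); last by exists y.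
by rewrite -card_gt0 (cells_card (valP K)).
Qed.

Lemma open_cell_int K : open (cell_int K).
Proof.
rewrite -closedC (_ : ~` _ =
  \bigcup_(a in [set` val K]) [set y | 0 <= ev (- bary K a) y]).
  by apply: closed_bigcup => // a _; exact: closed_ev_ge0.
apply/seteqP; split => y /=.
  move=> h; apply: contrapT => h'; apply: h => a aK.
  rewrite ltNge; apply/negP => le0; apply: h'; exists a => //=.
  by rewrite evN oppr_ge0.
by move=> [a /= aK]; rewrite evN oppr_ge0 => le0 /(_ a aK); rewrite ltNge le0.
Qed.

Lemma closed_cset (K : cell T) : closed (cset K).
Proof.
rewrite (_ : cset K = \bigcap_(a in [set` val K]) [set y | 0 <= ev (bary K a) y]).
  by apply: closed_bigI => a _; exact: closed_ev_ge0.
by apply/seteqP; split => y /= => [/csetP|] h; [move=> a /= /h|apply/csetP].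
Qed.

Lemma cset_bounded_borel (K : cell T) : bounded_borel (cset K).
Proof. exact: (hull_bounded_borel (cells_indep (valP K)) (baryP K)). Qed.

Lemma cset_nonnull (K : cell T) : nonnull (cset K).
Proof.
have [y hy] := cell_int_nonempty K.
apply: (nonnull_open _ (open_cell_int (K := K)) hy (@cell_int_sub K)).
by have [] := cset_bounded_borel K.
Qed.

(** Moving from [x] by any positive fraction of the way to an interior point makes all barycentric
    coordinates positive; the fraction [s] is then taken small against the distance. *)
Lemma cell_int_near (K : cell T) (x : 'rV[R]_d) (e : R) : cset K x -> 0 < e ->
  exists2 y, cell_int K y & forall i, `|y 0 i - x 0 i| < e.
Proof.
move=> /csetP Kx e0; have [c hc] := cell_int_nonempty K.
pose M := 1 + \sum_i `|c 0 i - x 0 i|.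
have M0 : 0 < M by rewrite ltr_pwDl // sumr_ge0.
have [s s0 [s1 sM]] : exists2 s : R, 0 < s & s <= 1 /\ s * M < e.
  exists (Num.min 1 (e / (2 * M))); first by rewrite lt_min ltr01 divr_gt0 ?mulr_gt0.
  split; first by rewrite ge_min lexx.
  apply: (@le_lt_trans _ _ (e / (2 * M) * M)).
    by rewrite ler_pM2r // ge_min lexx orbT.
  by rewrite invfM mulrA mulfVK ?gt_eqF // ltr_pdivrMr //; lra.
exists (x + s *: (c - x)).
  move=> a aK; have -> : ev (bary K a) (x + s *: (c - x)) =
      (1 - s) * ev (bary K a) x + s * ev (bary K a) c.
    by rewrite !ev_aff dotDr dotZr dotBr; ring.
  have h1 := Kx a aK; have h2 := hc a aK.
  by apply: ltr_wpDl; [apply: mulr_ge0 => //; lra|apply: mulr_gt0].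
move=> i; rewrite !mxE addrAC subrr add0r normrM gtr0_norm //.
apply: le_lt_trans sM; rewrite ler_pM2l //.
by rewrite /M (bigD1 i) //= addrCA lerDl addr_ge0 // sumr_ge0.
Qed.

Variable Om : set 'rV[R]_d.
Hypotheses (Om_open : open Om) (Om_conn : connected Om) (Om_reg : Om = interior (closure Om)).
Hypothesis T_Om : triangulates T Om.

(** The open cell is an open subset of the closure of [Om]; regular openness puts it inside [Om]
    itself. *)
Lemma cell_int_Om (K : cell T) : cell_int K `<=` Om.
Proof.
have h : cell_int K `<=` closure Om.
  by rewrite T_Om => y /cell_int_sub Ky; exists K.
move: (interiorS h); rewrite -Om_reg => h' y Ky; apply: h'.
by have := open_cell_int (K := K); rewrite openE; exact.
Qed.

(* Two classes of cells meeting only in codimension at least two cannot both be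
   nonempty: near a common point of the two closed unions, a generic segment joining
   interior points of both classes avoids the intersection. *)
Lemma facet_connected (P : cell T -> Prop) :
  (forall K K' : cell T, P K -> #|finset.setI (val K) (val K')| = d -> P K') ->
  forall K K', P K -> P K'.
Proof.
move=> Pstep K0 K1 PK0; apply: contrapT => nPK1.
pose AA := \bigcup_(K in [set K : cell T | P K]) cset K.
pose BB := \bigcup_(K in [set K : cell T | ~ P K]) cset K.
have cAA : closed AA.
  by apply: closed_bigcup => [|K _]; [exact: finite_finset|exact: closed_cset].
have cBB : closed BB.
  by apply: closed_bigcup => [|K _]; [exact: finite_finset|exact: closed_cset].
have cover : Om `<=` AA `|` BB.
  move=> y /(@subset_closure _ Om); rewrite T_Om => -[K Ky].
  by have [PK|nPK] := pselect (P K); [left|right]; exists K.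
have [x [Omx [[KA PKA KAx] [KB nPKB KBx]]]] : Om `&` (AA `&` BB) !=set0.
  apply: connected_closed_cover => //.
    have [y hy] := cell_int_nonempty K0; exists y; split; first exact: cell_int_Om hy.
    by exists K0 => //; exact: cell_int_sub.
  have [y hy] := cell_int_nonempty K1; exists y; split; first exact: cell_int_Om hy.
  by exists K1 => //; exact: cell_int_sub.
(* Across the two classes the common face cannot have d vertices, by [Pstep], nor d + 1, since the
   cells would be equal. *)
have card_lt (k : cell T * cell T) : P k.1 -> ~ P k.2 ->
    (#|finset.setI (val k.1) (val k.2)| < d)%N.
  case: k => K K' /= PK nPK'.
  have c1 : (#|finset.setI (val K) (val K')| <= d.+1)%N.
    by rewrite -(cells_card (valP K)) subset_leq_card // finset.subsetIl.
  have c2 : #|finset.setI (val K) (val K')| != d.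
    by apply/eqP => h; apply: nPK'; exact: Pstep h.
  rewrite ltn_neqAle c2 /= -ltnS ltn_neqAle c1 andbT; apply/eqP => c3.
  have e1 : finset.setI (val K) (val K') = val K.
    by apply/eqP; rewrite eqEcard finset.subsetIl c3 (cells_card (valP K)) leqnn.
  have e2 : finset.setI (val K) (val K') = val K'.
    by apply/eqP; rewrite eqEcard finset.subsetIr c3 (cells_card (valP K')) leqnn.
  by apply: nPK'; rewrite -(_ : K = K') //; apply: val_inj; rewrite -e1 e2.
(* A common face across the classes has at most d - 1 vertices, which leaves room for one more point
   on a hyperplane through it. Other pairs receive the constant 1, so that every polynomial in the
   family is nonzero. *)
have avoid (s : seq 'rV[R]_d) : (size s <= 1)%N -> exists p : cell T * cell T -> 'rV[R]_d * R,
    (forall k, aff (p k).1 (p k).2 != 0) /\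
    (forall k, P k.1 -> ~ P k.2 ->
      (forall y, y \in s -> ev (aff (p k).1 (p k).2) y = 0) /\
      (forall a, a \in finset.setI (val k.1) (val k.2) ->
        ev (aff (p k).1 (p k).2) (vert a) = 0)).
  move=> s1; have /boolp.choice [p hp] : forall k : cell T * cell T, exists p : 'rV[R]_d * R,
      aff p.1 p.2 != 0 /\ (P k.1 -> ~ P k.2 ->
      (forall y, y \in s -> ev (aff p.1 p.2) y = 0) /\
      (forall a, a \in finset.setI (val k.1) (val k.2) -> ev (aff p.1 p.2) (vert a) = 0)).
    move=> k; have [[P1 P2]|n] := pselect (P k.1 /\ ~ P k.2); last first.
      exists (0, 1); split => [|P1 P2]; last by case: n.
      apply/eqP => /(congr1 (fun p => ev p 0)).
      by rewrite ev_aff dot0r add0r ev0 => /eqP; rewrite oner_eq0.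
    have [|g [h [gh0 gh]]] := @hyperplane_through
      (s ++ [seq vert a | a <- enum (finset.setI (val k.1) (val k.2))]).
      rewrite size_cat size_map -cardE.
      by apply: leq_trans (leq_add s1 (leqnn _)) _; rewrite add1n; exact: card_lt.
    exists (g, h); split => // _ _; split => [y ys|a aI].
      by apply: gh; rewrite mem_cat ys.
    by apply: gh; rewrite mem_cat map_f ?orbT // mem_enum.
  by exists p; split => k; have [] := hp k.
have [e e0 eOm] := open_box Om_open Omx.
pose N := [set y : 'rV[R]_d | forall i, `|y 0 i - x 0 i| < e].
have oN (K : cell T) : cset K x -> exists2 U, open U /\ U !=set0 & U `<=` cell_int K `&` N.
  move=> Kx; have [y Ky Ny] := cell_int_near Kx e0.
  exists (cell_int K `&` N) => //; split; last by exists y.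
  apply: openI; first exact: open_cell_int.
  rewrite (_ : N = ball x e); first exact: ball_open.
  apply/seteqP; split => y' /= hy'.
    by split => // i j; rewrite ord1 /ball /= distrC.
  by move=> i; case: hy' => _ /(_ 0 i); rewrite /ball /= distrC.
(* The end [z] is chosen off hyperplanes [p] through the common faces; then [y] is chosen off
   hyperplanes [q] through [z] and the common faces. The segment can meet such a hyperplane [q] only
   at [z], which lies in no common face. *)
have [p [p0 hp]] := avoid [::] isT.
have [UB [oUB [zB UBz]] sUB] := oN KB KBx.
have [z Uz pz] := ev_neq0_open oUB UBz p0.
have [q [q0 hq]] := avoid [:: z] isT.
have [UA [oUA [zA UAz]] sUA] := oN KA KAx.
have [y Uy qy] := ev_neq0_open oUA UAz q0.
pose phi (t : R) := z + t *: (y - z).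
(* Both ends lie in the box [N] around [x], which is convex and contained in [Om]. *)
have phiN t : 0 <= t <= 1 -> Om (phi t).
  move=> /andP [t0 t1]; apply: eOm => i.
  have /sUB [_ /(_ i) hz] := Uz; have /sUA [_ /(_ i) hy] := Uy.
  rewrite !mxE; set a := z 0 i in hz *; set b := y 0 i in hy *; set c := x 0 i in hz hy *.
  have -> : a + t * (b - a) - c = (1 - t) * (a - c) + t * (b - c) by ring.
  apply: le_lt_trans (_ : Num.max `|a - c| `|b - c| < e); last by rewrite gt_max hz.
  apply: le_trans (ler_normD _ _) _; rewrite !normrM (ger0_norm t0) ger0_norm ?subr_ge0 //.
  set m := Num.max _ _.
  have h1 : (1 - t) * `|a - c| <= (1 - t) * m by rewrite ler_wpM2l ?subr_ge0 // le_max lexx.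
  have h2 : t * `|b - c| <= t * m by rewrite ler_wpM2l // le_max lexx orbT.
  by lra.
have cphi : continuous phi.
  move=> t; apply: cvgD; first exact: cvg_cst.
  by apply: cvgZr_tmp; exact: cvg_id.
have [t [/= t01 [[K PK Kt] [K' nPK' K't]]]] :
    `[0, 1]%classic `&` ((phi @^-1` AA) `&` (phi @^-1` BB)) !=set0.
  apply: connected_closed_cover.
  - exact: segment_connected.
  - by apply: closed_comp => // t _; exact: cphi.
  - by apply: closed_comp => // t _; exact: cphi.
  - by move=> t /=; rewrite in_itv /= => /phiN /cover.
  - exists 1; split; first by rewrite /= in_itv /= ler01 lexx.
    exists KA => //; rewrite /phi scale1r addrC subrK.
    by apply: cell_int_sub; have /sUA [] := Uy.
  - exists 0; split; first by rewrite /= in_itv /= ler01 lexx.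
    exists KB => //; rewrite /phi scale0r addr0.
    by apply: cell_int_sub; have /sUB [] := Uz.
have hJ : hull (@vert R d T) (finset.setI (val K) (val K')) (phi t).
  by rewrite -(cells_conform (valP K) (valP K')).
have [qz qJ] := hq (K, K') PK nPK'.
have := aff_hull0 qJ hJ.
(* The affine function vanishes at [z], so along the segment it is [t] times its nonzero value at
   [y]; a crossing point therefore has t = 0. *)
have -> : ev (aff (q (K, K')).1 (q (K, K')).2) (phi t) = t * ev (aff (q (K, K')).1 (q (K, K')).2) y.
  have := qz z (mem_head _ _); rewrite !ev_aff /phi dotDr dotZr dotBr => E.
  have -> : dot (q (K, K')).1 z = - (q (K, K')).2 by lra.
  by ring.
move/eqP; rewrite mulf_eq0 (negPf (qy _)) orbF => /eqP t0.
have [_ pJ] := hp (K, K') PK nPK'.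
have := aff_hull0 pJ hJ; rewrite t0 /phi scale0r addr0 => /eqP.
by rewrite (negPf (pz _)).
Qed.

End Connectivity.

(** * Surface integrals *)

Section Gram.
Variable R : realType.

(** The determinant of (1 - t) I + t G is a polynomial in [t] equal to 1 at t = 0. Each of these
    matrices is positive definite, hence invertible, so by the intermediate value theorem the sign
    is still positive at t = 1. *)
Lemma det_mul_tr_gt0 m n (B : 'M[R]_(m, n)) : row_free B -> 0 < \det (B *m B^T).
Proof.
move=> Bfree; set G := B *m B^T.
have quad (c : 'rV[R]_m) : (c *m G *m c^T) 0 0 = dot (c *m B) (c *m B).
  rewrite /G mulmxA -[_ *m _ *m _]mulmxA -trmx_mul mxE.
  by apply: eq_bigr => i _; rewrite [in X in _ * X]mxE.
have quad1 (c : 'rV[R]_m) : (c *m c^T) 0 0 = dot c c.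
  by rewrite mxE; apply: eq_bigr => i _; rewrite [in X in _ * X]mxE.
have pos (u v : R) : 0 <= u -> 0 <= v -> 0 < u + v -> \det (u%:M + v *: G) != 0.
  move=> u0 v0 uv0; apply/eqP => /eqP; rewrite -[_ == 0]negbK -unitfE -unitmxE.
  move/negP; apply; rewrite -row_free_unit -kermx_eq0; apply/eqP/row_matrixP => i.
  rewrite row0; set c := row i _.
  have : c *m (u%:M + v *: G) = 0 by apply/sub_kermxP; apply: row_sub.
  rewrite mulmxDr mul_mx_scalar -scalemxAr => /(congr1 (fun w => (w *m c^T) 0 0)).
  rewrite mul0mx mulmxDl -!scalemxAl [RHS]mxE mxE [X in X + _]mxE [X in _ + X]mxE quad quad1.
  move=> E; have d1 := dot_ge0 c; have d2 := dot_ge0 (c *m B).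
  have [u_gt0|u_le0] := ltP 0 u.
    apply: dot_eq0; apply/eqP; rewrite eq_le d1 andbT.
    rewrite -(ler_pM2l u_gt0) mulr0; have := mulr_ge0 v0 d2; lra.
  have v_gt0 : 0 < v by lra.
  have : c *m B = 0.
    apply: dot_eq0; apply/eqP; rewrite eq_le d2 andbT.
    rewrite -(ler_pM2l v_gt0) mulr0; have := mulr_ge0 u0 d1; lra.
  by rewrite -(mul0mx _ B) => /(row_free_inj Bfree).
pose P : 'M[{poly R}]_m := (1 - 'X)%:M + 'X *: map_mx polyC G.
have PE t : (\det P).[t] = \det ((1 - t)%:M + t *: G).
  rewrite -horner_evalE -det_map_mx; congr (\det _); apply/matrixP => i j.
  rewrite /P !mxE /= /horner_eval hornerD hornerM hornerX hornerC hornerMn.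
  by rewrite hornerD hornerN hornerC hornerX.
rewrite ltNge; apply/negP => G0.
have [||t t01 /rootP] := @poly_ivt R (- \det P) 0 1; first by [].
  rewrite !hornerN !PE subr0 scale0r addr0 det1 subrr scale1r.
  by rewrite (_ : 0%:M = 0) ?raddf0 // add0r oppr_le0 ler01 oppr_ge0.
rewrite hornerN => /eqP; rewrite oppr_eq0 PE => /eqP E.
move: t01 => /andP [t0 t1].
have := pos (1 - t) t; rewrite E eqxx subr_ge0 => /(_ t1 t0); rewrite subrK ltr01 => /(_ isT).
by [].
Qed.

End Gram.

Section Facets.
Variables (R : realType) (d' : nat).
Local Notation d := d'.+1.
Variable T : mesh R d.
Implicit Types (F : facet T) (K : cell T).

Lemma facet_card F : #|val F| = d.
Proof. by have := valP F; rewrite inE => /andP [/eqP]. Qed.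

Lemma facet_cell F : exists K : cell T, inc F K.
Proof.
have := valP F; rewrite inE => /andP [_ /existsP [K /andP [KT FK]]].
by exists (exist _ K KT).
Qed.

Lemma facet_indep F : affine_indep (@vert R d T) (val F).
Proof.
have [K FK] := facet_cell F; move: FK; rewrite /inc => FK c c1 c2.
have KF (V : nmodType) (f : 'I_(nvert T) -> V) :
    \sum_(a in val K) (if a \in val F then f a else 0) = \sum_(a in val F) f a.
  rewrite -big_mkcondr /=; apply: eq_bigl => a.
  by case: (boolP (a \in val F)) => aF; rewrite ?andbF // (fintype.subsetP FK).
pose c' a := if a \in val F then c a else 0.
have h := cells_indep (valP K) (c := c').
move=> a aF; have := h _ _ a (fintype.subsetP FK _ aF).
rewrite /c' aF; apply; first by rewrite KF.
rewrite -[RHS]c2 -KF; apply: eq_bigr => b _.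
by case: ifP => //; rewrite scale0r.
Qed.

Lemma opposite_vertex F K : inc F K -> exists2 l, l \in val K &
  forall a, (a \in val F) = (a \in val K) && (a != l).
Proof.
rewrite /inc => FK.
have : #|finset.setD (val K) (val F)| = 1%N.
  by rewrite finset.cardsD (finset.setIidPr FK) facet_card (cells_card (valP K)) subSnn.
move=> /eqP/finset.cards1P [l hl].
have lD : l \in finset.setD (val K) (val F) by rewrite hl finset.set11.
exists l => [|a]; first by move: lD; rewrite finset.in_setD => /andP [].
have /setP /(_ a) := hl; rewrite finset.in_setD finset.in_set1 => <-.
rewrite negb_and negbK; case: (boolP (a \in val F)) => // aF.
  by rewrite (fintype.subsetP FK).
by rewrite /= andbN.
Qed.

Definition fidx F (i : 'I_d) := enum_val (cast_ord (esym (facet_card F)) i).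

Lemma fidx_in F i : fidx F i \in val F. Proof. exact: enum_valP. Qed.

Lemma fidx_inj F : injective (fidx F).
Proof. by move=> i j /enum_val_inj /cast_ord_inj. Qed.

Lemma big_fidx F (V : nmodType) (f : 'I_(nvert T) -> V) :
  \sum_(a in val F) f a = \sum_i f (fidx F i).
Proof.
rewrite big_enum_val /=.
by rewrite (reindex_onto (cast_ord (esym (facet_card F))) (cast_ord (facet_card F))) /=;
  [apply: eq_bigl => i; rewrite cast_ordKV eqxx|move=> i _; rewrite cast_ordK].
Qed.

Lemma fptE F (i : 'I_d) : fpt F i = vert (fidx F i).
Proof.
have il : (i < size (enum (val F)))%N by rewrite -cardE facet_card.
rewrite /fpt (nth_map (fidx F i)) //.
by rewrite {2}/fidx (enum_val_nth (fidx F i)).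
Qed.

(** Barycentric coordinates of [fparam F t]; index 0 belongs to the base vertex of the
    parametrization and takes the remaining mass. *)
Definition tcoord (t : 'rV[R]_d') (i : 'I_d) : R :=
  if unlift ord0 i is Some j then t 0 j else 1 - \sum_j t 0 j.

Lemma tcoord_sum t : \sum_i tcoord t i = 1.
Proof.
rewrite big_ord_recl /tcoord unlift_none.
under [X in _ + X]eq_bigr do rewrite liftK.
by rewrite subrK.
Qed.

Lemma fparamE F t : fparam F t = \sum_i tcoord t i *: vert (fidx F i).
Proof.
rewrite /fparam big_ord_recl /tcoord unlift_none.
under [X in _ + X = _]eq_bigr do rewrite scalerBr.
under [X in _ = _ + X]eq_bigr do rewrite liftK.
rewrite sumrB -scaler_suml scalerBl scale1r (fptE F ord0).
under [X in _ + (X - _) = _]eq_bigr => i _ do rewrite (fptE F (lift ord0 i)).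
by rewrite addrCA addrC -!addrA [- _ + _]addrC.
Qed.

End Facets.

Section RefSimplex.
Variables (R : realType) (n : nat).

Lemma refsimplex_bounded_borel : bounded_borel (@refsimplex R n).
Proof.
split; last first.
  exists 1 => t [t0 t1] i; rewrite ger0_norm //; apply: le_trans t1.
  by rewrite (bigD1 i) //= lerDl sumr_ge0.
rewrite /borel (_ : _ @^-1` _ =
  (\bigcap_(i in [set: 'I_n]) [set t | 0 <= ev (mpolyX R (mnm1 i)) (rVt t)]) `&`
  [set t | 0 <= ev (aff (const_mx (-1)) 1) (rVt t)]).
  have mge (p : mpoly n R) :
      measurable [set t : n.-tuple (measurableTypeR R) | 0 <= ev p (rVt t)].
    have := @measurable_ev R n p measurableT _ (@measurable_itv R `[0, +oo[).
    rewrite setTI; congr (measurable _).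
    by apply/seteqP; split => t /=; rewrite in_itv /= andbT.
  by apply: measurableI => //; apply: fin_bigcap_measurable => //; exact: finite_finset.
have affE (t : 'rV[R]_n) : ev (aff (const_mx (-1)) 1) t = 1 - \sum_i t 0 i.
  rewrite ev_aff addrC; congr (_ + _); rewrite -sumrN.
  by apply: eq_bigr => i _; rewrite mxE mulN1r.
apply/seteqP; split => t /= [t0 t1]; split.
- by move=> i _ /=; rewrite evX.
- by rewrite affE subr_ge0.
- by move=> i; have := t0 i I; rewrite /= evX.
- by move: t1; rewrite affE subr_ge0.
Qed.

Lemma refsimplex_nonnull : nonnull (@refsimplex R n).
Proof.
(* The cube of side 1/(n + 1) fits in the simplex, since its coordinate sums are at most n/(n +
   1). *)
apply: (@nonnull_box _ _ _ (fun=> 0) (fun=> n.+1%:R^-1)) => [|i|t ht].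
- by have [] := refsimplex_bounded_borel.
- by rewrite invr_gt0 ltr0n.
split=> [i|]; first by have /andP [] := ht i.
apply: (@le_trans _ _ (\sum_(i < n) n.+1%:R^-1)).
  by apply: ler_sum => i _; have /andP [] := ht i.
rewrite sumr_const card_ord -[_ *+ _]mulr_natl ler_pdivrMr ?ltr0n // mul1r.
by rewrite ler_nat.
Qed.

End RefSimplex.

Section FacetIntegration.
Variables (R : realType) (d' : nat).
Local Notation d := d'.+1.
Variable T : mesh R d.
Implicit Types (F : facet T) (K : cell T) (phi psi : 'rV[R]_d -> R).

Lemma fidx_extend F (f : 'I_d -> R) : exists c, forall i, c (fidx F i) = f i.
Proof.
exists (fun a => \sum_i f i *+ (fidx F i == a)) => i.
rewrite (bigD1 i) //= eqxx big1 ?addr0 // => j ji.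
by rewrite (inj_eq (@fidx_inj R d' T F)) (negPf ji).
Qed.

Lemma fparam_in F t : refsimplex t -> fset F (fparam F t).
Proof.
move=> [t0 t1]; have [c hc] := fidx_extend F (tcoord t).
exists c; split.
- move=> a aF; have [i ->] : exists i, a = fidx F i.
    exists (cast_ord (facet_card F) (enum_rank_in aF a)).
    by rewrite /fidx cast_ordK enum_rankK_in.
  rewrite hc /tcoord; case: unliftP => [j _|_] //.
  by rewrite subr_ge0.
- by rewrite big_fidx; under eq_bigr do rewrite hc; rewrite tcoord_sum.
- by rewrite fparamE big_fidx; under [RHS]eq_bigr do rewrite hc.
Qed.

Lemma fparam_onto F y : fset F y -> exists2 t, refsimplex t & y = fparam F t.
Proof.
move=> [c [c0 c1 ->]]; rewrite big_fidx in c1.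
pose t : 'rV[R]_d' := \row_j c (fidx F (lift ord0 j)).
have tc i : tcoord t i = c (fidx F i).
  rewrite /tcoord; case: unliftP => [j ->|->]; first by rewrite mxE.
  rewrite -c1 big_ord_recl; under [X in _ - X]eq_bigr do rewrite mxE.
  by rewrite addrK.
exists t; last by rewrite fparamE big_fidx; under [RHS]eq_bigr do rewrite tc.
split=> [j|]; first by rewrite mxE c0 // fidx_in.
by have := tc ord0; rewrite /tcoord unlift_none => E; rewrite -subr_ge0 E c0 // fidx_in.
Qed.

(** The Gram matrix is B B^T for the edge vectors from the base vertex. A relation among these edges
    becomes an affine relation among the vertices once the base vertex is given minus the sum of the
    coefficients. *)
Lemma farea_elt_gt0 F : 0 < farea_elt F.
Proof.
pose B : 'M[R]_(d', d) := \matrix_(i, k) (fpt F i.+1 - fpt F 0) 0 k.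
rewrite /farea_elt sqrtr_gt0.
rewrite (_ : \matrix_(i, j) _ = B *m B^T); last first.
  apply/matrixP => i j; rewrite !mxE; apply: eq_bigr => k _.
  by rewrite !mxE.
apply: det_mul_tr_gt0.
rewrite -kermx_eq0; apply/eqP/row_matrixP => i; rewrite row0.
have [v -> vB] : exists2 v : 'rV_d', row i (kermx B) = v & v *m B = 0.
  by exists (row i (kermx B)) => //; apply/sub_kermxP; apply: row_sub.
have [c hc] := fidx_extend F
  (fun i => if unlift ord0 i is Some j then v 0 j else - \sum_j v 0 j).
have ind := facet_indep (F := F) (c := c).
apply/rowP => j; rewrite [RHS]mxE.
have <- : c (fidx F (lift ord0 j)) = v 0 j by rewrite hc liftK.
apply: ind; last exact: fidx_in.
  rewrite big_fidx big_ord_recl hc unlift_none.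
  under [X in _ + X]eq_bigr do rewrite hc liftK.
  by rewrite addrC subrr.
rewrite big_fidx big_ord_recl hc unlift_none.
under [X in _ + X]eq_bigr do rewrite hc liftK.
rewrite -[RHS]vB -(fptE F ord0); apply/rowP => k.
rewrite !mxE summxE -sumrN mulr_suml -big_split; apply: eq_bigr => j' _ /=.
by rewrite !mxE -(fptE F (lift ord0 j')) /= mulrBr mulNr addrC.
Qed.

Lemma fparam_coord F i : exists q : mpoly d' R, forall t, ev q t = fparam F t 0 i.
Proof.
exists (aff (\row_j (fpt F j.+1 - fpt F 0) 0 i) (fpt F 0 0 i)) => t.
rewrite ev_aff /fparam mxE addrC summxE; congr (_ + _).
by apply: eq_bigr => j _; rewrite mxE [in RHS]mxE mulrC.
Qed.

(** Transfers facet statements to the reference simplex, where sets of positive measure determine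
    polynomials; surjectivity of the parametrization brings the vanishing back to the facet. *)
Lemma poly_on_fparam F phi : poly_on (fset F) phi -> exists2 q : mpoly d' R,
  (forall t, refsimplex t -> phi (fparam F t) = ev q t) &
  q = 0 -> forall y, fset F y -> phi y = 0.
Proof.
move=> [p hp]; have [q hq] := ev_subst (fparam_coord F) p.
exists q => [t /fparam_in /hp ->|q0 y Fy]; first by rewrite hq.
have [t ht yE] := fparam_onto Fy.
by rewrite hp // yE -hq q0 ev0.
Qed.

Lemma fint_eq F phi psi : (forall y, fset F y -> phi y = psi y) -> fint F phi = fint F psi.
Proof.
move=> h; congr (_ * _); apply: rVint_eq => t /= ht.
by apply: h; exact: fparam_in.
Qed.

Lemma fint_linear F (a : R) phi psi : poly_on (fset F) phi -> poly_on (fset F) psi ->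
  fint F (fun x => a * phi x + psi x) = a * fint F phi + fint F psi.
Proof.
move=> /poly_on_fparam [p hp _] /poly_on_fparam [q hq _].
rewrite /fint (rVint_eq (psi := fun t => a * (phi \o fparam F) t + (psi \o fparam F) t)) //.
rewrite rVint_linear; first by rewrite mulrDr mulrCA.
- exact: refsimplex_bounded_borel.
- by exists p.
- by exists q.
Qed.

Lemma fint_ge0 F phi : (forall y, fset F y -> 0 <= phi y) -> 0 <= fint F phi.
Proof.
move=> h; apply: mulr_ge0; first exact: ltW (farea_elt_gt0 F).
by apply: rVint_ge0 => t ht; apply: h; exact: fparam_in.
Qed.

Lemma fint_eq0 F phi : poly_on (fset F) phi -> (forall y, fset F y -> 0 <= phi y) ->
  fint F phi = 0 -> forall y, fset F y -> phi y = 0.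
Proof.
move=> /poly_on_fparam [q hq q0] phi0 /eqP; rewrite mulf_eq0 gt_eqF ?farea_elt_gt0 //=.
move=> /eqP I0; apply: q0; apply: (rVint_eq0 (@refsimplex_bounded_borel R d')).
- exact: refsimplex_nonnull.
- by move=> t ht; rewrite -hq //; apply: phi0; exact: fparam_in.
- by rewrite -[RHS]I0; apply: rVint_eq => t ht; rewrite -hq.
Qed.

Lemma vanishes_on_facet F (G : set 'rV[R]_d) phi : borel G -> (0 < farea F G)%E ->
  poly_on (fset F) phi -> vanishes_on F G phi -> forall y, fset F y -> phi y = 0.
Proof.
move=> mG FG /poly_on_fparam [q hq q0] van; apply: q0.
pose A : set 'rV[R]_d' := [set t | refsimplex t /\ G (fparam F t)].
apply: (@ae_eq0_ev _ _ A).
- apply: measurableI; first by have [] := @refsimplex_bounded_borel R d'.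
  (* The parametrization as a map between tuples, where the sigma-algebra lives: its measurability
     makes the part of the reference simplex sent into [G] a Borel set. *)
  pose tau (t : d'.-tuple (measurableTypeR R)) : d.-tuple (measurableTypeR R) :=
    [tuple fparam F (rVt t) 0 i | i < d].
  have mtau : measurable_fun setT tau.
    apply/measurable_fun_tnthP => i; have [p hp] := fparam_coord F i.
    rewrite (_ : _ \o _ = fun t => ev p (rVt t)); first exact: measurable_ev.
    by apply: funext => t /=; rewrite tnth_mktuple hp.
  have := mtau measurableT _ mG; rewrite setTI; congr (measurable _).
  apply/seteqP; rewrite /preimage; split => t /=.
    by rewrite (_ : rVt (tau t) = fparam F (rVt t)) //; apply/rowP => i; rewrite rVtE tnth_mktuple.
  by rewrite (_ : rVt (tau t) = fparam F (rVt t)) //; apply/rowP => i; rewrite rVtE tnth_mktuple.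
- rewrite /nonnull lt0e measure_ge0 andbT; apply: contraTneq FG => E.
  by rewrite /farea [X in (_ * X)%E]E mule0 ltxx.
- by apply: filterS van => t /= h [ht Gt]; rewrite -hq // h.
Qed.

Lemma surf_gt0 (G : set 'rV[R]_d) : (0 < surf T G)%E -> exists F : facet T, (0 < farea F G)%E.
Proof.
move=> G0; apply: contrapT => h; move: G0; rewrite /surf big1 ?ltxx // => F _.
apply/eqP; rewrite eq_le; apply/andP; split.
  by rewrite leNgt; apply/negP => hF; apply: h; exists F.
by rewrite mule_ge0 ?measure_ge0 // lee_fin ltW // farea_elt_gt0.
Qed.

End FacetIntegration.

(** * Local test functions *)

Section CellTests.
Variables (R : realType) (d' : nat).
Local Notation d := d'.+1.
Variable T : mesh R d.
Implicit Types (F : facet T) (K : cell T) (phi psi : 'rV[R]_d -> R).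
Local Notation pol := (mpoly d R).

Lemma rVint0 n (A : set 'rV[R]_n) (phi : 'rV[R]_n -> R) : (forall x, A x -> phi x = 0) -> rVint A phi = 0.
Proof.
move=> h; rewrite (rVint_eq (psi := fun=> 0)) // /rVint /Rintegral /=.
by rewrite integral0.
Qed.

Lemma fint0 F phi : (forall x, fset F x -> phi x = 0) -> fint F phi = 0.
Proof.
by move=> h; rewrite /fint rVint0 ?mulr0 // => t /fparam_in /h.
Qed.

Lemma PolOn_poly_on l (A : set 'rV[R]_d) phi : PolOn l A phi ->
  exists2 p : pol, Pol l p & forall x, A x -> phi x = ev p x.
Proof.
move=> [p pl ->]; exists p => // x Ax.
by rewrite /patch mem_set.
Qed.

Lemma fint_sum F (J : Type) (r : seq J) (phi : J -> 'rV[R]_d -> R) :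
  (forall j, poly_on (fset F) (phi j)) ->
  fint F (fun x => \sum_(j <- r) phi j x) = \sum_(j <- r) fint F (phi j).
Proof.
move=> h; suff [] : poly_on (fset F) (fun x => \sum_(j <- r) phi j x) /\
  fint F (fun x => \sum_(j <- r) phi j x) = \sum_(j <- r) fint F (phi j) by [].
elim: r => [|j r [IH1 IH2]].
  split; first by exists 0 => x _; rewrite big_nil ev0.
  by rewrite big_nil fint0 // => x _; rewrite big_nil.
split.
  have [p hp] := h j; have [q hq] := IH1.
  by exists (p + q) => x Fx; rewrite big_cons evD hp // hq.
rewrite big_cons -IH2 -[fint F (phi j)]mul1r -fint_linear //.
by apply: fint_eq => x _; rewrite big_cons mul1r.
Qed.

(** [normal] is a choice, so a witness is needed: the gradient of the barycentric coordinate of the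
    opposite vertex points into the cell, and its negative is normalized. *)
Lemma normalP K F : inc F K -> [/\ dot (normal K F) (normal K F) = 1,
    forall a b, a \in val F -> b \in val F -> dot (normal K F) (vert a - vert b) = 0 &
    forall a b, a \in val F -> b \in val K -> b \notin val F ->
      dot (normal K F) (vert b - vert a) < 0].
Proof.
move=> FK; rewrite /normal.
set S := [set n | _]; suff [n Sn] : S !=set0 by exact: (xgetPex 0 (ex_intro _ n Sn)).
have [l lK lF] := opposite_vertex FK.
have FinK a : a \in val F -> a \in val K by rewrite lF => /andP [].
pose g := bary_g K l.
have gE a b : a \in val K -> b \in val K ->
    dot g (vert a - vert b) = (l == a)%:R - (l == b)%:R.
  move=> aK bK.
  have E c : c \in val K -> dot g (vert c) + bary_h K l = (l == c)%:R.
    move=> cK; rewrite -(bary_vert (cells_indep (valP K)) (baryP K) lK cK).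
    by rewrite ev_aff.
  by rewrite dotBr -(E a aK) -(E b bK); ring.
have a0F := fidx_in F ord0; set a0 := fidx F ord0 in a0F.
have g0 : 0 < dot g g.
  rewrite lt0r dot_ge0 andbT; apply/eqP => /dot_eq0 g0.
  have := gE l a0 lK (FinK _ a0F); rewrite g0 dotC dot0r eqxx.
  have -> : (l == a0) = false.
    by apply/negP => /eqP E; move: a0F; rewrite lF -E eqxx andbF.
  by rewrite subr0 => /eqP; rewrite eq_sym oner_eq0.
pose s := Num.sqrt (dot g g).
have s0 : 0 < s by rewrite sqrtr_gt0.
exists (- s^-1 *: g); split.
- by rewrite dotZl dotZr mulrA mulrNN -invfM -expr2 sqr_sqrtr ?(ltW g0) // mulVf ?gt_eqF.
- move=> a b aF bF; rewrite dotZl gE ?FinK //.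
  by move: aF bF; rewrite !lF ![l == _]eq_sym => /andP [_ /negPf ->] /andP [_ /negPf ->]; rewrite subrr mulr0.
- move=> a b aF bK bF; rewrite dotZl gE ?(FinK _ aF) //.
  have -> : l == b by move: bF; rewrite lF bK /= negbK eq_sym.
  move: aF; rewrite lF eq_sym => /andP [_ /negPf ->].
  by rewrite subr0 mulr1 oppr_lt0 invr_gt0.
Qed.

Lemma normal_tangent K F x a : inc F K -> fset F x -> a \in val F ->
  dot (normal K F) (x - vert a) = 0.
Proof.
move=> FK [c [_ c1 ->]] aF; have [_ h _] := normalP FK.
have -> : \sum_(i in val F) c i *: vert i - vert a = \sum_(i in val F) c i *: (vert i - vert a).
  under [RHS]eq_bigr do rewrite scalerBr.
  by rewrite sumrB -scaler_suml c1 scale1r.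
by rewrite dot_sumr big1 // => i iF; rewrite dotZr h // mulr0.
Qed.

Lemma bary_facet0 K F x a : inc F K -> fset F x -> a \in val K -> a \notin val F ->
  ev (bary K a) x = 0.
Proof.
move=> FK [c [_ c1 xE]] aK aF.
by rewrite (bary_sub (cells_indep (valP K)) (baryP K) FK c1 xE) // (negPf aF).
Qed.

(** A facet of [K] is determined by the single vertex that it omits. *)
Lemma opposite_vertex_inj K F F' l : inc F K -> inc F' K ->
  (forall a, (a \in val F) = (a \in val K) && (a != l)) -> F' != F -> l \in val K ->
  l \in val F'.
Proof.
move=> FK F'K lF F'F lK; have [l' l'K l'F] := opposite_vertex F'K.
rewrite l'F lK /=; apply: contraNneq F'F => E; apply/eqP/val_inj/setP => a.
by rewrite lF l'F E.
Qed.

(* For a in F and l opposite to F, the field along the edge from l to a weighted by the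
   barycentric coordinate of a has zero normal component on every facet other than F. *)
Lemma face_test k K (pb : fsca T) :
  (forall F, inc F K -> PolOn k.+1 (fset F) (pb F)) ->
  (forall v : 'I_d -> pol, (forall i, Pol k.+1 (v i)) ->
    intbd K (fun F x => pb F x * \sum_i ev (v i) x * normal K F 0 i) = 0) ->
  forall F, inc F K -> forall x, fset F x -> pb F x = 0.
Proof.
move=> hpb test F FK; have [P Pk PE] := PolOn_poly_on (hpb F FK).
have [l lK lF] := opposite_vertex FK.
have FinK a : a \in val F -> a \in val K by rewrite lF => /andP [].
have [_ _ nneg] := normalP FK.
have fa0 a (s : pol) : a \in val F -> Pol k s ->
    fint F (fun x => pb F x * (ev (bary K a) x * ev s x)) = 0.
  move=> aF sk; pose t := vert a - vert l.
  pose v i := t 0 i *: (bary K a * s).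
  have vn F' x : \sum_i ev (v i) x * normal K F' 0 i =
      ev (bary K a) x * ev s x * dot (normal K F') t.
    rewrite /dot mulr_sumr; apply: eq_bigr => i _.
    by rewrite evZ evM; ring.
  have vk i : Pol k.+1 (v i).
    by apply: PolZ; rewrite -[k.+1]add1n; apply: PolM => //; exact: Pol_aff.
  (* A facet other than [F] contains [l]. If it also contains [a], the edge is tangent to it;
     otherwise the barycentric coordinate of [a] vanishes on it. *)
  have := test v vk; rewrite /intbd (bigD1 F) //= big1 => [|F' /andP [F'K F'F]]; last first.
    apply: fint0 => x F'x; rewrite vn.
    have lF' := opposite_vertex_inj FK F'K lF F'F lK.
    have [aF'|aF'] := boolP (a \in val F').
      by have [_ -> //] := normalP F'K; rewrite !mulr0.
    by rewrite (bary_facet0 F'K F'x) ?FinK // !mul0r mulr0.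
  set c := dot (normal K F) t.
  have c0 : c != 0.
    rewrite /c /t -opprB dotNr oppr_eq0; apply: ltr0_neq0; apply: nneg => //.
    by rewrite lF eqxx andbF.
  rewrite addr0 (fint_eq (psi := fun x => c * (pb F x * (ev (bary K a) x * ev s x)) + 0)); last first.
    by move=> x _; rewrite vn -/c addr0; ring.
  rewrite fint_linear; first last.
  - by exists 0 => x _; rewrite ev0.
  - by exists (P * (bary K a * s)) => x Fx; rewrite PE // !evM.
  rewrite [fint _ (fun=> 0)]fint0 // addr0 => /eqP.
  by rewrite mulf_eq0 (negPf c0) => /eqP.
(* Expanding one factor of the square of [pb F] over the barycentric coordinates of the vertices of
   [F] gives integrals that all vanish by [fa0]. *)
have [s sk hs] := barycentric_decomp (fun i => vert (fidx F i)) Pk.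
have decomp x : fset F x -> ev P x = \sum_i ev (bary K (fidx F i)) x * ev (s i) x.
  move=> Fx; have [c [_ c1 xE]] := Fx.
  have cE a : a \in val F -> ev (bary K a) x = c a.
    move=> aF; rewrite (bary_sub (cells_indep (valP K)) (baryP K) FK c1 xE) ?aF //.
    exact: FinK.
  rewrite big_fidx in c1; rewrite big_fidx in xE.
  have := hs (fun i => c (fidx F i)) c1; rewrite -xE => ->.
  by apply: eq_bigr => i _; rewrite cE // fidx_in.
have sq x : fset F x -> pb F x = 0 <-> pb F x ^+ 2 = 0.
  by move=> _; split => [->|/eqP]; [rewrite expr0n|rewrite sqrf_eq0 => /eqP].
move=> x Fx; apply/sq => //.
apply: (fint_eq0 (F := F) (phi := fun x => pb F x ^+ 2)) => //.
- by exists (P ^+ 2) => y Fy; rewrite PE // !expr2 evM.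
- by move=> y _; exact: sqr_ge0.
rewrite (fint_eq (psi := fun x => \sum_i pb F x * (ev (bary K (fidx F i)) x * ev (s i) x))).
  rewrite fint_sum => [|i]; last first.
    by exists (P * (bary K (fidx F i) * s i)) => y Fy; rewrite PE // !evM.
  by rewrite big1 // => i _; apply: fa0 => //; exact: fidx_in.
by move=> y Fy; rewrite expr2 {2}PE // decomp // mulr_sumr.
Qed.

(* With l opposite to F, the field (x - l) q is tangent to the other facets, and q can be
   chosen so that its divergence is p. *)
Lemma pressure_step k K (p : pol) (pb : fsca T) F :
  Pol k p -> (forall F, inc F K -> PolOn k.+1 (fset F) (pb F)) ->
  (forall v : 'I_d -> pol, (forall i, Pol k.+1 (v i)) ->
    - rVint (cset K) (fun x => ev p x * ev (divg v) x) +
    intbd K (fun F x => pb F x * \sum_i ev (v i) x * normal K F 0 i) = 0) ->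
  inc F K -> (forall x, fset F x -> pb F x = 0) ->
  p = 0 /\ forall F', inc F' K -> forall x, fset F' x -> pb F' x = 0.
Proof.
move=> pk hpb test FK pbF.
have p0 : p = 0.
  have [l lK lF] := opposite_vertex FK.
  have [q qk qE] := euler_surj (vert l) (ltn0Sn d') pk.
  pose v i := (mpolyX R (mnm1 i) - mpolyC d (vert l 0 i)) * q.
  have vk i : Pol k.+1 (v i).
    rewrite -[k.+1]add1n; apply: PolM => //.
    by apply: PolB; [exact: PolXU|exact: PolC].
  (* The flux through [F] vanishes because [pb] does; every other facet contains [l], so x - l is
     tangent to it. The volume term that remains is minus the integral of p^2. *)
  have := test v vk; rewrite /divg qE /intbd big1 ?addr0 => [|F' F'K]; last first.
    apply: fint0 => x F'x; have [E|F'F] := eqVneq F' F.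
      by move: F'x; rewrite E => Fx; rewrite pbF // mul0r.
    have lF' := opposite_vertex_inj FK F'K lF F'F lK.
    rewrite (_ : \sum_i _ = ev q x * dot (normal K F') (x - vert l)).
      by rewrite normal_tangent // !mulr0.
    rewrite /dot mulr_sumr; apply: eq_bigr => i _.
    by rewrite evM evB evX evC !mxE; ring.
  move=> /eqP; rewrite oppr_eq0 => /eqP I0.
  have : p * p = 0.
    apply: (rVint_eq0 (cset_bounded_borel K) (cset_nonnull K)).
      by move=> x _; rewrite evM -expr2 sqr_ge0.
    by rewrite -[RHS]I0; apply: rVint_eq => x _; rewrite evM.
  by move/eqP; rewrite mulf_eq0 orbb => /eqP.
split=> //; apply: (face_test hpb) => v vk.
rewrite -[RHS](test v vk) rVint0 ?oppr0 ?add0r // => x _.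
by rewrite p0 ev0 mul0r.
Qed.

Lemma poly_deriv0 (q : {poly R}) : (forall t, q^`().[t] = 0) -> forall s t, q.[s] = q.[t].
Proof.
move=> h s t.
have q'0 : q^`() = 0.
  apply: (@roots_geq_poly_eq0 _ _ [seq i%:R | i <- iota 0 (size q^`())]).
  - by apply/allP => u _; rewrite /root h.
  - by rewrite map_inj_uniq ?iota_uniq //; apply: mulrIn; exact: oner_neq0.
  - by rewrite size_map size_iota.
have : (size q <= 1)%N.
  apply/leq_sizeP => -[//|j] _; have /polyP /(_ j) := q'0.
  by rewrite coef_deriv coef0 => /eqP; rewrite mulrn_eq0 => /eqP.
by move=> /size1_polyC ->; rewrite !hornerC.
Qed.

(* Along the line through x and y, the component of v in the direction x - y has
   derivative eps v (x - y) . (x - y). *)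
Lemma rigid_line (v : 'I_d -> pol) (x y : 'rV[R]_d) : (forall i j, eps v i j = 0) ->
  dot (\row_i ev (v i) x) (x - y) = dot (\row_i ev (v i) y) (x - y).
Proof.
move=> v0; pose w := x - y.
have hq i := ev_line (v i) y w.
pose Q i := s2val (cid2 (hq i)).
have Q1 i : forall t, (Q i).[t] = ev (v i) (y + t *: w) := s2valP (cid2 (hq i)).
have Q2 i : forall t, (Q i)^`().[t] = \sum_j ev (mderiv j (v i)) (y + t *: w) * w 0 j :=
  s2valP' (cid2 (hq i)).
pose q := \sum_i w 0 i *: Q i.
have qE t : q.[t] = dot (\row_i ev (v i) (y + t *: w)) w.
  rewrite /q horner_sum; apply: eq_bigr => i _.
  by rewrite hornerZ Q1 mxE mulrC.
have := @poly_deriv0 q _ 1 0; rewrite !qE scale0r addr0 scale1r /w addrC subrK; apply.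
move=> t; rewrite /q raddf_sum horner_sum /=.
under eq_bigr do rewrite derivZ hornerZ Q2 mulr_sumr.
set z := y + t *: w.
pose D i j := w 0 i * (ev (mderiv j (v i)) z * w 0 j).
(* With zero strain the Jacobian is antisymmetric, so exchanging the indices changes the sign of the
   quadratic form. *)
have sym : \sum_i \sum_j D i j = - \sum_i \sum_j D i j.
  rewrite [in RHS]exchange_big -sumrN; apply: eq_bigr => i _; rewrite -sumrN.
  apply: eq_bigr => j _; have /(congr1 (fun p => ev p z)) := v0 i j.
  rewrite ev0 /eps evZ evD => /eqP; rewrite mulf_eq0 invr_eq0 pnatr_eq0 /= addr_eq0 => /eqP E.
  by rewrite /D E; ring.
by move: sym; rewrite /D; lra.
Qed.

(** Let V be the value of [v] at an interior point x. By [rigid_line], V . a = V . x for each vertex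
    a of [F]. As V . x is the barycentric mean of the V . a and the weight of the opposite vertex is
    positive, that vertex satisfies the same equality. Hence V . y does not depend on y, and V =
    0. *)
Lemma rigid_step K F (v : 'I_d -> pol) : inc F K -> (forall i j, eps v i j = 0) ->
  (forall i x, fset F x -> ev (v i) x = 0) -> forall i, v i = 0.
Proof.
move=> FK v0 vF i; have [l lK lF] := opposite_vertex FK.
have [x0 hx0] := cell_int_nonempty K.
apply: (ev_eq0_open (open_cell_int (K := K)) hx0) => x Kx.
pose V := \row_i ev (v i) x.
have vertF a : a \in val F -> fset F (vert a).
  move=> aF; exists (fun b => (b == a)%:R); split => [b _||]; first exact: ler0n.
    rewrite (bigD1 a) //= eqxx big1 ?addr0 // => b /andP [_ /negPf ->] //.
  rewrite (bigD1 a) //= eqxx scale1r big1 ?addr0 // => b /andP [_ /negPf ->].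
  by rewrite scale0r.
have VF a : a \in val F -> dot V (vert a) = dot V x.
  move=> aF; apply/eqP; rewrite eq_sym -subr_eq0 -dotBr (rigid_line _ _ v0).
  rewrite (_ : \row_i0 _ = 0) ?[dot 0 _]dotC ?dot0r //.
  by apply/rowP => j; rewrite !mxE vF //; exact: vertF.
have [l1 l2] := baryP K x.
have Vx : dot V x = \sum_(a in val K) ev (bary K a) x * dot V (vert a).
  by rewrite -{1}l2 dot_sumr; apply: eq_bigr => a _; rewrite dotZr.
have Vl : dot V (vert l) = dot V x.
  have : \sum_(a in val K) ev (bary K a) x * (dot V (vert a) - dot V x) = 0.
    by under eq_bigr do rewrite mulrBr; rewrite sumrB -mulr_suml l1 mul1r -Vx subrr.
  rewrite (bigD1 l) //= big1 => [|a /andP [aK al]]; last first.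
    by rewrite VF ?subrr ?mulr0 // lF aK.
  rewrite addr0 => /eqP; rewrite mulf_eq0 gt_eqF ?Kx //= subr_eq0 => /eqP //.
have VK a : a \in val K -> dot V (vert a) = dot V x.
  by move=> aK; have [->//|al] := eqVneq a l; apply: VF; rewrite lF aK.
have Vy y : dot V y = dot V x.
  have [m1 m2] := baryP K y; rewrite -{1}m2 dot_sumr.
  under eq_bigr => a aK do rewrite dotZr VK //.
  by rewrite -mulr_suml m1 mul1r.
have V0 : V = 0 by apply: dot_eq0; rewrite Vy -(Vy 0) dot0r.
by move/rowP: V0 => /(_ i); rewrite !mxE.
Qed.

End CellTests.

(** * Bilinear forms and discrete spaces *)

Section Submodules.
Variable F : fieldType.

Lemma submodset_prod (V W : lmodType F) (S : set V) (S' : set W) :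
  submodset S -> submodset S' -> submodset (S `*` S').
Proof.
move=> [S0 Sl] [S'0 S'l]; split=> [|a u v [hu hu'] [hv hv']]; first by split.
by split; [exact: Sl|exact: S'l].
Qed.

Lemma submodset_fun (I : Type) (V : lmodType F) (S : I -> set V) :
  (forall i, submodset (S i)) -> submodset ([set f | forall i, S i (f i)] : set (I -> V)).
Proof.
move=> h; split=> [i|a u v hu hv i]; first by have [] := h i.
by have [_ Sl] := h i; exact: Sl.
Qed.

Lemma submodsetI (V : lmodType F) (S S' : set V) :
  submodset S -> submodset S' -> submodset (S `&` S').
Proof.
move=> [S0 Sl] [S'0 S'l]; split=> [|a u v [hu hu'] [hv hv']]; first by split.
by split; [exact: Sl|exact: S'l].
Qed.

Definition linear_on (V : lmodType F) (S : set V) (f : V -> F) : Prop :=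
  forall a u v, S u -> S v -> f (a *: u + v) = a * f u + f v.

Lemma linear_on0 (V : lmodType F) (S : set V) f : submodset S -> linear_on S f -> f 0 = 0.
Proof.
move=> [S0 _] fl; have := fl (-1) 0 0 S0 S0.
by rewrite scaler0 addr0 mulN1r addNr.
Qed.

Lemma linear_onD (V : lmodType F) (S : set V) f g :
  linear_on S f -> linear_on S g -> linear_on S (fun x => f x + g x).
Proof. by move=> hf hg a u v hu hv; rewrite hf // hg // mulrDr addrACA. Qed.

Lemma linear_onN (V : lmodType F) (S : set V) f :
  linear_on S f -> linear_on S (fun x => - f x).
Proof. by move=> hf a u v hu hv; rewrite hf // opprD mulrN. Qed.

Lemma linear_onZ (V : lmodType F) (S : set V) c f :
  linear_on S f -> linear_on S (fun x => c * f x).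
Proof. by move=> hf a u v hu hv; rewrite hf // mulrDr mulrCA. Qed.

Variables (V1 V2 V3 V4 : lmodType F).
Variables (S1 : set V1) (S2 : set V2) (S3 : set V3) (S4 : set V4).
Local Notation V := (V1 * V2 * V3 * V4)%type.
Local Notation S := (S1 `*` S2 `*` S3 `*` S4).
Variables (E1 : V -> V1 -> F) (E2 : V -> V2 -> F) (E3 : V -> V3 -> F) (E4 : V -> V4 -> F).
Variables (L1 : V1 -> F) (L2 : V2 -> F) (L3 : V3 -> F) (L4 : V4 -> F).

(** The four equations are added into one form on the product space; taking three zero test
    components separates them again, since linear maps vanish at 0. *)
Lemma variational_system :
  submodset S1 -> submodset S2 -> submodset S3 -> submodset S4 ->
  fspan S1 -> fspan S2 -> fspan S3 -> fspan S4 ->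
  (forall y, S1 y -> linear_on S (E1^~ y)) -> (forall y, S2 y -> linear_on S (E2^~ y)) ->
  (forall y, S3 y -> linear_on S (E3^~ y)) -> (forall y, S4 y -> linear_on S (E4^~ y)) ->
  (forall x, S x -> linear_on S1 (E1 x)) -> (forall x, S x -> linear_on S2 (E2 x)) ->
  (forall x, S x -> linear_on S3 (E3 x)) -> (forall x, S x -> linear_on S4 (E4 x)) ->
  linear_on S1 L1 -> linear_on S2 L2 -> linear_on S3 L3 -> linear_on S4 L4 ->
  (forall x, S x -> (forall y, S1 y -> E1 x y = 0) -> (forall y, S2 y -> E2 x y = 0) ->
    (forall y, S3 y -> E3 x y = 0) -> (forall y, S4 y -> E4 x y = 0) -> x = 0) ->
  exists! x, S x /\ [/\ forall y, S1 y -> E1 x y = L1 y, forall y, S2 y -> E2 x y = L2 y,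
    forall y, S3 y -> E3 x y = L3 y & forall y, S4 y -> E4 x y = L4 y].
Proof.
move=> m1 m2 m3 m4 f1 f2 f3 f4 l1 l2 l3 l4 r1 r2 r3 r4 c1 c2 c3 c4 nd.
pose B (x y : V) := E1 x y.1.1.1 + E2 x y.1.1.2 + E3 x y.1.2 + E4 x y.2.
pose L (y : V) := L1 y.1.1.1 + L2 y.1.1.2 + L3 y.1.2 + L4 y.2.
have mS : submodset S by do !apply: submodset_prod.
have split_system (G1 : V1 -> F) (G2 : V2 -> F) (G3 : V3 -> F) (G4 : V4 -> F) :
    linear_on S1 G1 -> linear_on S2 G2 -> linear_on S3 G3 -> linear_on S4 G4 ->
    forall x, S x ->
    (forall y, S y -> B x y = G1 y.1.1.1 + G2 y.1.1.2 + G3 y.1.2 + G4 y.2) ->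
    [/\ forall y, S1 y -> E1 x y = G1 y, forall y, S2 y -> E2 x y = G2 y,
      forall y, S3 y -> E3 x y = G3 y & forall y, S4 y -> E4 x y = G4 y].
  move=> g1 g2 g3 g4 x Sx h.
  have [[z1 _] [z2 _] [z3 _] [z4 _]] := And4 m1 m2 m3 m4.
  have [e1 e2 e3 e4] := And4 (linear_on0 m1 (r1 _ Sx)) (linear_on0 m2 (r2 _ Sx))
    (linear_on0 m3 (r3 _ Sx)) (linear_on0 m4 (r4 _ Sx)).
  have [k1 k2 k3 k4] := And4 (linear_on0 m1 g1) (linear_on0 m2 g2)
    (linear_on0 m3 g3) (linear_on0 m4 g4).
  split=> y Sy.
  - have := h (y, 0, 0, 0); rewrite /B /= e2 e3 e4 k2 k3 k4 !addr0; exact.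
  - have := h (0, y, 0, 0); rewrite /B /= e1 e3 e4 k1 k3 k4 !addr0 !add0r; exact.
  - have := h (0, 0, y, 0); rewrite /B /= e1 e2 e4 k1 k2 k4 !addr0 !add0r; exact.
  - have := h (0, 0, 0, y); rewrite /B /= e1 e2 e3 k1 k2 k3 !add0r; exact.
have [|||||x [[Sx hx] ux]] := @variational_exists_unique F _ S B L mS.
- by do !apply: fspan_prod.
- move=> y [[[y1 y2] y3] y4]; rewrite /B.
  by do !apply: linear_onD; [exact: l1|exact: l2|exact: l3|exact: l4].
- move=> z Sz a u v [[[u1 u2] u3] u4] [[[v1 v2] v3] v4]; rewrite /B /=.
  by rewrite (r1 z Sz) // (r2 z Sz) // (r3 z Sz) // (r4 z Sz) //; ring.
- move=> a u v [[[u1 u2] u3] u4] [[[v1 v2] v3] v4]; rewrite /L /=.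
  by rewrite c1 // c2 // c3 // c4 //; ring.
- move=> z Sz hz.
  have lin0 (W : lmodType F) (S' : set W) : linear_on S' (fun=> 0).
    by move=> a u v _ _; rewrite mulr0 addr0.
  have [|||||e1 e2 e3 e4] := split_system (fun=> 0) (fun=> 0) (fun=> 0) (fun=> 0) _ _ _ _ z Sz.
  - exact: lin0.
  - exact: lin0.
  - exact: lin0.
  - exact: lin0.
  - by move=> y Sy; rewrite hz // !addr0.
  - exact: nd.
exists x; split; first by split => //; exact: split_system.
move=> x' [Sx' [e1 e2 e3 e4]]; apply: ux; split => // y [[[y1 y2] y3] y4].
by rewrite /B /L e1 // e2 // e3 // e4.
Qed.

End Submodules.

Section PolyOn.
Variables (R : realType) (n : nat) (A : set 'rV[R]_n).
Implicit Types (phi psi : 'rV[R]_n -> R).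

Lemma poly_on_ev (p : mpoly n R) : poly_on A (ev p).
Proof. by exists p. Qed.

Lemma poly_on_cst c : poly_on A (fun=> c).
Proof. by exists (mpolyC n c) => x _; rewrite evC. Qed.

Lemma poly_onB phi psi : poly_on A phi -> poly_on A psi -> poly_on A (fun x => phi x - psi x).
Proof. by move=> [p hp] [q hq]; exists (p - q) => x Ax; rewrite evB hp // hq. Qed.

Lemma poly_onM phi psi : poly_on A phi -> poly_on A psi -> poly_on A (fun x => phi x * psi x).
Proof. by move=> [p hp] [q hq]; exists (p * q) => x Ax; rewrite evM hp // hq. Qed.

Lemma poly_on_sum (J : Type) (r : seq J) (phi : J -> 'rV[R]_n -> R) :
  (forall j, poly_on A (phi j)) -> poly_on A (fun x => \sum_(j <- r) phi j x).
Proof.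
move=> h; elim: r => [|j r [p hp]].
  by exists 0 => x _; rewrite big_nil ev0.
by have [q hq] := h j; exists (q + p) => x Ax; rewrite big_cons evD hq // hp.
Qed.

End PolyOn.

Section Forms.
Variables (R : realType) (d' : nat).
Local Notation d := d'.+1.
Variable T : mesh R d.
Local Notation pol := (mpoly d R).

Lemma intOm_linear a (phi psi : cell T -> 'rV[R]_d -> R) :
  (forall K, poly_on (cset K) (phi K)) -> (forall K, poly_on (cset K) (psi K)) ->
  intOm (fun K x => a * phi K x + psi K x) = a * intOm phi + intOm psi.
Proof.
move=> h1 h2; rewrite /intOm mulr_sumr -big_split; apply: eq_bigr => K _ /=.
by rewrite rVint_linear //; exact: cset_bounded_borel.
Qed.

Lemma intOm_eq (phi psi : cell T -> 'rV[R]_d -> R) :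
  (forall K x, phi K x = psi K x) -> intOm phi = intOm psi.
Proof. by move=> h; apply: eq_bigr => K _; apply: rVint_eq. Qed.

Lemma intbd_linear a K (phi psi : facet T -> 'rV[R]_d -> R) :
  (forall F, poly_on (fset F) (phi F)) -> (forall F, poly_on (fset F) (psi F)) ->
  intbd K (fun F x => a * phi F x + psi F x) = a * intbd K phi + intbd K psi.
Proof.
move=> h1 h2; rewrite /intbd mulr_sumr -big_split; apply: eq_bigr => F _ /=.
by rewrite fint_linear.
Qed.

Lemma intbd_eq K (phi psi : facet T -> 'rV[R]_d -> R) :
  (forall F x, phi F x = psi F x) -> intbd K phi = intbd K psi.
Proof. by move=> h; apply: eq_bigr => F _; apply: fint_eq. Qed.

Lemma ipQC (p q : esca T) : ipQ p q = ipQ q p.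
Proof. by apply: intOm_eq => K x; rewrite mulrC. Qed.

Lemma ipVC (u v : evec T) : ipV u v = ipV v u.
Proof. by apply: intOm_eq => K x; apply: eq_bigr => i _; rewrite mulrC. Qed.

Lemma ipQ_linear (q : esca T) : linear_on (V := esca T) setT (fun p => ipQ p q).
Proof.
move=> a u v _ _; rewrite -intOm_linear.
- by apply: intOm_eq => K x; rewrite evD evZ mulrDl mulrA.
- by move=> K; apply: poly_onM; exact: poly_on_ev.
- by move=> K; apply: poly_onM; exact: poly_on_ev.
Qed.

Lemma ipV_linear (w : evec T) : linear_on (V := evec T) setT (fun u => ipV u w).
Proof.
move=> a u v _ _; rewrite -intOm_linear.
- apply: intOm_eq => K x; rewrite mulr_sumr -big_split; apply: eq_bigr => i _ /=.
  by rewrite evD evZ mulrDl mulrA.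
- by move=> K; apply: poly_on_sum => i; apply: poly_onM; exact: poly_on_ev.
- by move=> K; apply: poly_on_sum => i; apply: poly_onM; exact: poly_on_ev.
Qed.

Lemma eps_linear a (u v : 'I_d -> pol) i j :
  eps (a *: u + v) i j = a *: eps u i j + eps v i j.
Proof.
rewrite /eps !mderivD !mderivZ scalerA mulrC -scalerA -scalerDr; congr (_ *: _).
by rewrite scalerDr addrACA.
Qed.

Lemma divg_linear a (u v : 'I_d -> pol) : divg (a *: u + v) = a *: divg u + divg v.
Proof.
rewrite /divg scaler_sumr -big_split; apply: eq_bigr => i _ /=.
by rewrite mderivD mderivZ.
Qed.

Lemma ipeps_linear (w : evec T) : linear_on (V := evec T) setT (fun u => ipeps u w).
Proof.
move=> a u v _ _; rewrite -intOm_linear.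
- apply: intOm_eq => K x; rewrite mulr_sumr -big_split; apply: eq_bigr => i _ /=.
  rewrite mulr_sumr -big_split; apply: eq_bigr => j _ /=.
  by rewrite eps_linear evD evZ mulrDl mulrA.
- by move=> K; do 2 (apply: poly_on_sum => ?); apply: poly_onM; exact: poly_on_ev.
- by move=> K; do 2 (apply: poly_on_sum => ?); apply: poly_onM; exact: poly_on_ev.
Qed.

Lemma ipepsC (u v : evec T) : ipeps u v = ipeps v u.
Proof.
by apply: intOm_eq => K x; apply: eq_bigr => i _; apply: eq_bigr => j _; rewrite mulrC.
Qed.

(** Element components are polynomials by their type, while facet components are arbitrary
    functions; this is the domain on which the facet integrals are linear. *)
Definition fvec_poly : set (evec T * fvec T) := [set v | forall F i, poly_on (fset F) (v.2 F i)].
Definition fsca_poly : set (esca T * fsca T) := [set q | forall F, poly_on (fset F) (q.2 F)].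

Lemma poly_on_jmp v K F i : fvec_poly v -> poly_on (fset F) (jmp v K F i).
Proof. by move=> h; apply: poly_onB; [exact: poly_on_ev|exact: h]. Qed.

Lemma jmp_linear a (u v : evec T * fvec T) K F i x :
  jmp (a *: u + v) K F i x = a * jmp u K F i x + jmp v K F i x.
Proof.
rewrite /jmp [ev _ _]evD [ev (_ *: _) _]evZ.
have -> : (a *: u + v).2 F i x = a * u.2 F i x + v.2 F i x by [].
by ring.
Qed.

Lemma poly_on_consist mu (u v : evec T * fvec T) K F : fvec_poly v -> poly_on (fset F) (fun x =>
  \sum_i (2 * mu * \sum_j ev (eps (u.1 K) i j) x * normal K F 0 j) * jmp v K F i x).
Proof.
move=> hv; apply: poly_on_sum => i; apply: poly_onM; last exact: poly_on_jmp.
apply: poly_onM; first exact: poly_on_cst.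
by apply: poly_on_sum => j; apply: poly_onM; [exact: poly_on_ev|exact: poly_on_cst].
Qed.

Lemma consist_linear_l mu v : fvec_poly v -> linear_on (V := (evec T * fvec T)%type) fvec_poly (fun u => consist mu u v).
Proof.
move=> hv a u u' hu hu'; rewrite /consist mulr_sumr -big_split; apply: eq_bigr => K _ /=.
rewrite -intbd_linear => [|F|F]; [|exact: poly_on_consist|exact: poly_on_consist].
apply: intbd_eq => F x; rewrite mulr_sumr -big_split; apply: eq_bigr => i _ /=.
rewrite (eq_bigr (fun j => a * (ev (eps (u.1 K) i j) x * normal K F 0 j) +
  ev (eps (u'.1 K) i j) x * normal K F 0 j)) => [|j _].
  by rewrite big_split -mulr_sumr /=; ring.
by rewrite eps_linear evD evZ; ring.
Qed.

Lemma consist_linear_r mu u : fvec_poly u -> linear_on (V := (evec T * fvec T)%type) fvec_poly (consist mu u).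
Proof.
move=> hu a v v' hv hv'; rewrite /consist mulr_sumr -big_split; apply: eq_bigr => K _ /=.
rewrite -intbd_linear => [|F|F]; [|exact: poly_on_consist|exact: poly_on_consist].
apply: intbd_eq => F x; rewrite mulr_sumr -big_split; apply: eq_bigr => i _ /=.
by rewrite jmp_linear; ring.
Qed.

(** The two consistency terms are exchanged; linearity in the second argument is thereby inherited
    from the first. *)
Lemma a_hC beta mu (u v : evec T * fvec T) : a_h beta mu u v = a_h beta mu v u.
Proof.
rewrite /a_h ipepsC -addrA [- _ - _]addrC addrA; congr (_ + _ - _ - _).
apply: eq_bigr => K _; apply: intbd_eq => F x; congr (_ * _).
by apply: eq_bigr => i _; rewrite mulrC.
Qed.

Lemma a_h_linear beta mu v : fvec_poly v -> linear_on (V := (evec T * fvec T)%type) fvec_poly (fun u => a_h beta mu u v).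
Proof.
move=> hv; rewrite /a_h.
do !apply: linear_onD.
- apply: linear_onZ => a u u' _ _; exact: ipeps_linear.
- move=> a u u' hu hu'; rewrite mulr_sumr -big_split; apply: eq_bigr => K _ /=.
  have pj w : fvec_poly w -> forall F, poly_on (fset F) (fun x =>
      2 * beta * mu / hK K * \sum_i jmp w K F i x * jmp v K F i x).
    move=> hw F; apply: poly_onM; first exact: poly_on_cst.
    by apply: poly_on_sum => i; apply: poly_onM; exact: poly_on_jmp.
  rewrite -intbd_linear => [|F|F]; [|exact: pj|exact: pj].
  apply: intbd_eq => F x; rewrite mulrCA -mulrDr; congr (_ * _).
  rewrite mulr_sumr -big_split; apply: eq_bigr => i _ /=.
  by rewrite jmp_linear; ring.
- by apply: linear_onN; exact: consist_linear_l.
- by apply: linear_onN; exact: consist_linear_r.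
Qed.

Lemma b_h_linear_l q : fsca_poly q -> linear_on (V := (evec T * fvec T)%type) fvec_poly (fun v => b_h v q).
Proof.
move=> hq; rewrite /b_h; apply: linear_onD.
  apply: linear_onN => a u u' _ _; rewrite -intOm_linear.
  - apply: intOm_eq => K x; rewrite [divg _]divg_linear evD evZ; ring.
  - by move=> K; apply: poly_onM; exact: poly_on_ev.
  - by move=> K; apply: poly_onM; exact: poly_on_ev.
move=> a u u' hu hu'; rewrite mulr_sumr -big_split; apply: eq_bigr => K _ /=.
have pj w : fvec_poly w -> forall F, poly_on (fset F) (fun x =>
    q.2 F x * \sum_i jmp w K F i x * normal K F 0 i).
  move=> hw F; apply: poly_onM; first exact: hq.
  by apply: poly_on_sum => i; apply: poly_onM; [exact: poly_on_jmp|exact: poly_on_cst].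
rewrite -intbd_linear => [|F|F]; [|exact: pj|exact: pj].
apply: intbd_eq => F x; rewrite mulrCA -mulrDr; congr (_ * _).
rewrite mulr_sumr -big_split; apply: eq_bigr => i _ /=.
by rewrite jmp_linear; ring.
Qed.

Lemma b_h_linear_r v : fvec_poly v -> linear_on (V := (esca T * fsca T)%type) fsca_poly (b_h v).
Proof.
move=> hv; rewrite /b_h; apply: linear_onD.
  apply: linear_onN => a q q' _ _; rewrite -intOm_linear.
  - apply: intOm_eq => K x.
    have -> : (a *: q + q').1 K = a *: q.1 K + q'.1 K by [].
    by rewrite evD evZ; ring.
  - by move=> K; apply: poly_onM; exact: poly_on_ev.
  - by move=> K; apply: poly_onM; exact: poly_on_ev.
move=> a q q' hq hq'; rewrite mulr_sumr -big_split; apply: eq_bigr => K _ /=.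
have pj w : fsca_poly w -> forall F, poly_on (fset F) (fun x =>
    w.2 F x * \sum_i jmp v K F i x * normal K F 0 i).
  move=> hw F; apply: poly_onM; first exact: hw.
  by apply: poly_on_sum => i; apply: poly_onM; [exact: poly_on_jmp|exact: poly_on_cst].
rewrite -intbd_linear => [|F|F]; [|exact: pj|exact: pj].
apply: intbd_eq => F x.
rewrite [X in X * _](_ : _ = a * q.2 F x + q'.2 F x) //.
by ring.
Qed.

Lemma ipL2Q_linear (Om : set 'rV[R]_d) g : L2 Om g -> linear_on (V := esca T) setT (ipL2Q Om g).
Proof.
move=> hg a p q _ _; rewrite /ipL2Q mulr_sumr -big_split; apply: eq_bigr => K _ /=.
have bK := cset_bounded_borel K; rewrite !rVint_setI.
have E r : rVint (cset K) (patch (fun=> 0) Om (fun x => g x * ev r x)) =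
    rVint (cset K) (fun x => patch (fun=> 0) Om g x * ev r x).
  by apply: rVint_eq => x _; rewrite /patch; case: ifP => // _; rewrite mul0r.
rewrite !E -rVint_linear_integrable.
- by apply: rVint_eq => x _; rewrite evD evZ; ring.
- by have [] := bK.
- exact: L2_integrable_mul.
- exact: L2_integrable_mul.
Qed.

Lemma ipL2V_linear (Om : set 'rV[R]_d) (f : 'I_d -> 'rV[R]_d -> R) :
  (forall j, L2 Om (f j)) -> linear_on (V := evec T) setT (ipL2V Om f).
Proof.
move=> hf a u v _ _; rewrite /ipL2V mulr_sumr -big_split; apply: eq_bigr => K _ /=.
have bK := cset_bounded_borel K; rewrite !rVint_setI.
have E (w : 'I_d -> pol) :
    rVint (cset K) (patch (fun=> 0) Om (fun x => \sum_i f i x * ev (w i) x)) =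
    rVint (cset K) (fun x => \sum_i patch (fun=> 0) Om (f i) x * ev (w i) x).
  apply: rVint_eq => x _; rewrite /patch; case: ifP => // _.
  by rewrite big1 // => i _; rewrite mul0r.
have int (w : 'I_d -> pol) : integrable_on (cset K)
    (fun x => \sum_i patch (fun=> 0) Om (f i) x * ev (w i) x).
  by apply: integrable_on_sum => // i; exact: L2_integrable_mul.
rewrite (E (u K)) (E (v K)) (E ((a *: u + v) K)) -rVint_linear_integrable //; last by have [] := bK.
apply: rVint_eq => x _; rewrite mulr_sumr -big_split; apply: eq_bigr => i _ /=.
have -> : (a *: u + v) K i = a *: u K i + v K i by [].
by rewrite evD evZ; ring.
Qed.

End Forms.

(** * The discrete spaces as finitely spanned subspaces *)

Section Spaces.
Variables (R : realType) (d' : nat).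
Local Notation d := d'.+1.
Variable T : mesh R d.
Local Notation pol := (mpoly d R).

(** Named so that a linear structure can be attached: [PolOn l A] is the image of [Pol l] under
    it. *)
Definition restrict_pol (A : set 'rV[R]_d) (p : pol) : 'rV[R]_d -> R :=
  patch (fun=> 0) A (ev p).

Lemma restrict_pol_linear A : linear (restrict_pol A).
Proof.
move=> a p q; apply: funext => x.
rewrite [RHS](_ : _ = a * restrict_pol A p x + restrict_pol A q x) // /restrict_pol /patch.
by case: ifP => _; [rewrite evD evZ|rewrite mulr0 addr0].
Qed.

HB.instance Definition _ (A : set 'rV[R]_d) :=
  GRing.isLinear.Build R pol ('rV[R]_d -> R) _ (restrict_pol A) (@restrict_pol_linear A).

Lemma fspan_PolOn l (A : set 'rV[R]_d) : fspan (PolOn l A).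
Proof.
apply: fspanS (fspan_image (restrict_pol A) (@fspan_Pol R d l)).
by move=> phi [p pl ->]; exists p.
Qed.

Lemma submodset_PolOn l (A : set 'rV[R]_d) : submodset (PolOn l A).
Proof.
have [P0 Pl] := @Pol_submod R d l; split.
  by exists 0 => //; rewrite -/(restrict_pol A 0) linear0.
move=> a u v [p pl ->] [q ql ->]; exists (a *: p + q); first exact: Pl.
by rewrite -/(restrict_pol A (a *: p + q)) restrict_pol_linear.
Qed.

Lemma submodset_Vh k : submodset (@Vh R d T k).
Proof.
apply: (@submodset_fun R (cell T) _ (fun _ => [set f : 'I_d -> pol | forall i, Pol k (f i)])) => K.
by apply: (@submodset_fun R 'I_d _ (fun _ => Pol k)) => i; exact: Pol_submod.
Qed.

Lemma fspan_Vh k : fspan (@Vh R d T k).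
Proof.
apply: (@fspan_fun R (cell T) _ (fun _ => [set f : 'I_d -> pol | forall i, Pol k (f i)])) => K.
by apply: (@fspan_fun R 'I_d _ (fun _ => Pol k)) => i; exact: fspan_Pol.
Qed.

Lemma submodset_Qh k : submodset (@Qh R d T k).
Proof. by apply: (@submodset_fun R (cell T) _ (fun _ => Pol k.-1)) => K; exact: Pol_submod. Qed.

Lemma fspan_Qh k : fspan (@Qh R d T k).
Proof. by apply: (@fspan_fun R (cell T) _ (fun _ => Pol k.-1)) => K; exact: fspan_Pol. Qed.

Lemma submodset_Qbar k : submodset (@Qbar R d T k).
Proof.
by apply: (@submodset_fun R (facet T) _ (fun F => PolOn k (fset F))) => F; exact: submodset_PolOn.
Qed.

Lemma fspan_Qbar k : fspan (@Qbar R d T k).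
Proof.
by apply: (@fspan_fun R (facet T) _ (fun F => PolOn k (fset F))) => F; exact: fspan_PolOn.
Qed.

Lemma submodset_vanishes (F : facet T) (G : set 'rV[R]_d) : submodset (vanishes_on F G).
Proof.
split=> [|a u v hu hv]; first exact: aeW.
apply: filterS2 hu hv => t hu hv ht Gt.
rewrite [LHS](_ : _ = a * u (fparam F (rVt t)) + v (fparam F (rVt t))) //.
by rewrite hu // hv // mulr0 addr0.
Qed.

Lemma submodset_Qbar0 k GP : submodset (@Qbar0 R d T k GP).
Proof.
apply: submodsetI; first exact: submodset_Qbar.
apply: (@submodset_fun R (facet T) _ (fun F => vanishes_on F GP)) => F.
exact: submodset_vanishes.
Qed.

Lemma submodset_C0skel : submodset (@C0skel R d T).
Proof.
split=> [i|a u v hu hv i].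
  by exists (fun=> 0) => //; move=> x; exact: cvg_cst.
have [g cg gE] := hu i; have [h ch hE] := hv i.
exists (fun x => a * g x + h x) => [x|F x Fx].
  apply: cvgD; last exact: ch.
  by apply: cvgM; [exact: cvg_cst|exact: cg].
by rewrite -(gE F) // -(hE F).
Qed.

Lemma submodset_Vbar k m GD : submodset (@Vbar R d T k m GD).
Proof.
have h : submodset (@Vbar_hdg R d T k GD).
  pose S (F : facet T) := PolOn k (fset F) `&` vanishes_on F GD.
  apply: (@submodset_fun R (facet T) _ (fun F =>
    [set f : 'I_d -> 'rV[R]_d -> R | forall i, S F (f i)])) => F.
  apply: (@submodset_fun R 'I_d _ (fun _ => S F)) => i.
  by apply: submodsetI; [exact: submodset_PolOn|exact: submodset_vanishes].
by case: m => //=; apply: submodsetI => //; exact: submodset_C0skel.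
Qed.

Lemma Vbar_sub_hdg k m GD : @Vbar R d T k m GD `<=` @Vbar_hdg R d T k GD.
Proof. by case: m => //= v []. Qed.

Lemma fspan_Vbar k m GD : fspan (@Vbar R d T k m GD).
Proof.
pose S (F : facet T) : set ('I_d -> 'rV[R]_d -> R) := [set f | forall i, PolOn k (fset F) (f i)].
apply: (@fspanS _ _ _ [set v | forall F, S F (v F)]).
  by move=> v /Vbar_sub_hdg hv F i; have [] := hv F i.
apply: fspan_fun => F.
by apply: (@fspan_fun R 'I_d _ (fun _ => PolOn k (fset F))) => i; exact: fspan_PolOn.
Qed.

Lemma bVh_poly k m GD v : @bVh R d T k m GD v -> fvec_poly v.
Proof.
move=> [_ /Vbar_sub_hdg hv] F i; have [h _] := hv F i.
by have [p _ hp] := PolOn_poly_on h; exists p.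
Qed.

Lemma bQh_poly k q : @bQh R d T k q -> fsca_poly q.
Proof. by move=> [_ hq] F; have [p _ hp] := PolOn_poly_on (hq F); exists p. Qed.

Lemma bQh0_sub k GP : @bQh0 R d T k GP `<=` bQh k.
Proof. by move=> q [q1 [q2 _]]. Qed.

(** The zero facet field meets both the boundary condition and the continuity constraint, so
    element-only tests are admissible for either method. *)
Lemma nofacet_bVh k m GD w : @Vh R d T k w -> bVh k m GD (nofacet w).
Proof. by move=> hw; split => //; have [h _] := submodset_Vbar k m GD; exact: h. Qed.

Lemma nofacet_linear a (w w' : evec T) : nofacet (a *: w + w') = a *: nofacet w + nofacet w'.
Proof.
rewrite /nofacet [RHS]surjective_pairing; congr pair.
apply: funext => F; apply: funext => i; apply: funext => x.
have E : 0 = a * 0 + 0 :> R by rewrite mulr0 addr0.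
exact: E.
Qed.

Lemma PolOn_eq0 l (A : set 'rV[R]_d) phi : PolOn l A phi -> (forall x, A x -> phi x = 0) ->
  phi = (fun=> 0).
Proof.
move=> [p _ ->] h; apply: funext => x; have := h x; rewrite /patch.
by case: ifP => // /set_mem Ax; exact.
Qed.

End Spaces.

(** * Definiteness of the norms and recovery of the unknowns from vanishing data *)

Section ZeroSets.
Variables (R : realType) (d' : nat).
Local Notation d := d'.+1.
Variable T : mesh R d.
Local Notation pol := (mpoly d R).

Lemma ipQ_ge0 (p : esca T) : 0 <= ipQ p p.
Proof.
by apply: sumr_ge0 => K _; apply: rVint_ge0 => x _; rewrite -expr2 sqr_ge0.
Qed.

Lemma ipQ_eq0 (p : esca T) : ipQ p p = 0 -> p = 0.
Proof.
have pos K : 0 <= rVint (cset K) (fun x => ev (p K) x * ev (p K) x).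
  by apply: rVint_ge0 => x _; rewrite -expr2 sqr_ge0.
move=> h; apply: funext => K.
have /eqP := h; rewrite psumr_eq0 => [/allP /(_ K (mem_index_enum _)) /implyP /(_ isT) /eqP E|//].
have : p K * p K = 0.
  apply: (rVint_eq0 (cset_bounded_borel K) (cset_nonnull K)).
    by move=> x _; rewrite evM -expr2 sqr_ge0.
  by rewrite -[RHS]E; apply: rVint_eq => x _; rewrite evM.
by move/eqP; rewrite mulf_eq0 orbb => /eqP.
Qed.

(** The sum of squares is one nonnegative polynomial, hence zero; each square then vanishes at every
    point. *)
Lemma sum_sqr_eq0 (A : set 'rV[R]_d) (J : finType) (p : J -> pol) :
  bounded_borel A -> nonnull A -> rVint A (fun x => \sum_j ev (p j) x * ev (p j) x) = 0 ->
  forall j, p j = 0.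
Proof.
move=> bA nA h j.
have E x : ev (\sum_j p j * p j) x = \sum_j ev (p j) x * ev (p j) x.
  by rewrite ev_sum; apply: eq_bigr => i _; rewrite evM.
have : \sum_j p j * p j = 0.
  apply: (rVint_eq0 bA nA).
    by move=> x _; rewrite E; apply: sumr_ge0 => i _; rewrite -expr2 sqr_ge0.
  by rewrite -[RHS]h; apply: rVint_eq => x _; rewrite E.
move=> s0; apply: (ev_eq0_open (@openT _) (I : setT 0)) => x _.
have /eqP := E x; rewrite s0 ev0 eq_sym psumr_eq0 => [/allP /(_ j (mem_index_enum _))|i _].
  by rewrite mulf_eq0 orbb => /eqP.
by rewrite -expr2 sqr_ge0.
Qed.

Lemma ipV_ge0 (u : evec T) : 0 <= ipV u u.
Proof.
apply: sumr_ge0 => K _; apply: rVint_ge0 => x _.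
by apply: sumr_ge0 => i _; rewrite -expr2 sqr_ge0.
Qed.

Lemma ipV_eq0 (u : evec T) : ipV u u = 0 -> u = 0.
Proof.
move=> /eqP; rewrite psumr_eq0 => [/allP h|K _]; last first.
  by apply: rVint_ge0 => x _; apply: sumr_ge0 => i _; rewrite -expr2 sqr_ge0.
apply: funext => K; apply: funext => i.
have /implyP /(_ isT) /eqP E := h K (mem_index_enum _).
exact: (sum_sqr_eq0 (cset_bounded_borel K) (cset_nonnull K) E).
Qed.

Lemma ipeps_ge0 (u : evec T) : 0 <= ipeps u u.
Proof.
apply: sumr_ge0 => K _; apply: rVint_ge0 => x _.
by do 2 (apply: sumr_ge0 => ? _); rewrite -expr2 sqr_ge0.
Qed.

Lemma ipeps_eq0 (u : evec T) : ipeps u u = 0 -> forall K i j, eps (u K) i j = 0.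
Proof.
move=> /eqP; rewrite psumr_eq0 => [/allP h K i j|K _]; last first.
  by apply: rVint_ge0 => x _; do 2 (apply: sumr_ge0 => ? _); rewrite -expr2 sqr_ge0.
have /implyP /(_ isT) /eqP E := h K (mem_index_enum _).
apply: (sum_sqr_eq0 (p := fun ij : 'I_d * 'I_d => eps (u K) ij.1 ij.2)
  (cset_bounded_borel K) (cset_nonnull K) _ (i, j)).
by rewrite -[RHS]E; apply: rVint_eq => x _; rewrite pair_big.
Qed.

Lemma hK_gt0 (K : cell T) : 0 < hK K.
Proof.
have card2 : (1 < #|val K|)%N by rewrite (cells_card (valP K)).
have [a [b [aK bK ab]]] : exists a b, [/\ a \in val K, b \in val K & a != b].
  by have /card_gt1P [a [b [? ? ?]]] := card2; exists a, b.
have vertK c : c \in val K -> cset K (vert c).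
  move=> cK; apply/csetP => e eK.
  by rewrite (bary_vert (cells_indep (valP K)) (baryP K)) // ler0n.
have pos : 0 < enorm (vert a - vert b).
  rewrite sqrtr_gt0 lt0r dot_ge0 andbT; apply/eqP => /dot_eq0 /eqP.
  rewrite subr_eq0 => /eqP E.
  have := bary_vert (cells_indep (valP K)) (baryP K) aK bK.
  rewrite -E (bary_vert (cells_indep (valP K)) (baryP K)) // eqxx (negPf ab).
  by move/eqP; rewrite oner_eq0.
apply: lt_le_trans pos _; apply: ub_le_sup; last by exists (vert a), (vert b); split => //; exact: vertK.
(* A supremum dominates its elements only if the set is bounded; bounded coordinates bound the
   distances. *)
have [_ [M hM]] := cset_bounded_borel K.
exists (Num.sqrt (\sum_(i < d) (M + M) ^+ 2)) => r [y [z [Ky Kz ->]]].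
rewrite ler_wsqrtr // /dot; apply: ler_sum => i _.
rewrite -expr2 -real_normK ?num_real //; apply: lerXn2r; rewrite ?nnegrE //.
  by rewrite addr_ge0 // (le_trans (normr_ge0 _) (hM y Ky i)).
by rewrite !mxE; apply: le_trans (ler_normB _ _) _; apply: lerD; exact: hM.
Qed.

Lemma energy_ge0 (v : evec T * fvec T) : 0 <= energy v.
Proof.
apply: addr_ge0; first exact: ipeps_ge0.
apply: sumr_ge0 => K _; apply: mulr_ge0; first by rewrite invr_ge0 ltW // hK_gt0.
apply: sumr_ge0 => F _; apply: fint_ge0 => x _.
by apply: sumr_ge0 => i _; exact: sqr_ge0.
Qed.

Lemma energy_eq0 (v : evec T * fvec T) : fvec_poly v -> energy v = 0 ->
  (forall K i j, eps (v.1 K) i j = 0) /\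
  (forall K F, inc F K -> forall i x, fset F x -> jmp v K F i x = 0).
Proof.
move=> hv /eqP.
have posF K F : 0 <= fint F (fun x => \sum_i jmp v K F i x ^+ 2).
  by apply: fint_ge0 => x _; apply: sumr_ge0 => i _; exact: sqr_ge0.
have posK K : 0 <= (hK K)^-1 * intbd K (fun F x => \sum_i jmp v K F i x ^+ 2).
  by apply: mulr_ge0; [rewrite invr_ge0 ltW // hK_gt0|apply: sumr_ge0 => F _; exact: posF].
rewrite paddr_eq0; [|exact: ipeps_ge0|by apply: sumr_ge0].
move=> /andP [/eqP /ipeps_eq0 h1]; rewrite psumr_eq0 // => /allP h2; split=> // K F FK i x Fx.
have := h2 K (mem_index_enum _); rewrite /= mulf_eq0 invr_eq0 gt_eqF ?hK_gt0 //=.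
rewrite /intbd psumr_eq0 // => /allP /(_ F (mem_index_enum _)); rewrite FK /= => /eqP I0.
have pj : poly_on (fset F) (fun x => \sum_i jmp v K F i x ^+ 2).
  by apply: poly_on_sum => j; apply: poly_onM; exact: poly_on_jmp.
have := fint_eq0 pj (fun x _ => sumr_ge0 _ (fun i _ => sqr_ge0 (jmp v K F i x))) I0 Fx.
move=> /eqP; rewrite psumr_eq0 => [/allP /(_ i (mem_index_enum _))|j _]; last exact: sqr_ge0.
by rewrite sqrf_eq0 => /eqP.
Qed.

Lemma cell_facet (K : cell T) : exists F : facet T, inc F K.
Proof.
have [a aK] : exists a, a \in val K.
  by apply/card_gt0P; rewrite (cells_card (valP K)).
pose F0 := finset.setD (val K) (finset.set1 a).
have F0K : F0 \subset val K by exact: finset.subD1set.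
have hF0 : F0 \in facets T.
  rewrite finset.inE; apply/andP; split.
    by have := finset.cardsD1 a (val K); rewrite aK (cells_card (valP K)) add1n => -[<-].
  by apply/existsP; exists (val K); rewrite (valP K).
by exists (exist _ F0 hF0).
Qed.

Section Propagation.
Variable Om : set 'rV[R]_d.
Hypotheses (hOm : polyhedral_domain Om) (hT : triangulates T Om).

(** The property carried from cell to cell is that [Q] holds on all facets of the cell; two cells
    with d common vertices share a facet, from which [step] continues in the second cell. *)
Lemma facet_propagation (Q : facet T -> Prop) :
  (forall K F, inc F K -> Q F -> forall F', inc F' K -> Q F') ->
  (exists F, Q F) -> forall F, Q F.
Proof.
move=> step [F0 QF0] F.
have [K FK] := facet_cell F; have [K0 F0K0] := facet_cell F0.
have [[Oo Oc _] [Or _ _]] := hOm.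
suff : forall K K' : cell T, (forall F, inc F K -> Q F) -> forall F, inc F K' -> Q F.
  by move=> /(_ K0 K (step _ _ F0K0 QF0) F FK).
apply: (facet_connected Oo Oc Or hT (P := fun K => forall F, inc F K -> Q F)).
move=> K1 K2 QK1 card12.
have sub1 : finset.setI (val K1) (val K2) \subset val K1 by exact: finset.subsetIl.
have hF : finset.setI (val K1) (val K2) \in facets T.
  rewrite finset.inE card12 eqxx; apply/existsP; exists (val K1).
  by rewrite (valP K1).
pose G : facet T := exist (fun F => F \in facets T) _ hF.
move=> F' F'K2; apply: (step K2 G _ _ F' F'K2); first exact: finset.subsetIr.
exact: QK1.
Qed.

Lemma displacement_eq0 k m GD (u : evec T * fvec T) : borel GD -> (0 < surf T GD)%E ->
  bVh k m GD u -> (forall K i j, eps (u.1 K) i j = 0) ->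
  (forall K F, inc F K -> forall i x, fset F x -> jmp u K F i x = 0) -> u = 0.
Proof.
move=> mGD GD0 hu eps0 jmp0; have hup := bVh_poly hu.
have [_ /Vbar_sub_hdg huD] := hu.
have uE K F : inc F K -> forall i x, fset F x -> u.2 F i x = ev (u.1 K i) x.
  by move=> FK i x Fx; have := jmp0 K F FK i x Fx; rewrite /jmp => /eqP; rewrite subr_eq0 => /eqP.
have step K F : inc F K -> (forall i x, fset F x -> u.2 F i x = 0) -> forall i, u.1 K i = 0.
  move=> FK uF; apply: (rigid_step FK (eps0 K)) => i x Fx.
  by rewrite -(uE K F) // uF.
have zero : forall F i x, fset F x -> u.2 F i x = 0.
  apply: facet_propagation => [K F FK uF F' F'K i x Fx|].
    by rewrite (uE K) // (step K F) // ev0.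
  have [F GF] := surf_gt0 GD0; exists F => i.
  by apply: (vanishes_on_facet mGD GF (hup F i)); have [] := huD F i.
rewrite [u]surjective_pairing; congr pair.
  apply: funext => K; apply: funext => i; have [F FK] := cell_facet K.
  exact: (step K F FK (zero F)).
apply: funext => F; apply: funext => i.
by have [h _] := huD F i; exact: (PolOn_eq0 h (zero F i)).
Qed.

(** With no facet component, the jumps seen from the other cells are zero; this turns the global
    equations into local ones. *)
Lemma b_h_single (K : cell T) (v : 'I_d -> pol) (q : esca T * fsca T) :
  b_h (nofacet (fun K' => if K' == K then v else 0)) q =
  - rVint (cset K) (fun x => ev (q.1 K) x * ev (divg v) x) +
  intbd K (fun F x => q.2 F x * \sum_i ev (v i) x * normal K F 0 i).
Proof.
rewrite /b_h; congr (- _ + _).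
  rewrite /intOm (bigD1 K) //= eqxx big1 ?addr0 // => K' /negPf K'K.
  rewrite rVint0 // => x _; rewrite K'K /divg big1 ?ev0 ?mulr0 // => i _.
  by rewrite mderiv0.
rewrite (bigD1 K) //= [X in _ + X]big1 ?addr0 => [|K' /negPf K'K]; last first.
  rewrite /intbd big1 // => F _; apply: fint0 => x _.
  by rewrite big1 ?mulr0 // => i _; rewrite /jmp /= K'K ev0 subr0 mul0r.
apply: intbd_eq => F x; congr (_ * _); apply: eq_bigr => i _.
by rewrite /jmp /= eqxx subr0.
Qed.

Lemma single_Vh k (K : cell T) (v : 'I_d -> pol) : (forall i, Pol k (v i)) ->
  Vh k (fun K' : cell T => if K' == K then v else 0).
Proof. by move=> vk K' i; case: ifP => // _; exact: Pol0. Qed.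

(** The hypothesis on [b_h] is the Darcy equation with z = 0. The mass equation does not enter,
    which is why c_0 = 0 is allowed. *)
Lemma pressure_eq0 k GP (p : esca T * fsca T) : borel GP -> (0 < surf T GP)%E -> bQh0 k.+1 GP p ->
  (forall w, Vh k.+1 w -> b_h (nofacet w) p = 0) -> p = 0.
Proof.
move=> mGP GP0 hp test; have [p1 [p2 p2v]] := hp.
have hpp := bQh_poly (bQh0_sub hp).
have step K F (FK : inc F K) (pF : forall x, fset F x -> p.2 F x = 0) :
    p.1 K = 0 /\ forall F', inc F' K -> forall x, fset F' x -> p.2 F' x = 0.
  apply: (pressure_step (k := k) _ _ _ FK pF) => // v vk.
  by rewrite -b_h_single test //; exact: single_Vh.
have zero : forall F x, fset F x -> p.2 F x = 0.
  apply: facet_propagation => [K F FK pF F' F'K|].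
    by have [_ h] := step K F FK pF; exact: h.
  have [F GF] := surf_gt0 GP0; exists F.
  exact: (vanishes_on_facet mGP GF (hpp F)).
rewrite [p]surjective_pairing; congr pair.
  apply: funext => K; have [F FK] := cell_facet K.
  by have [] := step K F FK (zero F).
by apply: funext => F; exact: (PolOn_eq0 (p2 F) (zero F)).
Qed.

(** No boundary condition could start a propagation here; instead the element part is already zero
    in every cell, so [face_test] applies in each cell separately. *)
Lemma total_pressure_eq0 k (q : esca T * fsca T) : bQh k.+1 q -> q.1 = 0 ->
  (forall w, Vh k.+1 w -> b_h (nofacet w) q = 0) -> q = 0.
Proof.
move=> [_ q2] q10 test.
rewrite [q]surjective_pairing q10; congr pair; apply: funext => F.
have [K FK] := facet_cell F.
apply: (PolOn_eq0 (q2 F)); apply: (face_test _ _ FK) => // v vk.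
have := test _ (@single_Vh k.+1 K v vk); rewrite b_h_single q10 rVint0 ?oppr0 ?add0r //.
by move=> x _; rewrite ev0 mul0r.
Qed.

End Propagation.

End ZeroSets.

(** * Well-posedness *)

Section PairProjections.
Variables (F : pzRingType) (V W : lmodType F).

Lemma fst_linear (a : F) (u v : V * W) : (a *: u + v).1 = a *: u.1 + v.1.
Proof. by []. Qed.

Lemma snd_linear (a : F) (u v : V * W) : (a *: u + v).2 = a *: u.2 + v.2.
Proof. by []. Qed.

End PairProjections.

Section WellPosedness.
Variables (R : realType) (d' : nat).
Local Notation d := d'.+1.
Variables (T : mesh R d) (Om GP GD : set 'rV[R]_d).
Hypotheses (hOm : polyhedral_domain Om) (hT : triangulates T Om).
Hypotheses (mGP : borel GP) (mGD : borel GD).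
Hypotheses (GP0 : (0 < surf T GP)%E) (GD0 : (0 < surf T GD)%E).
Variables (dt kappa c0 alpha lam mu beta c : R) (k : nat) (m : method).
Hypotheses (dt0 : 0 < dt) (kappa0 : 0 < kappa) (c00 : 0 <= c0) (lam0 : 0 < lam).
Hypotheses (mu0 : 0 < mu) (c_gt0 : 0 < c).
Hypothesis coer : forall v : evec T * fvec T, bVh k.+1 m GD v ->
  c * mu * energy v <= a_h beta mu v v.

Local Notation X := (Xcarrier T).

Definition momentum_form (x : X) (v : evec T * fvec T) : R :=
  a_h beta mu x.1.1.1 v + b_h v x.1.1.2.
Definition total_pressure_form (x : X) (q : esca T * fsca T) : R :=
  b_h x.1.1.1 q + lam^-1 * ipQ (comb alpha x.2.1 x.1.1.2.1) q.1.
Definition darcy_form (x : X) (w : evec T) : R :=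
  kappa^-1 * ipV x.1.2 w + b_h (nofacet w) x.2.
Definition mass_form (x : X) (q : esca T * fsca T) : R :=
  dt^-1 * (ipQ (scale c0 x.2.1) q.1
           + lam^-1 * ipQ (comb alpha x.2.1 x.1.1.2.1) (scale alpha q.1))
  - b_h (nofacet x.1.2) q.

Lemma scale_linear a : forall b (u v : esca T), scale a (b *: u + v) = b *: scale a u + scale a v.
Proof.
move=> b u v; apply: funext => K.
transitivity (a *: (b *: u K + v K)); first by [].
by rewrite scalerDr scalerA mulrC -scalerA.
Qed.

Lemma comb_linear a : forall b (u v u' v' : esca T),
  comb a (b *: u + v) (b *: u' + v') = b *: comb a u u' + comb a v v'.
Proof.
move=> b u v u' v'; apply: funext => K.
transitivity (a *: (b *: u K + v K) - (b *: u' K + v' K)); first by [].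
transitivity (b *: (a *: u K - u' K) + (a *: v K - v' K)); last by [].
by rewrite scalerDr scalerA mulrC -scalerA scalerBr opprD addrACA.
Qed.

Lemma Xh_poly (x : X) : Xh k.+1 m GD GP x ->
  [/\ fvec_poly x.1.1.1, fsca_poly x.1.1.2 & fsca_poly x.2].
Proof.
move=> [[[h1 h2] _] h4]; split; first exact: bVh_poly h1.
  exact: bQh_poly h2.
exact: bQh_poly (bQh0_sub h4).
Qed.

Lemma submodset_fvec_poly : submodset (V := (evec T * fvec T)%type) (@fvec_poly R d' T).
Proof.
split=> [F i|a u v hu hv F i]; first exact: poly_on_cst.
have [p hp] := hu F i; have [q hq] := hv F i.
by exists (a *: p + q) => x Fx; rewrite evD evZ -hp // -hq.
Qed.

Lemma nofacet_poly w : fvec_poly (@nofacet R d T w).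
Proof. by move=> F i; exact: poly_on_cst. Qed.

(* Testing with (u, p_T, z, p) itself, the coupling terms cancel and leave
   c_0 |p|^2 + |alpha p - p_T|^2 / lam + a_h(u, u) + (dt / kappa) |z|^2 = 0. *)
Lemma homogeneous_eq0 (x : X) : Xh k.+1 m GD GP x ->
  (forall y, bVh k.+1 m GD y -> momentum_form x y = 0) ->
  (forall y, bQh k.+1 y -> total_pressure_form x y = 0) ->
  (forall y, Vh k.+1 y -> darcy_form x y = 0) ->
  (forall y, bQh0 k.+1 GP y -> mass_form x y = 0) -> x = 0.
Proof.
case: x => [[[u pT] z] p] [[[hu hpT] hz] hp].
rewrite /momentum_form /total_pressure_form /darcy_form /mass_form /=.
move=> e1 e2 e3 e4.
pose r := comb alpha p.1 pT.1.
have E1 := e1 u hu; have E2 := e2 pT hpT; have E3 := e3 z hz; have E4 := e4 p hp.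
(* From alpha p = r + p_T: the first part gives the square of [r], the second the coupling that the
   total pressure equation converts. *)
have Er : ipQ r (scale alpha p.1) = ipQ r r + ipQ r pT.1.
  rewrite ipQC (ipQC r pT.1) -[ipQ r r]mul1r -ipQ_linear //; congr (ipQ _ _).
  by apply: funext => K; rewrite scale1r /GRing.add /= /r /comb /scale subrK.
have Ec : ipQ (scale c0 p.1) p.1 = c0 * ipQ p.1 p.1.
  have -> : scale c0 p.1 = c0 *: p.1 + 0 :> esca T by rewrite addr0.
  rewrite ipQ_linear // [ipQ 0 _](_ : _ = 0) ?addr0 //.
  by rewrite /ipQ /intOm big1 // => K _; rewrite rVint0 // => y _; rewrite ev0 mul0r.
rewrite -/r in E2 E4; rewrite Er Ec in E4.
have A0 : 0 <= a_h beta mu u u.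
  by apply: le_trans (coer hu); rewrite mulr_ge0 ?energy_ge0 // mulr_ge0 // ltW.
set A := a_h _ _ _ _ in E1 A0; set bu := b_h u pT in E1 E2.
set bz := b_h (nofacet z) p in E3 E4.
have P0 := ipQ_ge0 p.1; have r0 := ipQ_ge0 r; have z0 := ipV_ge0 z.
set P := ipQ p.1 p.1 in E4 P0; set Q := ipQ r r in E4 r0; set Z := ipV z z in E3 z0.
set W := ipQ r pT.1 in E2 E4.
have li : 0 < lam^-1 by rewrite invr_gt0.
have di : 0 < dt^-1 by rewrite invr_gt0.
have ki : 0 < kappa^-1 by rewrite invr_gt0.
(* The momentum and total pressure equations give A = W / lam, and the Darcy equation replaces -[bz]
   by the dissipation; the mass equation becomes a sum of nonnegative terms. *)
have S : dt^-1 * (c0 * P + (lam^-1 * Q + A)) + kappa^-1 * Z = 0.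
  have -> : A = lam^-1 * W by lra.
  have -> : kappa^-1 * Z = - bz by lra.
  by rewrite -[RHS]E4; ring.
have t1 : 0 <= c0 * P by exact: mulr_ge0.
have t2 : 0 <= lam^-1 * Q by rewrite mulr_ge0 // ltW.
have t3 : 0 <= kappa^-1 * Z by rewrite mulr_ge0 // ltW.
have t4 : 0 <= lam^-1 * Q + A by exact: addr_ge0.
have t5 : 0 <= dt^-1 * (c0 * P + (lam^-1 * Q + A)).
  by apply: mulr_ge0; [exact: ltW|exact: addr_ge0].
move: S => /eqP; rewrite (paddr_eq0 t5 t3) mulf_eq0 (gt_eqF di) (paddr_eq0 t1 t4) /=.
rewrite (paddr_eq0 t2 A0) !mulf_eq0 (gt_eqF li) (gt_eqF ki) /=.
(* The vanishing of [c0 * P] is discarded: it says nothing about [p] when c_0 = 0. *)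
move=> /andP [/andP [_ /andP [/eqP Q0 /eqP Au]] /eqP Z0].
have z_eq0 : z = 0 by exact: ipV_eq0.
have r_eq0 : r = 0 by exact: ipQ_eq0.
have en0 : energy u = 0.
  apply/eqP; rewrite eq_le energy_ge0 andbT.
  have := coer hu; rewrite -/A Au pmulr_rle0 ?mulr_gt0 //.
have [eps0 jmp0] := energy_eq0 (bVh_poly hu) en0.
have u_eq0 : u = 0 := displacement_eq0 hOm hT mGD GD0 hu eps0 jmp0.
have p_eq0 : p = 0.
  apply: (pressure_eq0 hOm hT mGP GP0 hp) => w hw; have := e3 w hw.
  have -> : ipV z w = 0.
    rewrite z_eq0 /ipV /intOm big1 // => K _; rewrite rVint0 // => y _.
    by rewrite big1 // => i _; rewrite ev0 mul0r.
  by rewrite mulr0 add0r.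
have pT10 : pT.1 = 0.
  apply: funext => K; have /(congr1 (fun f => f K)) := r_eq0.
  rewrite /r /comb p_eq0 => /eqP; rewrite subr_eq0 => /eqP <-.
  exact: scaler0.
have pT_eq0 : pT = 0.
  apply: (total_pressure_eq0 hpT pT10) => w hw.
  have hw' := nofacet_bVh m GD hw.
  have := e1 (nofacet w) hw'; rewrite u_eq0.
  by rewrite (linear_on0 submodset_fvec_poly (a_h_linear beta mu (bVh_poly hw'))) add0r.
by rewrite u_eq0 p_eq0 z_eq0 pT_eq0.
Qed.

Variables (pTn pn : esca T * fsca T) (f : 'I_d -> 'rV[R]_d -> R) (g : 'rV[R]_d -> R).
Hypotheses (hf : forall j, L2 Om (f j)) (hg : L2 Om g).

Definition mass_rhs (q : esca T * fsca T) : R :=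
  dt^-1 * (ipQ (scale c0 pn.1) q.1
           + lam^-1 * ipQ (comb alpha pn.1 pTn.1) (scale alpha q.1))
  + ipL2Q Om g q.1.

(** [solves] tests the four equations with one common quadruple; filling the other three components
    with zero makes the equations independent. *)
Lemma solvesP (x : X) : solves k.+1 m Om GD GP beta lam mu alpha kappa c0 dt pTn pn f g x <->
  [/\ forall y, bVh k.+1 m GD y -> momentum_form x y = ipL2V Om f y.1,
    forall y, bQh k.+1 y -> total_pressure_form x y = 0,
    forall y, Vh k.+1 y -> darcy_form x y = 0 &
    forall y, bQh0 k.+1 GP y -> mass_form x y = mass_rhs y].
Proof.
case: x => [[[u pT] z] p]; split=> [sol|[e1 e2 e3 e4] [[[v qT] w] q] [[[hv hqT] hw] hq]].
  have V0 : bVh k.+1 m GD (0 : evec T * fvec T).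
    by have [] := submodset_prod (submodset_Vh T k.+1) (submodset_Vbar T k.+1 m GD).
  have Q0 : bQh k.+1 (0 : esca T * fsca T).
    by have [] := submodset_prod (submodset_Qh T k.+1) (submodset_Qbar T k.+1).
  have W0 : Vh k.+1 (0 : evec T) by have [] := submodset_Vh T k.+1.
  have QQ0 : bQh0 k.+1 GP (0 : esca T * fsca T).
    by have [] := submodset_prod (submodset_Qh T k.+1) (submodset_Qbar0 T k.+1 GP).
  split=> y hy.
  - by have [] := sol (y, 0, 0, 0) (conj (conj (conj hy Q0) W0) QQ0).
  - by have [] := sol (0, y, 0, 0) (conj (conj (conj V0 hy) W0) QQ0).
  - by have [] := sol (0, 0, y, 0) (conj (conj (conj V0 Q0) hy) QQ0).
  - by have [] := sol (0, 0, 0, y) (conj (conj (conj V0 Q0) W0) hy).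
by split; [exact: e1|exact: e2|exact: e3|exact: e4].
Qed.

Local Notation S1 := (bVh k.+1 m GD : set (evec T * fvec T)).
Local Notation S2 := (bQh k.+1 : set (esca T * fsca T)).
Local Notation S3 := (Vh k.+1 : set (evec T)).
Local Notation S4 := (bQh0 k.+1 GP : set (esca T * fsca T)).
Local Notation S := (Xh k.+1 m GD GP : set X).
Local Notation linear_onX := (linear_on (V := X)).
Local Notation linear_onV := (linear_on (V := (evec T * fvec T)%type)).
Local Notation linear_onW := (linear_on (V := evec T)).
Local Notation linear_onQ := (linear_on (V := (esca T * fsca T)%type)).

Lemma momentum_form_linear_l v : S1 v -> linear_onX S (momentum_form^~ v).
Proof.
move=> hv; have hvp := bVh_poly hv.
move=> a x y hx hy; have [hx1 hx2 _] := Xh_poly hx; have [hy1 hy2 _] := Xh_poly hy.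
by rewrite /momentum_form !(fst_linear, snd_linear) (a_h_linear beta mu hvp) // (b_h_linear_r hvp) //; ring.
Qed.

Lemma total_pressure_form_linear_l q : S2 q -> linear_onX S (total_pressure_form^~ q).
Proof.
move=> hq; have hqp := bQh_poly hq.
move=> a x y hx hy; have [hx1 _ _] := Xh_poly hx; have [hy1 _ _] := Xh_poly hy.
by rewrite /total_pressure_form !(fst_linear, snd_linear) (b_h_linear_l hqp) // comb_linear ipQ_linear //; ring.
Qed.

Lemma darcy_form_linear_l w : linear_onX S (darcy_form^~ w).
Proof.
move=> a x y hx hy; have [_ _ hx2] := Xh_poly hx; have [_ _ hy2] := Xh_poly hy.
by rewrite /darcy_form !(fst_linear, snd_linear) (b_h_linear_r (nofacet_poly w)) // ipV_linear //; ring.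
Qed.

Lemma mass_form_linear_l q : S4 q -> linear_onX S (mass_form^~ q).
Proof.
move=> hq; have hqp := bQh_poly (bQh0_sub hq).
move=> a x y hx hy.
rewrite /mass_form !(fst_linear, snd_linear) comb_linear scale_linear !ipQ_linear // nofacet_linear.
rewrite (b_h_linear_l hqp); [|exact: nofacet_poly|exact: nofacet_poly].
by ring.
Qed.

Lemma momentum_form_linear_r x : S x -> linear_onV S1 (momentum_form x).
Proof.
move=> hx; have [hx1 hx2 _] := Xh_poly hx; apply: linear_onD.
  move=> a u v hu hv; rewrite !(a_hC _ _ x.1.1.1).
  by apply: (a_h_linear beta mu hx1); [exact: bVh_poly hu|exact: bVh_poly hv].
by move=> a u v hu hv; apply: (b_h_linear_l hx2); [exact: bVh_poly hu|exact: bVh_poly hv].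
Qed.

Lemma ipQ_linear_r (A : set (esca T * fsca T)) (r : esca T) :
  linear_onQ A (fun q => ipQ r q.1).
Proof. by move=> a u v _ _; rewrite !(ipQC r) -ipQ_linear. Qed.

Lemma ipQ_scale_linear_r (A : set (esca T * fsca T)) (r : esca T) :
  linear_onQ A (fun q => ipQ r (scale alpha q.1)).
Proof. by move=> a u v _ _; rewrite !(ipQC r) -ipQ_linear // -scale_linear. Qed.

Lemma total_pressure_form_linear_r x : S x -> linear_onQ S2 (total_pressure_form x).
Proof.
move=> hx; have [hx1 _ _] := Xh_poly hx.
apply: linear_onD; last by apply: linear_onZ; exact: ipQ_linear_r.
by move=> a u v hu hv; apply: (b_h_linear_r hx1); [exact: bQh_poly hu|exact: bQh_poly hv].
Qed.

Lemma darcy_form_linear_r x : S x -> linear_onW S3 (darcy_form x).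
Proof.
move=> hx; have [_ _ hx2] := Xh_poly hx; apply: linear_onD.
  by apply: linear_onZ => a u v _ _; rewrite !(ipVC x.1.2) ipV_linear.
move=> a u v _ _; rewrite nofacet_linear.
by apply: (b_h_linear_l hx2); exact: nofacet_poly.
Qed.

Lemma mass_form_linear_r x : linear_onQ S4 (mass_form x).
Proof.
apply: linear_onD; last first.
  apply: linear_onN => a u v hu hv; apply: (b_h_linear_r (nofacet_poly _)).
    exact: bQh_poly (bQh0_sub hu).
  exact: bQh_poly (bQh0_sub hv).
apply: linear_onZ; apply: linear_onD; first exact: ipQ_linear_r.
by apply: linear_onZ; exact: ipQ_scale_linear_r.
Qed.

Lemma mass_rhs_linear : linear_onQ S4 mass_rhs.
Proof.
apply: linear_onD; last by move=> a u v _ _; rewrite -(ipL2Q_linear hg).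
apply: linear_onZ; apply: linear_onD; first exact: ipQ_linear_r.
by apply: linear_onZ; exact: ipQ_scale_linear_r.
Qed.

Lemma momentum_rhs_linear : linear_onV S1 (fun v => ipL2V Om f v.1).
Proof. by move=> a u v _ _; rewrite -(ipL2V_linear hf). Qed.

Lemma zero_linear (V : lmodType R) (A : set V) : linear_on A (fun=> 0).
Proof. by move=> a u v _ _; rewrite mulr0 addr0. Qed.

Lemma fspan_bVh : fspan S1.
Proof. exact: fspan_prod (fspan_Vh T k.+1) (fspan_Vbar T k.+1 m GD). Qed.

Lemma fspan_bQh : fspan S2.
Proof. exact: fspan_prod (fspan_Qh T k.+1) (fspan_Qbar T k.+1). Qed.

Lemma fspan_bQh0 : fspan S4.
Proof. by apply: fspanS fspan_bQh => q hq; exact: bQh0_sub hq. Qed.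

Lemma well_posed_forms : exists! x : X, S x /\
  [/\ forall y, S1 y -> momentum_form x y = ipL2V Om f y.1,
    forall y, S2 y -> total_pressure_form x y = 0,
    forall y, S3 y -> darcy_form x y = 0 &
    forall y, S4 y -> mass_form x y = mass_rhs y].
Proof.
apply: (@variational_system R (evec T * fvec T)%type (esca T * fsca T)%type (evec T)
  (esca T * fsca T)%type S1 S2 S3 S4 momentum_form total_pressure_form darcy_form mass_form
  (fun v => ipL2V Om f v.1) (fun=> 0) (fun=> 0) mass_rhs).
- exact: submodset_prod (submodset_Vh T k.+1) (submodset_Vbar T k.+1 m GD).
- exact: submodset_prod (submodset_Qh T k.+1) (submodset_Qbar T k.+1).
- exact: submodset_Vh.
- exact: submodset_prod (submodset_Qh T k.+1) (submodset_Qbar0 T k.+1 GP).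
- exact: fspan_bVh.
- exact: fspan_bQh.
- exact: fspan_Vh.
- exact: fspan_bQh0.
- exact: momentum_form_linear_l.
- exact: total_pressure_form_linear_l.
- by move=> w _; exact: darcy_form_linear_l.
- exact: mass_form_linear_l.
- exact: momentum_form_linear_r.
- exact: total_pressure_form_linear_r.
- exact: darcy_form_linear_r.
- by move=> x _; exact: mass_form_linear_r.
- exact: momentum_rhs_linear.
- exact: zero_linear.
- exact: zero_linear.
- exact: mass_rhs_linear.
- exact: homogeneous_eq0.
Qed.

Lemma well_posed : exists! x : X, Xh k.+1 m GD GP x /\
  solves k.+1 m Om GD GP beta lam mu alpha kappa c0 dt pTn pn f g x.
Proof.
have [x [[Sx hx] ux]] := well_posed_forms; exists x; split.
  by split => //; exact/solvesP.
by move=> y [Sy /solvesP hy]; apply: ux.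
Qed.

End WellPosedness.

Theorem theorem2 (R : realType) (d : nat) (hd : d = 2%N \/ d = 3%N)
  (Om GP GF GD GT : set 'rV[R]_d)
  (hOm : polyhedral_domain Om)
  (hPF : bdry_partition Om GP GF)
  (hDT : bdry_partition Om GD GT)
  (I : Type) (Th : I -> mesh R d)
  (hTh : forall i, triangulates (Th i) Om)
  (hreg : shape_regular Th)
  (hcPF : forall i, compatible (Th i) Om GP GF)
  (hcDT : forall i, compatible (Th i) Om GD GT)
  (hGP : forall i, (0 < surf (Th i) GP)%E)
  (hGD : forall i, (0 < surf (Th i) GD)%E)
  (dt kappa c0 alpha E nu nustar lam mu : R)
  (hdt : 0 < dt) (hkappa : 0 < kappa) (hc0 : 0 <= c0)
  (halpha : 0 < alpha < 1)
  (hnustar : 0 < nustar) (hnu : nustar <= nu) (hnu2 : nu < 2^-1)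
  (hlam : lam = E * nu / ((1 + nu) * (1 - 2 * nu))) (hlam0 : 0 < lam)
  (hmu : mu = E / (2 * (1 + nu))) (hmu0 : 0 < mu)
  (k : nat) (hk : (1 <= k)%N) (m : method)
  (beta0 beta : R) (hbeta0 : 0 < beta0)
  (hcoer : forall b : R, beta0 < b ->
     exists2 c : R, 0 < c & forall i (v : evec (Th i) * fvec (Th i)),
       bVh k m GD v -> c * mu * energy v <= a_h b mu v v)
  (hbeta : beta0 < beta)
  (i : I)
  (pTn pn : esca (Th i) * fsca (Th i))
  (hpTn : bQh k pTn) (hpn : bQh0 k GP pn)
  (f : 'I_d -> 'rV[R]_d -> R) (hf : forall j, L2 Om (f j))
  (g : 'rV[R]_d -> R) (hg : L2 Om g) :
  exists! X : Xcarrier (Th i),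
    Xh k m GD GP X /\
    solves k m Om GD GP beta lam mu alpha kappa c0 dt pTn pn f g X.
Proof.
have [d' dE] : exists d', d = d'.+1 by case: hd => ->; [exists 1%N|exists 2%N].
(* Writing k as a successor turns the predecessor in [Qh] into an honest degree, one below that of
   the velocities. *)
subst d; case: k hk hcoer hpTn hpn => // k' _ hcoer' _ _.
have [c c_gt0 coer] := hcoer' beta hbeta.
have [mGP _ _ _] := hPF; have [mGD _ _ _] := hDT.
exact: (well_posed hOm (hTh i) mGP mGD (hGP i) (hGD i) alpha hdt hkappa hc0 hlam0 hmu0 c_gt0
  (coer i) pTn pn hf hg).
Qed.
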